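(* Let $(\mathcal{A},m)$ be a nonempty multiarrangement in an $\ell$-dimensional vector space $V$ over a field $\mathbb{K}$ with $\ell\ge2$, let $H_0\in\mathcal{A}$, and let $(\mathcal{A},m),(\mathcal{A}',m'),(\mathcal{A}'',m^* )$ be the triple with respect to $H_0$. Let $d_1,\ldots,d_\ell$ be integers (in no particular order). Then any two of the following statements imply the third: (i) $(\mathcal{A},m)$ is free with $\exp(\mathcal{A},m)=(d_1,\ldots,d_{\ell-1},d_\ell)$. (ii) $(\mathcal{A}',m')$ is free with $\exp(\mathcal{A}',m')=(d_1,\ldots,d_{\ell-1},d_\ell-1)$. (iii) $(\mathcal{A}'',m^* )$ is free with $\exp(\mathcal{A}'',m^* )=(d_1,\ldots,d_{\ell-1})$. (Equalities of exponents are equalities of multisets.)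
   Context: Let $\mathbb{K}$ be a field, $V$ an $\ell$-dimensional $\mathbb{K}$-vector space, $S=\mathrm{Sym}(V^* )\cong\mathbb{K}[x_1,\ldots,x_\ell]$, and $\mathrm{Der}_{\mathbb{K}}(S)=\bigoplus_i S\,\partial_{x_i}$ the $S$-module of $\mathbb{K}$-linear derivations of $S$. An arrangement is a finite set $\mathcal{A}$ of hyperplanes of $V$, all containing the origin; for each $H\in\mathcal{A}$ fix a linear form $\alpha_H$ with $H=\ker\alpha_H$. A multiarrangement $(\mathcal{A},m)$ is an arrangement with a multiplicity $m:\mathcal{A}\to\mathbb{Z}_{>0}$. Define $D(\mathcal{A},m)=\{\theta\in\mathrm{Der}_{\mathbb{K}}(S)\mid\theta(\alpha_H)\in\alpha_H^{m(H)}S\text{ for all }H\in\mathcal{A}\}$; $(\mathcal{A},m)$ is free if $D(\mathcal{A},m)$ is a free $S$-module. A nonzero derivation $\theta=\sum f_i\partial_{x_i}$ is homogeneous of degree $p$ if each $f_i$ is zero or homogeneous of degree $p$. If $(\mathcal{A},m)$ is free, $\exp(\mathcal{A},m)$ is the multiset of degrees of a homogeneous basis of $D(\mathcal{A},m)$ (independent of the basis). Triple with respect to $H_0\in\mathcal{A}$, with $\alpha_0=\alpha_{H_0}$: Deletion $(\mathcal{A}',m')$: if $m(H_0)=1$, then $\mathcal{A}'=\mathcal{A}\setminus\{H_0\}$ and $m'=m|_{\mathcal{A}'}$; if $m(H_0)\ge2$, then $\mathcal{A}'=\mathcal{A}$, $m'(H)=m(H)$ for $H\ne H_0$, and $m'(H_0)=m(H_0)-1$.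 Restriction $(\mathcal{A}'',m^* )$: $\mathcal{A}''=\{H_0\cap K\mid K\in\mathcal{A}\setminus\{H_0\}\}$, an arrangement in the vector space $H_0$, and $m^*$ is the Euler multiplicity: for $X\in\mathcal{A}''$ put $\mathcal{A}_X=\{H\in\mathcal{A}\mid X\subset H\}$, $m_X=m|_{\mathcal{A}_X}$, and choose coordinates so that $X=\{x_1=x_2=0\}$; then $D(\mathcal{A}_X,m_X)$ has a homogeneous basis $\theta_X,\psi_X,\partial_{x_3},\ldots,\partial_{x_\ell}$ with $\theta_X\notin\alpha_0\mathrm{Der}_{\mathbb{K}}(S)$ and $\psi_X\in\alpha_0\mathrm{Der}_{\mathbb{K}}(S)$, and $m^*(X):=\deg\theta_X$. *)

(* Defs.v *)
From HB Require Import structures.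
From mathcomp Require Import all_boot all_order all_algebra finmap.
From mathcomp Require Import mpoly.
From Stdlib Require Import ClassicalEpsilon.

Set Implicit Arguments.
Unset Strict Implicit.
Unset Printing Implicit Defensive.

Import GRing.Theory.

Local Open Scope fset_scope.
Local Open Scope ring_scope.

Section FreeModules.

Variables (S : nzRingType) (M : lmodType S).

Definition is_basis (D : M -> Prop) (B : seq M) : Prop :=
  (forall x, D x <->
     exists c : 'I_(size B) -> S, x = \sum_(i < size B) c i *: B`_i) /\
  (forall c : 'I_(size B) -> S,
     \sum_(i < size B) c i *: B`_i = 0 -> forall i, c i = 0).

Definition is_free_module (D : M -> Prop) : Prop :=
  exists B : seq M, is_basis D B.

End FreeModules.

Section Derivations.

Variables (K : fieldType) (l : nat).

(* The derivation \sum_i f_i d/dx_i of K[x_1, ..., x_l] is represented by the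
   row (f_1, ..., f_l). *)
Definition Der := 'rV[{mpoly K[l]}]_l.

Definition der_app (theta : Der) (f : {mpoly K[l]}) : {mpoly K[l]} :=
  \sum_(i < l) theta 0 i * f^`M(i).

Definition partial (i : 'I_l) : Der := delta_mx 0 i.

Definition der_homog (p : nat) (theta : Der) : bool :=
  (theta != 0) && [forall i, theta 0 i \is p.-homog].

(* The exponents are compared as integers: some entry of es may be negative,
   in which case this is false. *)
Definition has_exponents (D : Der -> Prop) (es : seq int) : Prop :=
  exists (B : seq Der) (ps : seq nat),
    [/\ is_basis D B, all2 der_homog ps B & perm_eq [seq p%:Z | p <- ps] es].

End Derivations.

Section Arrangements.

Variables (K : fieldType) (V : vectType K).

Definition is_multiarrangement (A : {fset {vspace V}}) (m : {vspace V} -> nat) :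
  Prop :=
  forall H, H \in A -> (\dim H).+1 = \dim {:V} /\ (0 < m H)%N.

(* A fixed linear form with kernel H; it exists when H is a hyperplane. *)
Definition alpha (H : {vspace V}) : 'Hom(V, K^o) :=
  epsilon (inhabits 0) (fun a => lker a = H).

(* The identification Sym(V^* ) = K[x_1, ..., x_l], where (x_i) is the basis of
   V^* dual to the basis e of V. *)
Definition form_mpoly (l : nat) (e : l.-tuple V) (a : 'Hom(V, K^o)) :
  {mpoly K[l]} :=
  \sum_(i < l) (a (tnth e i) : K) *: 'X_i.

Definition log_der (l : nat) (e : l.-tuple V) (A : {fset {vspace V}})
    (m : {vspace V} -> nat) (theta : Der K l) : Prop :=
  forall H, H \in A ->
    exists g : {mpoly K[l]},
      der_app theta (form_mpoly e (alpha H)) =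
      form_mpoly e (alpha H) ^+ m H * g.

Definition free_with_exp (l : nat) (e : l.-tuple V) (A : {fset {vspace V}})
    (m : {vspace V} -> nat) (es : seq int) : Prop :=
  is_free_module (log_der e A m) /\ has_exponents (log_der e A m) es.

Definition deletion (A : {fset {vspace V}}) (m : {vspace V} -> nat)
    (H0 : {vspace V}) : {fset {vspace V}} :=
  if m H0 == 1%N then A `\ H0 else A.

(* When m H0 = 1, the value at H0 is irrelevant since H0 is deleted. *)
Definition deletion_mult (m : {vspace V} -> nat) (H0 : {vspace V}) :
  {vspace V} -> nat :=
  fun H => if H == H0 then (m H0).-1 else m H.

Definition localization (A : {fset {vspace V}}) (X : {vspace V}) :
  {fset {vspace V}} :=
  [fset H in A | (X <= H)%VS].

Definition in_form_Der (l : nat) (e : l.-tuple V) (H0 : {vspace V})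
    (theta : Der K l) : Prop :=
  exists phi : Der K l, theta = form_mpoly e (alpha H0) *: phi.

(* Coordinates with X = {x_1 = x_2 = 0} are given by a basis e of V whose
   vectors from the third on span X. *)
Definition is_euler_degree (A : {fset {vspace V}}) (m : {vspace V} -> nat)
    (H0 X : {vspace V}) (d : nat) : Prop :=
  exists (e : (\dim {:V}).-tuple V) (theta psi : Der K (\dim {:V})) (p : nat),
    [/\ basis_of {:V} e /\ X = <<drop 2 e>>%VS,
        is_basis (log_der e (localization A X) m)
          [:: theta, psi
            & [seq partial K i | i : 'I_(\dim {:V}) <- enum 'I_(\dim {:V})
                & (2 <= i)%N]],
        der_homog d theta /\ der_homog p psi,
        ~ in_form_Der e H0 theta
      & in_form_Der e H0 psi].

Definition euler_mult (A : {fset {vspace V}}) (m : {vspace V} -> nat)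
    (H0 X : {vspace V}) : nat :=
  epsilon (inhabits 0%N) (is_euler_degree A m H0 X).

(* H0 :&: H, seen as a subspace of the vector space H0. *)
Definition trace_on (H0 H : {vspace V}) : {vspace subvs_of H0} :=
  (linfun (vsval : subvs_of H0 -> V) @^-1: H)%VS.

Definition restriction (A : {fset {vspace V}}) (H0 : {vspace V}) :
  {fset {vspace subvs_of H0}} :=
  [fset trace_on H0 H | H in A `\ H0].

Definition restriction_mult (A : {fset {vspace V}}) (m : {vspace V} -> nat)
    (H0 : {vspace V}) : {vspace subvs_of H0} -> nat :=
  fun X => euler_mult A m H0 (linfun (vsval : subvs_of H0 -> V) @: X)%VS.

End Arrangements.

Arguments restriction_mult {K V} A m H0 X.

(* Main.v *)
(** Saito's criterion holds for the modules [{x | L t ^ m t divides x . c t}]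
    with the [L t] pairwise non-associated primes and the [c t] unimodular: a
    square matrix with rows in such a module is a basis exactly when its
    determinant divides [\prod_t L t ^ m t].  It covers [D(A, m)], [D(A', m')],
    [D(A'', m* )] and the rank two localizations.

    Let [x] be the linear form of [H0].  Restricting derivations modulo [x]
    gives an exact sequence [0 -> D(A', m') -> D(A, m) -> D(A'', m* )] whose
    first map is the multiplication by [x].  If [theta_X, psi_X] is the local
    basis at [X], then [theta_X(beta) * (psi_X(x) / x ^ m(H0))] is modulo [x]
    an associate of [\prod_(H <> H0) alpha_H ^ m(H)] for the localized
    arrangement, a power of the form of [X]; by homogeneity its first factor is
    the power of exponent [m* (X)].  Hence restrictions of elements of [D(A, m)]
    lie in [D(A'', m* )], and for [theta] in [D(A', m')] the quotient
    [theta(x) / x ^ (m(H0) - 1)] is modulo [x] a multiple of a fixed form [B]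
    with [B * \prod_X alpha_X ^ m* (X) = \prod_(H <> H0) alpha_H ^ m(H)].

    Everything reduces to finding a homogeneous basis of [D(A, m)] with a
    member in [x Der]: dividing it by [x] gives a basis of [D(A', m')],
    dropping it a basis of [D(A'', m* )].  Given (i) and (ii), it comes from a
    unit entry in the transition matrix between [D(A, m)] and [x D(A', m')];
    given (i) and (iii), from a relation between the restrictions of the basis,
    which exists by counting degrees.  Given (ii) and (iii), the same count
    yields a basis member [theta] of [D(A', m')] for which the quotient above
    is a nonzero scalar multiple of [B]; it is multiplied by [x] and used to
    correct the other members. *)
Require Import Defs.
From HB Require Import structures.
From mathcomp Require Import all_boot all_order all_algebra finmap.
From mathcomp Require Import mpoly perm ring zify.
From Stdlib Require Import ClassicalEpsilon.

Set Implicit Arguments.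
Unset Strict Implicit.
Unset Printing Implicit Defensive.

Import GRing.Theory.

Local Open Scope fset_scope.
Local Open Scope ring_scope.

(** * Saito's criterion *)

Section Divisibility.

Variable R : idomainType.
Implicit Types a b c p u v : R.

Definition rdvd a b := exists g, b = a * g.

(** Prime elements of a domain, stated by divisibility. They replace unique factorization, since
    only products of linear forms are ever factored. *)
Definition rprime p :=
  [/\ p != 0, ~ rdvd p 1 & forall a b, rdvd p (a * b) -> rdvd p a \/ rdvd p b].

Lemma rdvd_refl a : rdvd a a.
Proof. by exists 1; rewrite mulr1. Qed.

Lemma rdvdr0 a : rdvd a 0.
Proof. by exists 0; rewrite mulr0. Qed.

Lemma rdvd1r a : rdvd 1 a.
Proof. by exists a; rewrite mul1r. Qed.

Lemma rdvd_trans b a c : rdvd a b -> rdvd b c -> rdvd a c.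
Proof. by move=> [g ->] [h ->]; exists (g * h); rewrite mulrA. Qed.

Lemma rdvd_mulr a b c : rdvd a b -> rdvd a (b * c).
Proof. by move=> [g ->]; exists (g * c); rewrite mulrA. Qed.

Lemma rdvd_mull a b c : rdvd a b -> rdvd a (c * b).
Proof. by rewrite mulrC; apply: rdvd_mulr. Qed.

Lemma rdvd_mul a b c d : rdvd a b -> rdvd c d -> rdvd (a * c) (b * d).
Proof. by move=> [g ->] [h ->]; exists (g * h); rewrite mulrACA. Qed.

Lemma rdvdD a b c : rdvd a b -> rdvd a c -> rdvd a (b + c).
Proof. by move=> [g ->] [h ->]; exists (g + h); rewrite mulrDr. Qed.

Lemma rdvdN a b : rdvd a b -> rdvd a (- b).
Proof. by move=> [g ->]; exists (- g); rewrite mulrN. Qed.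

Lemma rdvdB a b c : rdvd a b -> rdvd a c -> rdvd a (b - c).
Proof. by move=> ab ac; apply: rdvdD => //; apply: rdvdN. Qed.

Lemma rdvd_sum (I : Type) (r : seq I) (P : pred I) a (F : I -> R) :
  (forall i, P i -> rdvd a (F i)) -> rdvd a (\sum_(i <- r | P i) F i).
Proof.
move=> aF; elim/big_ind: _ => //; [exact: rdvdr0 | exact: rdvdD].
Qed.

Lemma rdvd_exp2l a m n : (m <= n)%N -> rdvd (a ^+ m) (a ^+ n).
Proof. by move=> /subnKC <-; exists (a ^+ (n - m)); rewrite exprD. Qed.

Lemma rdvd_cancel c a b : c != 0 -> rdvd (c * a) (c * b) -> rdvd a b.
Proof.
by move=> c0 [g]; rewrite -mulrA => /(mulfI c0) ->; exists g.
Qed.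

Lemma rdvd_unit u a : u \is a GRing.unit -> rdvd u a.
Proof. by move=> uU; exists (u^-1 * a); rewrite mulrA divrr ?mul1r. Qed.

Lemma rdvd1_unit u : rdvd u 1 -> u \is a GRing.unit.
Proof. by move=> [g ug]; apply/unitrPr; exists g. Qed.

Lemma rdvd_mulUr u a b : u \is a GRing.unit -> rdvd a (b * u) -> rdvd a b.
Proof.
by move=> uU [g bu]; exists (g * u^-1); rewrite mulrA -bu mulrK.
Qed.

Lemma rprime_neq0 p : rprime p -> p != 0. Proof. by case. Qed.

Lemma rprime_exp p a n : rprime p -> rdvd p (a ^+ n) -> rdvd p a.
Proof.
move=> [_ p1 pM]; elim: n => [/p1 //|n IHn].
by rewrite exprS => /pM [].
Qed.

Lemma rprime_prod (T : eqType) (r : seq T) (F : T -> R) p :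
  rprime p -> rdvd p (\prod_(t <- r) F t) -> exists2 t, t \in r & rdvd p (F t).
Proof.
move=> [_ p1 pM]; elim: r => [|t r IHr]; first by rewrite big_nil => /p1.
rewrite big_cons => /pM [pt|/IHr [s sr ps]]; first by exists t; rewrite ?mem_head.
by exists s => //; rewrite inE sr orbT.
Qed.

(** Powers of [p] come off one at a time: [p] divides [a * b] but not [a], hence divides [b], and a
    factor [p] cancels on both sides. *)
Lemma rprime_exp_coprime p n a b :
  rprime p -> ~ rdvd p a -> rdvd (p ^+ n) (a * b) -> rdvd (p ^+ n) b.
Proof.
move=> pP pa; have [p0 _ pM] := pP; elim: n b => [|n IHn] b.
  by move=> _; rewrite expr0; apply: rdvd1r.
move=> pab.
have: rdvd p (a * b).
  by apply: rdvd_trans pab; rewrite exprS; apply/rdvd_mulr/rdvd_refl.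
case/pM => // -[g bE]; move: pab; rewrite bE exprS mulrCA => /(rdvd_cancel p0).
by move=> /IHn [h ->]; exists h; rewrite mulrA.
Qed.

(** Induction on [J]: the quotient of [a] by the product over the tail must absorb [L t ^+ m t],
    because the prime [L t] divides none of the other factors. *)
Lemma rdvd_prime_prod (T : eqType) (J : seq T) (L : T -> R) (m : T -> nat) a :
  uniq J -> (forall t, t \in J -> rprime (L t)) ->
  (forall s t, s \in J -> t \in J -> s != t -> ~ rdvd (L s) (L t)) ->
  (forall t, t \in J -> rdvd (L t ^+ m t) a) ->
  rdvd (\prod_(t <- J) L t ^+ m t) a.
Proof.
elim: J a => [|t J IHJ] a; first by rewrite big_nil => *; apply: rdvd1r.
rewrite big_cons /= => /andP [tJ uJ] LP LL La.
have [g aE] : rdvd (\prod_(t <- J) L t ^+ m t) a.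
  apply: IHJ => // [s sJ|s s' sJ s'J|s sJ].
  - by apply: LP; rewrite inE sJ orbT.
  - by apply: LL; rewrite inE ?sJ ?s'J orbT.
  - by apply: La; rewrite inE sJ orbT.
rewrite mulrC aE; apply: rdvd_mul; first exact: rdvd_refl.
have Lt : rprime (L t) by apply: LP; rewrite mem_head.
apply: (@rprime_exp_coprime _ _ (\prod_(t <- J) L t ^+ m t)) => //.
  move=> /(rprime_prod Lt) [s sJ /(rprime_exp Lt)].
  apply: LL; rewrite ?mem_head // ?inE ?sJ ?orbT //.
  by apply: contraNneq tJ => ->.
by rewrite -aE; apply: La; rewrite mem_head.
Qed.

Lemma rdvd_prime_prod_unit (T : eqType) (J : seq T) (L : T -> R) u :
  (forall t, t \in J -> rprime (L t)) -> (forall t, t \in J -> ~ rdvd (L t) u) ->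
  rdvd u (\prod_(t <- J) L t) -> u \is a GRing.unit.
Proof.
elim: J => [|t J IHJ]; first by rewrite big_nil => _ _ /rdvd1_unit.
rewrite big_cons => LP Lu [g uE].
have [L0 _ LM] : rprime (L t) by apply: LP; rewrite mem_head.
have: rdvd (L t) (u * g) by rewrite -uE; apply/rdvd_mulr/rdvd_refl.
case/LM => [/Lu -[]|[h gE]]; first by rewrite mem_head.
apply: IHJ => [s sJ|s sJ|]; [by apply: LP; rewrite inE sJ orbT| |].
  by apply: Lu; rewrite inE sJ orbT.
by exists h; apply: (mulfI L0); rewrite uE gE mulrCA.
Qed.

Lemma rdvd_prime_prodX_unit (T : eqType) (J : seq T) (L : T -> R) (m : T -> nat)
    n u :
  (forall t, t \in J -> rprime (L t)) -> (forall t, t \in J -> ~ rdvd (L t) u) ->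
  rdvd u ((\prod_(t <- J) L t ^+ m t) ^+ n) -> u \is a GRing.unit.
Proof.
move=> LP Lu uJ.
pose J' := flatten [seq nseq (m t * n) t | t <- J].
have J'J t : t \in J' -> t \in J.
  by move=> /flatten_mapP [s sJ]; rewrite mem_nseq => /andP [_ /eqP ->].
apply: (@rdvd_prime_prod_unit _ J' L) => [t /J'J /LP //|t /J'J /Lu //|].
suff -> : \prod_(t <- J') L t = (\prod_(t <- J) L t ^+ m t) ^+ n by [].
rewrite big_flatten /= big_map -prodrXl; apply: eq_bigr => t _.
by rewrite big_nseq -exprM; elim: (_ * _)%N => //= k ->; rewrite exprS.
Qed.

(** Each factor [p] of the right side is assigned to [a] or to [b]; [j] counts those that go to
    [a]. *)
Lemma rprime_exp_split p a b u N :
  rprime p -> u \is a GRing.unit -> a * b = p ^+ N * u ->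
  exists j, [/\ (j <= N)%N, rdvd (p ^+ j) a, rdvd a (p ^+ j)
               & rdvd (p ^+ (N - j)) b].
Proof.
move=> pP uU; have [p0 _ pM] := pP.
elim: N a b => [|N IHN] a b abE.
  exists 0%N; split=> //; try exact: rdvd1r.
  apply: (@rdvd_mulUr u) => //; rewrite -abE; exact/rdvd_mulr/rdvd_refl.
have: rdvd p (a * b) by rewrite abE exprS -mulrA; apply/rdvd_mulr/rdvd_refl.
case/pM => [] [g gE]; move: abE; rewrite gE exprS.
  rewrite -!mulrA => /(mulfI p0) /IHN [j [jN ja aj jb]].
  exists j.+1; rewrite subSS exprS; split=> //;
    by apply: rdvd_mul => //; apply: rdvd_refl.
rewrite mulrCA -mulrA => /(mulfI p0) /IHN [j [jN ja aj jb]].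
exists j; rewrite subSn // exprS; split=> //; first exact: leqW.
by apply: rdvd_mul => //; apply: rdvd_refl.
Qed.

End Divisibility.

(** * Bases as rows of matrices, and Cramer's rule *)

Section MatrixBases.

Variable S : idomainType.

Definition mxbasis k n (D : 'rV[S]_n -> Prop) (T : 'M[S]_(k, n)) :=
  (forall x, D x <-> exists c : 'rV_k, x = c *m T) /\
  (forall c : 'rV_k, c *m T = 0 -> c = 0).

Lemma mxbasis_row k n D (T : 'M[S]_(k, n)) i : mxbasis D T -> D (row i T).
Proof. by move=> [DT _]; apply/DT; exists (delta_mx 0 i); rewrite rowE. Qed.

Lemma mxbasis_fact k k' n D (T : 'M[S]_(k, n)) (U : 'M[S]_(k', n)) :
  mxbasis D T -> (forall i, D (row i U)) -> exists G, U = G *m T.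
Proof.
move=> [DT _] DU.
have /fin_all_exists [G GE] : forall i, exists c : 'rV_k, row i U = c *m T.
  by move=> i; apply/DT/DU.
exists (\matrix_i G i); apply/row_matrixP => i.
by rewrite row_mul rowK -GE.
Qed.

Lemma mxbasis_free k k' n D (T : 'M[S]_(k, n)) (G : 'M[S]_(k', k)) :
  mxbasis D T -> G *m T = 0 -> G = 0.
Proof.
move=> [_ fT] GT; apply/row_matrixP => i; rewrite row0; apply: fT.
by rewrite -row_mul GT row0.
Qed.

Lemma det_neq0_free n (T : 'M[S]_n) (c : 'rV_n) :
  \det T != 0 -> c *m T = 0 -> c = 0.
Proof.
move=> T0 cT; have := congr1 (mulmx^~ (\adj T)) cT.
rewrite /= mul0mx -mulmxA mul_mx_adj mul_mx_scalar => /matrixP cE.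
apply/matrixP => i j; have /eqP := cE i j.
by rewrite !mxE mulf_eq0 (negPf T0) => /eqP.
Qed.

Definition setrow m n (i : 'I_m) (v : 'rV[S]_n) (T : 'M[S]_(m, n)) :=
  \matrix_j (if j == i then v else row j T).

Lemma row_setrow m n (i j : 'I_m) (v : 'rV_n) (T : 'M_(m, n)) :
  row j (setrow i v T) = if j == i then v else row j T.
Proof. by rewrite rowK. Qed.

Lemma cofactor_setrow n (i : 'I_n) j v (T : 'M_n) :
  cofactor (setrow i v T) i j = cofactor T i j.
Proof.
rewrite /cofactor; congr (_ * \det _); apply/matrixP => k l.
by rewrite !mxE eq_sym (negPf (neq_lift _ _)) !mxE.
Qed.

(** Expansion along row [i], whose cofactors do not depend on that row: this is Cramer's rule. *)
Lemma det_setrow n (i : 'I_n) v (T : 'M_n) :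
  \det (setrow i v T) = (v *m \adj T) 0 i.
Proof.
rewrite (expand_det_row _ i) !mxE; apply: eq_bigr => j _.
by rewrite cofactor_setrow !mxE eqxx.
Qed.

Lemma det_setrow_mul n (i : 'I_n) (c : 'rV_n) (T : 'M_n) :
  \det (setrow i (c *m T) T) = c 0 i * \det T.
Proof. by rewrite det_setrow -mulmxA mul_mx_adj mul_mx_scalar !mxE mulrC. Qed.

Lemma det_setrowZ n (i : 'I_n) a v (T : 'M_n) :
  \det (setrow i (a *: v) T) = a * \det (setrow i v T).
Proof. by rewrite !det_setrow -scalemxAl !mxE. Qed.

(** Row [i] vanishes outside column [i], and the complementary minor is an identity matrix. *)
Lemma det_col_identity n (i : 'I_n) (E : 'M[S]_n) :
  (forall j k, k != i -> E j k = (j == k)%:R) -> \det E = E i i.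
Proof.
move=> EE; rewrite (expand_det_row _ i) (bigD1 i) //= big1 ?addr0 => [|j ji].
  suff -> : cofactor E i i = 1 by rewrite mulr1.
  rewrite /cofactor addnn -signr_odd odd_double mul1r.
  suff -> : row' i (col' i E) = 1%:M by rewrite det1.
  apply/matrixP => j k; rewrite !mxE EE ?(inj_eq lift_inj) //.
  by rewrite eq_sym neq_lift.
by rewrite EE // eq_sym (negPf ji) mul0r.
Qed.

End MatrixBases.

(** * The criterion itself, for square matrices *)

Section Saito.

Variables (S : idomainType) (T : eqType) (n : nat).
Variables (J : seq T) (L : T -> S) (m : T -> nat) (c : T -> 'cV[S]_n).

(** In the applications [c t] holds the coefficients of the form [L t], so that [x *m c t] is the
    value of the derivation [x] on it. *)
Definition log_mod (x : 'rV[S]_n) :=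
  forall t, t \in J -> rdvd (L t ^+ m t) ((x *m c t) 0 0).

Local Notation Q := (\prod_(t <- J) L t ^+ m t).

Hypothesis uniqJ : uniq J.
Hypothesis primeL : forall t, t \in J -> rprime (L t).
Hypothesis neqL : forall s t, s \in J -> t \in J -> s != t -> ~ rdvd (L s) (L t).
Hypothesis unit_c : forall t, t \in J -> exists i, c t i 0 \is a GRing.unit.

Lemma saito_prod_neq0 : Q != 0.
Proof.
rewrite prodf_seq_neq0; apply/allP => t tJ; apply/implyP => _.
exact/expf_neq0/rprime_neq0/primeL.
Qed.

(** [\det M] times an entry of [c t] is a combination of the entries of [M *m c t], all divisible by
    [L t ^+ m t]; one entry of [c t] is a unit. *)
Lemma saito_dvd_det (M : 'M_n) :
  (forall i, log_mod (row i M)) -> rdvd Q (\det M).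
Proof.
move=> DM; apply: rdvd_prime_prod => // t tJ.
have [i ciU] := unit_c tJ; apply: (rdvd_mulUr ciU).
have -> : \det M * c t i 0 = (\adj M *m (M *m c t)) i 0.
  by rewrite mulmxA mul_adj_mx mul_scalar_mx !mxE.
rewrite mxE; apply: rdvd_sum => j _; apply: rdvd_mull.
by have := DM j t tJ; rewrite -row_mul mxE.
Qed.

(** Replacing a row of [M] by a member [x] gives a determinant divisible by the product, hence by
    [\det M]; the quotients are the coordinates of [x]. *)
Lemma saito_basis (M : 'M_n) :
  (forall i, log_mod (row i M)) -> rdvd (\det M) Q -> mxbasis log_mod M.
Proof.
move=> DM detM; have detM0 : \det M != 0.
  by apply: contraTneq saito_prod_neq0 => dM0; case: detM => g ->;
     rewrite dM0 mul0r eqxx.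
have logM k (d : 'rV_k) (N : 'M_(k, n)) :
    (forall i, log_mod (row i N)) -> log_mod (d *m N).
  move=> DN t tJ; rewrite -mulmxA mxE; apply: rdvd_sum => j _.
  by apply: rdvd_mull; have := DN j t tJ; rewrite -row_mul mxE.
split=> [x|d]; last exact: det_neq0_free.
split=> [Dx|[d ->]]; last exact: logM.
have /fin_all_exists [w wE] : forall i, exists g, (x *m \adj M) 0 i = \det M * g.
  move=> i; apply: rdvd_trans detM _.
  rewrite -det_setrow; apply: saito_dvd_det => j.
  by rewrite row_setrow; case: ifP.
exists (\row_i w i).
have xadj : x *m \adj M = \det M *: \row_i w i.
  by apply/rowP => i; rewrite wE !mxE.
have := congr1 (mulmx^~ M) xadj; rewrite /= -mulmxA mul_adj_mx mul_mx_scalar.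
rewrite -scalemxAl => /matrixP xE; apply/matrixP => i j.
by have := xE i j; rewrite [LHS]mxE [RHS]mxE => /(mulfI detM0).
Qed.

(** The quotient [u] of [\det M] by the product is a unit: it divides a power of the product, as the
    product times each unit vector lies in the module, and no [L t] divides it. *)
Lemma saito_det (M : 'M_n) : mxbasis log_mod M -> rdvd (\det M) Q.
Proof.
move=> bM.
have [u detE] : rdvd Q (\det M).
  by apply: saito_dvd_det => i; apply: mxbasis_row bM.
suff uU : u \is a GRing.unit.
  by exists u^-1; rewrite detE mulrK.
apply: (@rdvd_prime_prodX_unit _ _ J L m n) => // [t tJ [v uE]|]; last first.
  have [G GE] : exists G, Q%:M = G *m M.
    apply: (mxbasis_fact bM) => i t tJ.
    rewrite -row_mul mul_scalar_mx !mxE (big_rem t) //= -mulrA.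
    exact/rdvd_mulr/rdvd_refl.
  have := congr1 determinant GE; rewrite det_scalar det_mulmx detE => ->.
  by do 2!apply: rdvd_mull; apply: rdvd_refl.
(* The rows of [q *: E] lie in the module, so that [det M] divides
   [q ^+ n * L t ^+ m t] where [L t] does not divide [q]. *)
have [i ciU] := unit_c tJ; have [Lt0 _ _] := primeL tJ.
pose q := \prod_(s <- rem t J) L s ^+ m s.
have QE : Q = L t ^+ m t * q by rewrite (big_rem t).
have Lq : ~ rdvd (L t) q.
  move=> /(rprime_prod (primeL tJ)) [s sJ /(rprime_exp (primeL tJ))].
  move: sJ; rewrite mem_rem_uniq // inE => /andP [st sJ].
  by apply: neqL => //; rewrite eq_sym.
(* [E] is the identity except in column [i], chosen so that [E *m c t] vanishes outside its entry
   [i], which is [L t ^+ m t * c t i 0]. *)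
pose E : 'M[S]_n := \matrix_(j, k)
  (if k == i then if j == i then L t ^+ m t else - (c t j 0 / c t i 0)
   else (j == k)%:R).
have detE' : \det E = L t ^+ m t.
  rewrite (@det_col_identity _ _ i) => [|j k ki]; first by rewrite mxE !eqxx.
  by rewrite mxE (negPf ki).
have Ec j : (E *m c t) j 0 = if j == i then L t ^+ m t * c t i 0 else 0.
  rewrite mxE (bigD1 i) //= mxE eqxx; have [->|ji] := eqVneq j i.
    rewrite big1 ?addr0 // => k ki.
    by rewrite mxE (negPf ki) eq_sym (negPf ki) mul0r.
  rewrite mulNr divrK // (bigD1 j) //= mxE (negPf ji) eqxx mul1r.
  rewrite big1 ?addr0 ?addNr // => k /andP [ki kj].
  by rewrite mxE (negPf ki) eq_sym (negPf kj) mul0r.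
have [G GE] : exists G, q *: E = G *m M.
  apply: (mxbasis_fact bM) => j s sJ.
  have -> : (row j (q *: E) *m c s) 0 0 = q * (E *m c s) j 0.
    by rewrite -row_mul -scalemxAl !mxE.
  have [->|st] := eqVneq s t.
    rewrite Ec; case: eqP => _; last by rewrite mulr0; apply: rdvdr0.
    by apply/rdvd_mull/rdvd_mulr/rdvd_refl.
  apply: rdvd_mulr; rewrite /q (big_rem s) ?mem_rem_uniq ?inE ?st //=.
  exact/rdvd_mulr/rdvd_refl.
have := congr1 determinant GE; rewrite detZ detE' det_mulmx detE QE uE => dE.
apply: Lq; apply: (@rprime_exp _ _ _ n); first exact: primeL.
exists (v * q * \det G); apply: (mulIf (expf_neq0 (m t) Lt0)).
by rewrite dE; ring.
Qed.

Lemma saito_det_assoc (M : 'M_n) :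
  mxbasis log_mod M -> rdvd Q (\det M) /\ rdvd (\det M) Q.
Proof.
move=> bM; split; last exact: saito_det.
by apply: saito_dvd_det => i; apply: mxbasis_row bM.
Qed.

End Saito.

(** * Homogeneous polynomials and linear forms *)

Section Homogeneous.

Variables (K : fieldType) (n : nat).
Implicit Types p q : {mpoly K[n]}.

(** Split [p] into homogeneous components: only the one of degree [d - e] contributes. The test
    guards against truncated subtraction. *)
Lemma pihomogM d e p q : q \is e.-homog ->
  pihomog mdeg d (p * q) = if (e <= d)%N then pihomog mdeg (d - e) p * q else 0.
Proof.
move=> hq; rewrite {1}(pihomog_partitionE (leqnn (mmeasure mdeg p))).
rewrite mulr_suml raddf_sum /=.
have step (k : nat) : pihomog mdeg d (pihomog mdeg k p * q) =
    if (k + e == d)%N then pihomog mdeg k p * q else 0.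
  have hkq : pihomog mdeg k p * q \is (k + e).-homog.
    by apply: dhomogM => //; apply: pihomogP.
  case: eqP => [<-|/eqP ne]; first by rewrite pihomog_dE.
  by rewrite (pihomog_ne0 _ hkq).
under eq_bigr do rewrite step.
rewrite -big_mkcond /=.
case: leqP => [ed|de]; last first.
  by rewrite big_pred0 // => k; apply/negbTE; rewrite neq_ltn ltn_addl ?orbT.
have [lt|ge] := ltnP (d - e) (mmeasure mdeg p).
  rewrite (eq_bigl (pred1 (Ordinal lt))) ?big_pred1_eq // => k.
  apply/eqP/eqP => [kE|->]; last by rewrite /= subnK.
  by apply/val_inj; rewrite /= -kE addnK.
rewrite big_pred0 => [|k]; last first.
  apply/negbTE/eqP => kE; have := ltn_ord k.
  by rewrite ltnNge (leq_trans ge) // -kE addnK.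
have -> : pihomog mdeg (d - e) p = 0; last by rewrite mul0r.
rewrite pihomogE big_seq_cond big_pred0 // => m; apply/negbTE/negP.
move=> /andP [/(mmeasure_mnm_lt mdeg) lem /eqP mE].
by move: lem; rewrite [X in (X < _)%N]mE ltnNge ge.
Qed.

Lemma homog_divl d e p q : q \is e.-homog -> p * q \is d.-homog -> p * q != 0 ->
  (e <= d)%N /\ p \is (d - e).-homog.
Proof.
move=> hq hpq pq0; have := pihomog_dE hpq; rewrite (pihomogM _ _ hq).
case: leqP => [ed|_ pqE]; last by rewrite -pqE eqxx in pq0.
have q0 : q != 0 by apply: contraNneq pq0 => ->; rewrite mulr0.
by move=> /(mulIf q0) <-; split=> //; apply: pihomogP.
Qed.

Lemma homog_rdvd d e p q : rdvd p q -> q != 0 ->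
  p \is d.-homog -> q \is e.-homog -> (d <= e)%N.
Proof.
move=> [g ->]; rewrite mulrC => pg0 hp hpg.
by have [] := homog_divl hp hpg pg0.
Qed.

Lemma homog_assoc d e p q : rdvd p q -> rdvd q p -> p != 0 ->
  p \is d.-homog -> q \is e.-homog -> d = e.
Proof.
move=> pq qp p0 hp hq; have q0 : q != 0.
  by case: qp => g pE; apply: contraNneq p0 => q0; rewrite pE q0 mul0r.
by apply/eqP; rewrite eqn_leq (homog_rdvd pq) ?(homog_rdvd qp).
Qed.

Lemma homog0_const p : p \is 0.-homog -> p = (p@_0%MM)%:MP.
Proof.
move=> hp; apply/mpolyP => m; rewrite mcoeffC; case: (eqVneq m 0%MM) => [->|m0].
  by rewrite mulr1.
by rewrite mulr0 (dhomog_nemf_coeff hp) ?mdeg_eq0.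
Qed.

Lemma homog_coeff0 d p : p \is d.-homog -> p@_0%MM != 0 -> d = 0%N.
Proof.
move=> hp; apply: contraNeq => d0; rewrite (dhomog_nemf_coeff hp) //.
by rewrite mf0 eq_sym.
Qed.

Lemma homog0_unit p : p \is 0.-homog -> p != 0 -> p \is a GRing.unit.
Proof.
move=> /homog0_const pE p0; rewrite pE; apply: rmorph_unit.
by rewrite unitfE; apply: contraNneq p0 => c0; rewrite pE c0 mpolyC0.
Qed.

Lemma mpolyC_unit (c : K) : c != 0 -> (c%:MP : {mpoly K[n]}) \is a GRing.unit.
Proof. by move=> c0; apply: rmorph_unit; rewrite unitfE. Qed.

Lemma homogC (c : K) : (c%:MP : {mpoly K[n]}) \is 0.-homog.
Proof. by rewrite -[c]mulr1 mpolyCM mul_mpolyC dhomogZ // mpolyC1 dhomog1. Qed.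

Lemma homog_bigprod (T : Type) (r : seq T) (F : T -> {mpoly K[n]}) (d : T -> nat) :
  (forall t, F t \is (d t).-homog) ->
  \prod_(t <- r) F t \is (\sum_(t <- r) d t).-homog.
Proof.
move=> hF; elim: r => [|t r IHr]; first by rewrite !big_nil dhomog1.
by rewrite !big_cons; apply: dhomogM.
Qed.

Lemma homog_bigprod_fin k (F : 'I_k -> {mpoly K[n]}) (d : 'I_k -> nat) :
  (forall t, F t \is (d t).-homog) ->
  \prod_t F t \is (\sum_t d t).-homog.
Proof. exact: homog_bigprod. Qed.

Lemma det_homog k (M : 'M[{mpoly K[n]}]_k) (p : 'I_k -> nat) :
  (forall i j, M i j \is (p i).-homog) -> \det M \is (\sum_i p i).-homog.
Proof.
move=> hM; apply: rpred_sum => s _; rewrite -signr_odd.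
have h : \prod_i M i (s i) \is (\sum_i p i).-homog.
  exact: homog_bigprod_fin.
by case: odd; rewrite ?mulN1r ?mul1r ?dhomogN.
Qed.

End Homogeneous.

(** * Linear forms, linear substitutions and primality *)

Section LinearForms.

Variables (K : fieldType).

Definition lin n (c : 'rV[K]_n) : {mpoly K[n]} := \sum_i c 0 i *: 'X_i.

Lemma linE n (c : 'rV[K]_n) i : (lin c)@_U_(i) = c 0 i.
Proof.
rewrite raddf_sum (bigD1 i) //= mcoeffZ mcoeffXU eqxx mulr1 big1 ?addr0 // => j ji.
by rewrite mcoeffZ mcoeffXU (negPf ji) mulr0.
Qed.

Lemma lin_is_linear n : linear (@lin n).
Proof.
move=> a c d; rewrite /lin scaler_sumr -big_split /=; apply: eq_bigr => i _.
by rewrite !mxE scalerDl scalerA.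
Qed.

HB.instance Definition _ n :=
  GRing.isLinear.Build K 'rV[K]_n {mpoly K[n]} _ (@lin n) (@lin_is_linear n).

Lemma lin_inj n : injective (@lin n).
Proof. by move=> c d cd; apply/rowP => i; rewrite -!linE cd. Qed.

Lemma lin_eq0 n (c : 'rV[K]_n) : (lin c == 0) = (c == 0).
Proof. by rewrite -[0 in LHS](raddf0 (@lin n)) (inj_eq (@lin_inj n)). Qed.

Lemma lin_homog n (c : 'rV[K]_n) : lin c \is 1.-homog.
Proof. by apply: rpred_sum => i _; apply: rpredZ; rewrite dhomogX /= mdeg1. Qed.

Lemma lin_delta n (i : 'I_n) : lin (delta_mx 0 i) = 'X_i.
Proof.
rewrite /lin (bigD1 i) //= big1 ?addr0 => [|j ji]; first by rewrite mxE !eqxx scale1r.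
by rewrite mxE (negPf ji) andbF scale0r.
Qed.

(** Indexed so that [lin c] goes to [lin (c *m P)]; it serves both as restriction to a hyperplane
    and as change of coordinates. *)
Definition lsub l n (P : 'M[K]_(l, n)) (p : {mpoly K[l]}) : {mpoly K[n]} :=
  p \mPo [tuple lin (row i P) | i < l].

HB.instance Definition _ l n (P : 'M[K]_(l, n)) :=
  GRing.RMorphism.copy (lsub P) (comp_mpoly [tuple lin (row i P) | i < l]).
HB.instance Definition _ l n (P : 'M[K]_(l, n)) :=
  GRing.Linear.copy (lsub P) (comp_mpoly [tuple lin (row i P) | i < l]).

Lemma lsubC l n (P : 'M[K]_(l, n)) (c : K) : lsub P c%:MP = c%:MP.
Proof. exact: comp_mpolyC. Qed.

Lemma lsubX l n (P : 'M[K]_(l, n)) i : lsub P 'X_i = lin (row i P).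
Proof. by rewrite /lsub comp_mpolyXU -tnth_nth tnth_mktuple. Qed.

Lemma lsub_lin l n (P : 'M[K]_(l, n)) c : lsub P (lin c) = lin (c *m P).
Proof.
rewrite [lin c]/lin raddf_sum mulmx_sum_row raddf_sum /=; apply: eq_bigr => i _.
by rewrite !linearZ /= lsubX.
Qed.

Lemma mpoly_rect_morph l (R : nzRingType) (f g : {rmorphism {mpoly K[l]} -> R}) :
  (forall c : K, f c%:MP = g c%:MP) -> (forall i, f 'X_i = g 'X_i) -> f =1 g.
Proof.
move=> fgC fgX p; rewrite (mpolyE p) !rmorph_sum /=; apply: eq_bigr => m _.
rewrite -mul_mpolyC !rmorphM /= fgC; congr (_ * _).
by rewrite mpolyXE_id !rmorph_prod /=; apply: eq_bigr => i _; rewrite !rmorphXn /= fgX.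
Qed.

Lemma lsub_comp l n k (P : 'M[K]_(l, n)) (Q : 'M[K]_(n, k)) p :
  lsub Q (lsub P p) = lsub (P *m Q) p.
Proof.
apply: (@mpoly_rect_morph _ _ (lsub Q \o lsub P) (lsub (P *m Q))) => [c|i] /=.
  by rewrite !lsubC.
by rewrite !lsubX lsub_lin row_mul.
Qed.

Lemma lsub1 l p : lsub (1%:M : 'M[K]_l) p = p.
Proof.
apply: (@mpoly_rect_morph _ _ (lsub 1%:M) idfun) => [c|i] /=; first by rewrite lsubC.
by rewrite lsubX row1 lin_delta.
Qed.

Lemma lsub_homog l n (P : 'M[K]_(l, n)) d p :
  p \is d.-homog -> lsub P p \is d.-homog.
Proof.
move=> /dhomogP hp; rewrite [p]mpolyE raddf_sum /= big_seq; apply: rpred_sum => m mp.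
rewrite linearZ; apply: rpredZ; rewrite /= -(hp m mp) mpolyXE_id rmorph_prod /=.
rewrite [X in _ \is X.-homog]mdegE.
apply: homog_bigprod => i; rewrite rmorphXn /= lsubX.
by have := dhomogMn (m i) (lin_homog (row i P)); rewrite mul1n.
Qed.

Lemma lsub_congr l (P : 'M[K]_l) (L : {mpoly K[l]}) p :
  (forall i, rdvd L (lin (row i P) - 'X_i)) -> rdvd L (lsub P p - p).
Proof.
move=> LP; elim/mpolyind: p => [|c m p _ _ IHp].
  by rewrite raddf0 subrr; apply: rdvdr0.
rewrite raddfD /= opprD addrACA; apply: rdvdD => //.
rewrite linearZ /= -scalerBr -mul_mpolyC; apply: rdvd_mull => {p c IHp}.
rewrite mpolyXE_id rmorph_prod /=.
elim/big_ind2: _ => [|a b c d La Lb|i _]; first by rewrite subrr; apply: rdvdr0.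
  have -> : b * d - a * c = (b - a) * d + a * (d - c) by ring.
  by apply: rdvdD; [apply: rdvd_mulr | apply: rdvd_mull].
rewrite rmorphXn /= lsubX; elim: (m i) => [|k IHk].
  by rewrite !expr0 subrr; apply: rdvdr0.
rewrite !exprS; move: IHk; set a := _ ^+ k; set b := _ ^+ k => IHk.
have -> : lin (row i P) * a - 'X_i * b = (lin (row i P) - 'X_i) * a + 'X_i * (a - b).
  by ring.
by apply: rdvdD; [apply: rdvd_mulr | apply: rdvd_mull].
Qed.

(** The quotient of [R] by [p] embeds into the domain [R']. *)
Lemma rprime_ker (R R' : idomainType) (f : {rmorphism R -> R'}) p :
  p != 0 -> (forall a, f a = 0 <-> rdvd p a) -> rprime p.
Proof.
move=> p0 fp; split=> // [/fp /eqP|a b /fp /eqP].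
  by rewrite rmorph1 oner_eq0.
by rewrite rmorphM mulf_eq0 => /orP [/eqP/fp|/eqP/fp]; [left|right].
Qed.

(* Solving [lin c = 0] for the variable of index [i]. *)
Definition elim_mx l (c : 'rV[K]_l) (i : 'I_l) : 'M[K]_l :=
  1%:M - (c 0 i)^-1 *: (delta_mx i 0 *m c).

Lemma mul_elim_mx l (c d : 'rV[K]_l) i :
  d *m elim_mx c i = d - (d 0 i / c 0 i) *: c.
Proof.
rewrite mulmxBr mulmx1 -scalemxAr mulmxA -colE; congr (_ - _).
by rewrite [col i d]mx11_scalar mul_scalar_mx scalerA mxE mulrC.
Qed.

(** The substitution kills [lin c] and is the identity modulo [lin c], so its kernel is the ideal of
    [lin c]. *)
Lemma lsub_elim_mx l (c : 'rV[K]_l) i p :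
  c 0 i != 0 -> lsub (elim_mx c i) p = 0 <-> rdvd (lin c) p.
Proof.
move=> ci0; have Pc : lsub (elim_mx c i) (lin c) = 0.
  by rewrite lsub_lin mul_elim_mx divff // scale1r subrr raddf0.
have [g gE] : rdvd (lin c) (lsub (elim_mx c i) p - p).
  apply: lsub_congr => j.
  rewrite rowE mul_elim_mx raddfB /= lin_delta addrAC subrr add0r linearZ /=.
  by apply: rdvdN; rewrite -mul_mpolyC; apply/rdvd_mull/rdvd_refl.
split=> [p0|[h ->]]; last by rewrite rmorphM /= Pc mul0r.
by exists (- g); rewrite mulrN -gE p0 sub0r opprK.
Qed.

Lemma row_neq0 (R : nzRingType) l (c : 'rV[R]_l) : c != 0 -> exists i, c 0 i != 0.
Proof.
move=> c0; apply/existsP; apply: contraNT c0; rewrite negb_exists => /forallP c0.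
by apply/eqP/rowP => i; have := c0 i; rewrite negbK mxE => /eqP.
Qed.

Lemma lin_prime l (c : 'rV[K]_l) : c != 0 -> rprime (lin c).
Proof.
move=> c0; have [i ci0] := row_neq0 c0.
apply: (@rprime_ker _ _ (lsub (elim_mx c i))); first by rewrite lin_eq0.
by move=> a; apply: lsub_elim_mx.
Qed.

Lemma rdvd_lin l (c d : 'rV[K]_l) :
  c != 0 -> rdvd (lin c) (lin d) -> exists k, d = k *: c.
Proof.
move=> /row_neq0 [i ci0] /(lsub_elim_mx _ ci0); rewrite lsub_lin mul_elim_mx.
move=> /eqP; rewrite lin_eq0 subr_eq0 => /eqP dE; by exists (d 0 i / c 0 i).
Qed.

End LinearForms.

(** * Graded linear algebra *)

Section Graded.

Variables (K : fieldType) (n : nat).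
Local Notation S := {mpoly K[n]}.

Definition rows_homog k N (p : 'I_k -> nat) (T : 'M[S]_(k, N)) :=
  forall i j, T i j \is (p i).-homog.

(* [f] may be the coefficient of a generator of degree [e] in an element of
   degree [d]; the condition excludes the truncation of [d - e]. *)
Definition coef_homog (d e : nat) (f : S) :=
  if (e <= d)%N then f \is (d - e).-homog else f == 0.

Lemma coef_homogD d e f g :
  coef_homog d e f -> coef_homog d e g -> coef_homog d e (f + g).
Proof.
by rewrite /coef_homog; case: ifP => _; [apply: rpredD | move=> /eqP-> /eqP->; rewrite addr0].
Qed.

Lemma coef_homog0 d e : coef_homog d e 0.
Proof. by rewrite /coef_homog; case: ifP => _; rewrite ?eqxx ?rpred0. Qed.

Lemma coef_homogN d e f : coef_homog d e f -> coef_homog d e (- f).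
Proof. by rewrite /coef_homog; case: ifP => _; rewrite ?rpredN ?oppr_eq0. Qed.

Lemma coef_homogM d e b f g :
  coef_homog d e f -> coef_homog e b g -> coef_homog d b (f * g).
Proof.
rewrite /coef_homog; case: (leqP e d) => [ed|_ /eqP->]; last first.
  by rewrite mul0r eqxx rpred0 if_same.
case: (leqP b e) => [be|_ _ /eqP->]; last by rewrite mulr0 eqxx rpred0 if_same.
rewrite (leq_trans be ed) => hf hg.
by have := dhomogM hf hg; rewrite addnBA // subnK.
Qed.

Lemma coef_homog_sum I (r : seq I) (P : pred I) F d e :
  (forall i, P i -> coef_homog d e (F i)) -> coef_homog d e (\sum_(i <- r | P i) F i).
Proof.
move=> hF; elim/big_ind: _ => //; [exact: coef_homog0 | exact: coef_homogD].
Qed.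

Lemma coef_homogC d c : coef_homog d d c%:MP.
Proof. by rewrite /coef_homog leqnn subnn homogC. Qed.

Lemma coef_homog_const d f : coef_homog d d f -> f = (f@_0%MM)%:MP.
Proof. by rewrite /coef_homog leqnn subnn => /homog0_const. Qed.

Lemma coef_homog_gt d e f : (d < e)%N -> coef_homog d e f -> f = 0.
Proof. by rewrite ltnNge /coef_homog => /negPf -> /eqP. Qed.

Lemma coef_homog_coeff0 d e f : coef_homog d e f -> f@_0%MM != 0 -> d = e.
Proof.
rewrite /coef_homog; case: leqP => [ed hf|_ /eqP->]; last by rewrite mcoeff0 eqxx.
by move=> /(homog_coeff0 hf)/eqP; rewrite subn_eq0 => de; apply/eqP; rewrite eqn_leq de.
Qed.

(** Taking the component of degree [d] of [x = c *m T] replaces each coefficient by its component of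
    degree [d - q j]. *)
Lemma coef_homog_factor k N q (T : 'M[S]_(k, N)) d (x : 'rV_N) :
  rows_homog q T -> (forall j, x 0 j \is d.-homog) -> (exists c, x = c *m T) ->
  exists2 c : 'rV_k, x = c *m T & forall j, coef_homog d (q j) (c 0 j).
Proof.
move=> hT hx [c xE].
exists (\row_j if (q j <= d)%N then pihomog mdeg (d - q j) (c 0 j) else 0); last first.
  by move=> j; rewrite mxE /coef_homog; case: (q j <= d)%N => /=; [apply: pihomogP | rewrite eqxx].
apply/rowP => i; rewrite -(pihomog_dE (hx i)) xE !mxE raddf_sum /=.
apply: eq_bigr => j _; rewrite mxE (pihomogM _ _ (hT j i)).
by case: leqP => //; rewrite mul0r.
Qed.

Lemma coef_homog_mxfactor k k' N p q (T : 'M[S]_(k, N)) (U : 'M[S]_(k', N)) :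
  rows_homog q T -> rows_homog p U -> (exists G, U = G *m T) ->
  exists2 G, U = G *m T & forall i j, coef_homog (p i) (q j) (G i j).
Proof.
move=> hT hU [G UE].
have /fin_all_exists2 [c cE hc] : forall i, exists2 c : 'rV_k,
    row i U = c *m T & forall j, coef_homog (p i) (q j) (c 0 j).
  move=> i; apply: coef_homog_factor => // [j|]; first by rewrite mxE.
  by exists (row i G); rewrite -row_mul -UE.
exists (\matrix_i c i) => [|i j]; last by rewrite mxE.
by apply/row_matrixP => i; rewrite row_mul rowK cE.
Qed.

Lemma lin_rows_homog N (c : 'rV[K]_n) k p (T : 'M[S]_(k, N)) :
  rows_homog p T -> rows_homog (fun i => (p i).+1) (lin c *: T).
Proof. by move=> hT i j; rewrite mxE -add1n; apply: dhomogM (lin_homog c) _. Qed.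

(** Some term of the Leibniz expansion is nonzero, and its permutation matches the degrees. *)
Lemma det_support_perm k (C : 'M[K]_k) (p q : 'I_k -> nat) :
  (forall i j, C i j != 0 -> p i = q j) -> \det C != 0 ->
  exists s : 'S_k, forall i, p i = q (s i).
Proof.
move=> Cpq; rewrite /determinant => detC.
have [s sC] : exists s : 'S_k, \prod_i C i (s i) != 0.
  apply/existsP; apply: contraNT detC; rewrite negb_exists => /forallP Cs.
  by rewrite big1 // => s _; have := Cs s; rewrite negbK => /eqP ->; rewrite mulr0.
exists s => i; apply: Cpq; apply: contraNneq sC => Ci.
by rewrite (bigD1 i) //= Ci mul0r.
Qed.

(** The transition matrices are mutually inverse, hence so are their matrices of constant terms,
    whose nonzero entries link only equal degrees. *)
Lemma homog_basis_degrees k N D (T T' : 'M[S]_(k, N)) p p' :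
  rows_homog p T -> rows_homog p' T' -> mxbasis D T -> mxbasis D T' ->
  exists s : 'S_k, forall i, p i = p' (s i).
Proof.
move=> hT hT' bT bT'.
have [G TE hG] : exists2 G, T = G *m T' &
    forall i j, coef_homog (p i) (p' j) (G i j).
  apply: coef_homog_mxfactor => //; apply: (mxbasis_fact bT') => i.
  exact: mxbasis_row bT.
have [G' T'E] : exists G', T' = G' *m T.
  by apply: (mxbasis_fact bT) => i; apply: mxbasis_row bT'.
have GG' : G *m G' = 1%:M.
  apply/eqP; rewrite -subr_eq0; apply/eqP; apply: (mxbasis_free bT).
  by rewrite mulmxBl mul1mx -mulmxA -T'E -TE subrr.
apply: (@det_support_perm _ (map_mx (mcoeff 0%MM) G)) => [i j|].
  by rewrite mxE; apply: coef_homog_coeff0.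
have : \det (map_mx (mcoeff 0%MM) G) * \det (map_mx (mcoeff 0%MM) G') = 1.
  by rewrite -det_mulmx -map_mxM GG' map_mx1 det1.
by apply: contra_eqN => /eqP ->; rewrite mul0r eq_sym oner_eq0.
Qed.

(* Write [T = M T'] and [lin c T' = G T], so that [G M = lin c].  If all entries
   of [G] have zero constant term, the linear parts of this equation show that
   the matrix of constant terms of [M] is invertible. *)
Lemma homog_basis_unit_coef k N D D' (T T' : 'M[S]_(k, N)) p p' (c : 'rV[K]_n) :
  rows_homog p T -> rows_homog p' T' -> mxbasis D T -> mxbasis D' T' ->
  (forall x, D x -> D' x) -> (forall x, D' x -> D (lin c *: x)) -> c != 0 ->
  (exists s : 'S_k, forall i, p i = p' (s i)) \/
  exists g : 'rV_k, exists i j, [/\ lin c *: row j T' = g *m T,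
     g 0 i \is a GRing.unit & p i = (p' j).+1].
Proof.
move=> hT hT' bT bT' DD' D'D c0.
have [M TE hM] : exists2 G, T = G *m T' &
    forall i j, coef_homog (p i) (p' j) (G i j).
  apply: coef_homog_mxfactor => //; apply: (mxbasis_fact bT') => i.
  exact/DD'/(mxbasis_row _ bT).
have [G cT'E hG] : exists2 G, lin c *: T' = G *m T &
    forall i j, coef_homog (p' i).+1 (p j) (G i j).
  apply: coef_homog_mxfactor => //; first exact: lin_rows_homog.
  apply: (mxbasis_fact bT) => i.
  by rewrite linearZ; apply/D'D/(mxbasis_row _ bT').
have GM : G *m M = (lin c)%:M.
  apply/eqP; rewrite -subr_eq0; apply/eqP; apply: (mxbasis_free bT').
  by rewrite mulmxBl mul_scalar_mx -mulmxA -TE -cT'E subrr.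
have [/existsP [j /existsP [i Gij]]|G0] :=
  boolP [exists j, exists i, (G j i)@_0%MM != 0].
  have pij := coef_homog_coeff0 (hG j i) Gij.
  right; exists (row j G), i, j; split=> //; first by rewrite -row_mul -cT'E linearZ.
  rewrite mxE; have := hG j i; rewrite pij => /coef_homog_const ->.
  exact: mpolyC_unit.
left; apply: (@det_support_perm _ (map_mx (mcoeff 0%MM) M)) => [i j|].
  by rewrite mxE; apply: coef_homog_coeff0.
have [h ch0] := row_neq0 c0.
have : \det (map_mx (fun f => f^`M(h)@_0%MM) G) * \det (map_mx (mcoeff 0%MM) M)
    = (c 0 h) ^+ k.
  rewrite -det_mulmx -det_scalar; congr (\det _); apply/matrixP => j i.
  have := congr1 (fun A : 'M[S]_k => (A j i)^`M(h)@_0%MM) GM.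
  rewrite !mxE (raddf_sum (mderiv h)) (raddf_sum (mcoeff 0%MM)).
  have -> : ((lin c *+ (j == i))^`M(h))@_0%MM = c 0 h *+ (j == i).
    by rewrite mcoeff_deriv add0m mnm0E mulr1n mcoeffMn linE.
  move=> <-; apply: eq_bigr => s _; rewrite !mxE.
  apply: etrans (congr1 (mcoeff 0%MM) (esym (mderivM h (G j s) (M s i)))).
  rewrite mcoeffD !rmorphM /=.
  suff -> : (G j s)@_0%MM = 0 by rewrite mul0r addr0.
  by move: G0; rewrite negb_exists => /forallP/(_ j); rewrite negb_exists
    => /forallP/(_ s); rewrite negbK => /eqP.
move=> dE; have: (c 0 h) ^+ k != 0 by rewrite expf_neq0.
by rewrite -dE; apply: contraNneq => ->; rewrite mulr0.
Qed.

(* At the smallest degree where the leading coefficients are not invertible,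
   a linear dependence between them lifts to a relation, because the
   [F j] of smaller degree are then combinations of the [X i]. *)
Lemma homog_relation a b N p q (X : 'M[S]_(a, N)) (F : 'M[S]_(b, N)) t0 :
  rows_homog p X -> rows_homog q F ->
  (forall i, (p i <= t0)%N -> exists c, row i X = c *m F) ->
  (forall t, (t < t0)%N ->
     (#|[set j | q j == t]| <= #|[set i | p i == t]|)%N) ->
  (#|[set j | q j == t0]| < #|[set i | p i == t0]|)%N ->
  exists t (g : 'rV_a), [/\ (t <= t0)%N, g *m X = 0,
    forall i, coef_homog t (p i) (g 0 i) &
    exists2 i, p i = t & g 0 i \is a GRing.unit].
Proof.
move=> hX hF XF cnt cnt0; set goal := exists t, _.
have /fin_all_exists [c cP] : forall i, exists c : 'rV_b, (p i <= t0)%N ->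
    row i X = c *m F /\ forall j, coef_homog (p i) (q j) (c 0 j).
  move=> i; case: (leqP (p i) t0) => pi; last by exists 0.
  have [|c' cE hc] := @coef_homog_factor _ _ q F (p i) (row i X) hF _ (XF i pi).
    by move=> j; rewrite mxE.
  by exists c'.
pose C : 'M_(a, b) := \matrix_i c i.
(* [B] writes the rows of [F] of degree below [t] in terms of those of [X]; its other rows are set
   to zero. *)
pose spanned t (B : 'M[S]_(b, a)) := forall j,
  if (q j < t)%N then row j F = row j B *m X /\
    forall i, coef_homog (q j) (p i) (B j i) else row j B = 0.
pose I t := [set i | p i == t]; pose J t := [set j | q j == t].
(* Constant terms of the coefficients of the degree [t] rows of [X] on the degree [t] rows of
   [F]. *)
pose E t : 'M[K]_(#|I t|, #|J t|) :=
  \matrix_(s, v) (C (enum_val s) (enum_val v))@_0%MM.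
(* A scalar combination [u] of the degree [t] rows of [X], corrected through [B] to remove the rows
   of [F] of smaller degree, leaves only degree [t] rows of [F], with scalars [u *m E t]. *)
have lift t B (u : 'rV[K]_#|I t|) : (t <= t0)%N -> spanned t B ->
  exists g : 'rV_a,
  [/\ g *m X = \sum_(v < #|J t|) ((u *m E t) 0 v)%:MP *: row (enum_val v) F,
      forall i, coef_homog t (p i) (g 0 i) &
      forall s, g 0 (enum_val s) = (u 0 s)%:MP].
  move=> tt0 hB; pose U := \row_i \sum_s u 0 s *+ (i == enum_val s).
  have U_ev s : U 0 (enum_val s) = u 0 s.
    rewrite mxE (bigD1 s) //= eqxx big1 ?addr0 // => s' s's.
    by rewrite (inj_eq enum_val_inj) eq_sym (negPf s's).
  have U_0 i : p i != t -> U 0 i = 0.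
    move=> pit; rewrite mxE big1 // => s _; case: eqP => // iE.
    by have := enum_valP s; rewrite -iE inE (negPf pit).
  pose Um := map_mx (@mpolyC n K) U; pose w := Um *m C.
  have Um_h i : coef_homog t (p i) (Um 0 i).
    have [<-|pit] := eqVneq (p i) t; first by rewrite mxE; apply: coef_homogC.
    by rewrite mxE U_0 // mpolyC0; apply: coef_homog0.
  have w_h j : coef_homog t (q j) (w 0 j).
    rewrite mxE; apply: coef_homog_sum => i _.
    have [pit|pit] := eqVneq (p i) t; last first.
      by rewrite mxE U_0 // mpolyC0 mul0r; apply: coef_homog0.
    apply: coef_homogM (Um_h i) _; rewrite mxE.
    by have [|_] := cP i; rewrite ?pit.
  have B_h i j : coef_homog t (p i) (w 0 j * B j i).
    have := hB j; case: ifP => _ [] hBj.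
      by move=> Bj; apply: coef_homogM (w_h j) _.
    have -> : B j i = 0 by have /rowP/(_ i) := hBj; rewrite !mxE.
    by rewrite mulr0; apply: coef_homog0.
  have gE i : (Um - w *m B) 0 i = Um 0 i - \sum_j w 0 j * B j i by rewrite !mxE.
  exists (Um - w *m B); split=> [|i|s]; last first.
  - rewrite gE [Um _ _]mxE U_ev big1 ?subr0 // => j _.
     have := hB j; have [qjt [_ Bj]|_ Bj] := ltnP (q j) t.
      have /eqP pst : p (enum_val s) == t by have := enum_valP s; rewrite inE.
      by rewrite (coef_homog_gt _ (Bj _)) ?mulr0 ?pst.
    have -> : B j (enum_val s) = 0 by have /rowP/(_ (enum_val s)) := Bj; rewrite !mxE.
    by rewrite mulr0.
  - rewrite gE; apply: coef_homogD => //.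
    by apply: coef_homogN; apply: coef_homog_sum => j _.
  have UX : Um *m X = w *m F.
    rewrite /w -mulmxA [LHS]mulmx_sum_row [RHS]mulmx_sum_row.
    apply: eq_bigr => i _; have [pit|pit] := eqVneq (p i) t; last first.
      by rewrite mxE U_0 // mpolyC0 !scale0r.
    by have [|XE _] := cP i; rewrite ?pit // XE row_mul rowK.
  rewrite mulmxBl UX -(mulmxA w B X) -mulmxBr mulmx_sum_row.
  rewrite (bigID (fun j => j \in J t)) /= [X in _ + X]big1 => [|j]; last first.
    rewrite inE neq_ltn linearB /= row_mul => qjt.
    have := hB j; case: ltnP qjt => [_ _ [FE _]|tq /= qt hBj].
      by rewrite FE subrr scaler0.
    by rewrite (coef_homog_gt qt (w_h j)) scale0r.
  rewrite addr0 big_enum_val; apply: eq_bigr => v _.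
  have /eqP qv : q (enum_val v) == t by have := enum_valP v; rewrite inE.
  rewrite linearB /= row_mul; have := hB (enum_val v); rewrite qv ltnn => ->.
  rewrite mul0mx subr0; congr (_ *: _).
  have := w_h (enum_val v); rewrite qv => /coef_homog_const ->; congr (_%:MP).
  rewrite [w _ _]mxE [(u *m E t) _ _]mxE raddf_sum /=.
  rewrite (bigID (fun i => i \in I t)) /= [X in _ + X]big1 => [|i]; last first.
    by rewrite inE => pit; rewrite [Um _ _]mxE U_0 // mpolyC0 mul0r mcoeff0.
  rewrite addr0 big_enum_val; apply: eq_bigr => s _.
  by rewrite rmorphM /= [Um _ _]mxE U_ev mcoeffC eqxx mulr1 [E t _ _]mxE.
(* A left kernel vector of [E t] lifts to the required relation; its nonzero entry is the unit
   coefficient. *)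
have free t B : (t <= t0)%N -> spanned t B -> goal \/ row_free (E t).
  move=> tt0 hB; have [|Et] := boolP (row_free (E t)); first by right.
  left; move: Et; rewrite -kermx_eq0 => /rowV0Pn [u /sub_kermxP uE u0].
  have [s us] := row_neq0 u0.
  have [g [gX hg gs]] := lift t B u tt0 hB.
  exists t, g; split=> //; first by rewrite gX uE big1 // => v _; rewrite mxE mpolyC0 scale0r.
  exists (enum_val s); first by have := enum_valP s; rewrite inE => /eqP.
  by rewrite gs mpolyC_unit.
have main t : (t <= t0)%N -> goal \/ exists B, spanned t B.
  elim: t => [_|t IHt tt0]; first by right; exists 0 => j; rewrite ltn0 row0.
  have [|[B hB]] := IHt (ltnW tt0); first by left.
  have [|Efree] := free t B (ltnW tt0) hB; first by left.
  right; have IJ : #|I t| = #|J t|.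
    apply/eqP; rewrite eqn_leq cnt // andbT.
    by move: Efree => /eqP <-; apply: rank_leq_col.
  (* By the count [E t] is square, so a left inverse [G] expresses the degree [t] rows of [F], and
     [B] extends to [t.+1]. *)
  have /row_fullP [G GE] : row_full (E t).
    by rewrite /row_full (eqP Efree) IJ.
  have /fin_all_exists [B' hB'] : forall j, exists B' : 'rV_a,
      if (q j < t.+1)%N then row j F = B' *m X /\
        forall i, coef_homog (q j) (p i) (B' 0 i) else B' = 0.
    move=> j; rewrite ltnS leq_eqVlt; case: eqP => [qjt|_] /=; last first.
      exists (row j B); have := hB j; case: ifP => // _ [FE hBj].
      by split=> // i; rewrite mxE.
    have jJ : j \in J t by rewrite inE qjt.
    have [g [gX hg _]] := lift t B (row (enum_rank_in jJ j) G) (ltnW tt0) hB.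
    exists g; split; last by rewrite qjt.
    rewrite gX -row_mul GE (bigD1 (enum_rank_in jJ j)) //= !mxE eqxx mpolyC1 scale1r.
    rewrite enum_rankK_in // big1 ?addr0 // => v vj.
    by rewrite !mxE eq_sym (negPf vj) mpolyC0 scale0r.
  exists (\matrix_j B' j) => j; rewrite rowK; have := hB' j; case: ifP => // _ [-> h].
  by split=> // i; rewrite mxE.
have [//|[B hB]] := main t0 (leqnn _).
have [//|Efree] := free t0 B (leqnn _) hB.
(* At [t0] there are more rows than columns, so [E t0] cannot be row free. *)
move: cnt0; rewrite ltnNge -[#|[set i | p i == t0]|](eqP Efree).
by rewrite rank_leq_col.
Qed.

End Graded.

(** * Multiarrangements of rank two *)

Section TwoRows.

Variable S : idomainType.

Definition rows2 N (x y : 'rV[S]_N) : 'M[S]_(2, N) :=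
  \matrix_i (if i == 0 then x else y).

Lemma row_rows2_0 N (x y : 'rV[S]_N) : row 0 (rows2 x y) = x.
Proof. by rewrite rowK. Qed.

Lemma row_rows2_1 N (x y : 'rV[S]_N) : row 1 (rows2 x y) = y.
Proof. by rewrite rowK. Qed.

Lemma ord2P (i : 'I_2) : i = 0 \/ i = 1.
Proof. by case: i => [[|[|//]] lti]; [left|right]; apply: val_inj. Qed.

Lemma mul_rows2 N (c : 'rV[S]_2) (x y : 'rV_N) :
  c *m rows2 x y = c 0 0 *: x + c 0 1 *: y.
Proof.
rewrite mulmx_sum_row big_ord_recl big_ord1 row_rows2_0; congr (_ + _ *: _).
  by congr (c 0 _); apply: val_inj.
by rewrite rowK.
Qed.

Definition det2 (x y : 'rV[S]_2) := x 0 0 * y 0 1 - x 0 1 * y 0 0.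

Lemma det_rows2 x y : \det (rows2 x y) = det2 x y.
Proof.
rewrite (expand_det_row _ 0) big_ord_recl big_ord1 /cofactor !det_mx11 !mxE /=.
rewrite /bump /= mul1r addn0 expr1 mulN1r mulrN /det2.
by congr (_ * y _ _ - x _ _ * y _ _); apply: val_inj.
Qed.

Lemma mulmx2 (x : 'rV[S]_2) (c : 'cV[S]_2) :
  (x *m c) 0 0 = x 0 0 * c 0 0 + x 0 1 * c 1 0.
Proof.
rewrite mxE big_ord_recl big_ord1; congr (_ + _ * _); congr (_ _ _);
  exact: val_inj.
Qed.

Lemma mulmx_subZ N (x y : 'rV[S]_N) g (c : 'cV[S]_N) :
  ((x - g *: y) *m c) 0 0 = (x *m c) 0 0 - g * (y *m c) 0 0.
Proof. by rewrite mulmxBl -scalemxAl !mxE. Qed.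

Variables (T : eqType) (J : seq T) (L : T -> S) (c : T -> 'cV[S]_2).

Hypothesis uniqJ : uniq J.
Hypothesis primeL : forall t, t \in J -> rprime (L t).
Hypothesis neqL : forall s t, s \in J -> t \in J -> s != t -> ~ rdvd (L s) (L t).
Hypothesis unit_c : forall t, t \in J -> exists i, c t i 0 \is a GRing.unit.

Local Notation Q m := (\prod_(t <- J) L t ^+ m t).
Local Notation D m := (log_mod J L m c).

Definition saito_pair m x y := [/\ D m x, D m y & rdvd (det2 x y) (Q m)].

Lemma saito_pair_sym m x y : saito_pair m x y -> saito_pair m y x.
Proof.
move=> [Dx Dy [g gE]]; split=> //; exists (- g).
by rewrite gE /det2; ring.
Qed.

Lemma saito_pair_basis m x y : saito_pair m x y -> mxbasis (D m) (rows2 x y).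
Proof.
move=> [Dx Dy dxy]; apply: saito_basis => //; last by rewrite det_rows2.
by move=> i; case: (ord2P i) => ->; rewrite ?row_rows2_0 ?row_rows2_1.
Qed.

Lemma saito_pair_dvd m x y : D m x -> D m y -> rdvd (Q m) (det2 x y).
Proof.
move=> Dx Dy; rewrite -det_rows2; apply: (saito_dvd_det (c := c)) => // i.
by case: (ord2P i) => ->; rewrite ?row_rows2_0 ?row_rows2_1.
Qed.

Variables (t : T) (m m' : T -> nat).
Hypotheses (tJ : t \in J) (mt : m t = (m' t).+1).
Hypothesis ms : forall s, s != t -> m s = m' s.

Lemma prod_mult_succ : Q m = L t * Q m'.
Proof.
rewrite !(big_rem t tJ) /= mt exprS -mulrA; congr (_ * (_ * _)).
rewrite [LHS]big_seq [RHS]big_seq; apply: eq_bigr => s.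
by rewrite mem_rem_uniq // inE => /andP [st _]; rewrite ms.
Qed.

(** The determinant acquires exactly the factor [L t] by which the product grows; the only new
    condition is the one at [t]. *)
Lemma saito_pair_succ x y g : saito_pair m' x y ->
  rdvd (L t ^+ m t) (((x - g *: y) *m c t) 0 0) ->
  saito_pair m (x - g *: y) (L t *: y).
Proof.
move=> [Dx Dy dxy] xyt; split=> [s sJ|s sJ|].
- have [->//|st] := eqVneq s t; rewrite ms // mulmx_subZ.
  by apply: rdvdB; [exact: Dx | apply/rdvd_mull/Dy].
- rewrite -scalemxAl mxE; have [->|st] := eqVneq s t.
    by rewrite mt exprS; apply: rdvd_mul; [apply: rdvd_refl | apply: Dy].
  by rewrite ms //; apply/rdvd_mull/Dy.
rewrite prod_mult_succ.
have -> : det2 (x - g *: y) (L t *: y) = L t * det2 x y.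
  by rewrite /det2 !mxE; ring.
by apply: rdvd_mul => //; apply: rdvd_refl.
Qed.

(** If [x = L t *: z], then [z] is in the module of [m'], and the determinant has two factors [L t]
    on top of the product for [m'], one too many. *)
Lemma saito_pair_succ_ndvd x y : saito_pair m x (L t *: y) ->
  D m' y -> ~ exists z, x = L t *: z.
Proof.
move=> [Dx Dy dxy] Dy' [z xE]; have [L0 L1 _] := primeL tJ.
have Dz : D m' z.
  move=> s sJ; have := Dx s sJ; rewrite xE -scalemxAl mxE.
  have [->|st] := eqVneq s t; first by rewrite mt exprS => /(rdvd_cancel L0).
  rewrite ms //; apply: rprime_exp_coprime; [exact: primeL | exact: neqL].
apply: L1; have Q0 : Q m != 0 by apply: saito_prod_neq0.
apply: (rdvd_cancel Q0); rewrite mulr1.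
apply: rdvd_trans dxy; rewrite prod_mult_succ xE.
have -> : det2 (L t *: z) (L t *: y) = L t * det2 z y * L t.
  by rewrite /det2 !mxE; ring.
apply: rdvd_mul; last exact: rdvd_refl.
by apply: rdvd_mul; [exact: rdvd_refl | apply: saito_pair_dvd].
Qed.

End TwoRows.

(** * Forms in two variables and division by a linear form *)

Section BinaryForms.

Variables (K : fieldType) (k : nat) (i0 i1 : 'I_k).
Hypothesis i01 : i0 != i1.
Local Notation S := {mpoly K[k]}.
Local Notation X := ('X_i0 : S).
Local Notation Y := ('X_i1 : S).

(** Forms of degree [p] in the variables of index [i0] and [i1] alone, zero included; the recursion
    supplies the induction for division by linear forms. *)
Fixpoint binary (p : nat) (f : S) : Prop :=
  if p is p'.+1 then
    exists g h, [/\ binary p' g, binary p' h & f = X * g + Y * h]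
  else exists a : K, f = a%:MP.

Lemma binary0 p : binary p 0.
Proof.
elim: p => [|p IHp] /=; first by exists 0; rewrite mpolyC0.
by exists 0, 0; rewrite !mulr0 addr0.
Qed.

Lemma binaryD p f g : binary p f -> binary p g -> binary p (f + g).
Proof.
elim: p f g => [|p IHp] f g /=.
  by move=> [a ->] [b ->]; exists (a + b); rewrite mpolyCD.
move=> [f1 [f2 [bf1 bf2 ->]]] [g1 [g2 [bg1 bg2 ->]]].
exists (f1 + g1), (f2 + g2); split; [exact: IHp | exact: IHp | ring].
Qed.

Lemma binaryZ p a f : binary p f -> binary p (a%:MP * f).
Proof.
elim: p f => [|p IHp] f /=; first by move=> [b ->]; exists (a * b); rewrite mpolyCM.
move=> [g [h [bg bh ->]]].
exists (a%:MP * g), (a%:MP * h); split; [exact: IHp | exact: IHp | ring].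
Qed.

Lemma binaryN p f : binary p f -> binary p (- f).
Proof.
by move=> /(binaryZ (-1)); rewrite mpolyCN mpolyC1 mulN1r.
Qed.

Definition binlin (a b : K) : S := a%:MP * X + b%:MP * Y.

Lemma binary_mul_lin p a b f : binary p f -> binary p.+1 (binlin a b * f).
Proof.
move=> bf; exists (a%:MP * f), (b%:MP * f).
by split; [exact: binaryZ | exact: binaryZ | rewrite /binlin; ring].
Qed.

Lemma binary_mul_linX p q a b f : binary p f -> binary (q + p) (binlin a b ^+ q * f).
Proof.
move=> bf; elim: q => [|q IHq]; first by rewrite mul1r.
by rewrite exprS -mulrA; apply: binary_mul_lin.
Qed.

Lemma binary_homog p f : binary p f -> f \is p.-homog.
Proof.
elim: p f => [|p IHp] f /=; first by move=> [a ->]; apply: homogC.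
move=> [g [h [/IHp hg /IHp hh ->]]].
by apply: rpredD; rewrite -add1n; apply: dhomogM => //; rewrite dhomogX /= mdeg1.
Qed.

Lemma binlin_lin a b : binlin a b = lin (a *: delta_mx 0 i0 + b *: delta_mx 0 i1).
Proof. by rewrite linearD !linearZ /= !lin_delta /binlin !mul_mpolyC. Qed.

Lemma binlin_coefs a b :
  (a *: delta_mx 0 i0 + b *: delta_mx 0 i1 : 'rV[K]_k) 0 i0 = a /\
  (a *: delta_mx 0 i0 + b *: delta_mx 0 i1 : 'rV[K]_k) 0 i1 = b.
Proof.
by rewrite !mxE !eqxx [i1 == i0]eq_sym (negPf i01) /= !mulr0 !mulr1 add0r addr0.
Qed.

Section Division.

(* [binlin a b] is the form to divide by, [binlin a' b'] a complement. *)
Variables (a b a' b' : K).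
Hypothesis ab : a * b' - b * a' != 0.
Local Notation L := (binlin a b).
Local Notation M := (binlin a' b').

Lemma binlin_neq0 : L != 0.
Proof.
have [ca cb] := binlin_coefs a b.
rewrite binlin_lin lin_eq0; apply: contraNneq ab => c0.
by move: ca cb; rewrite c0 !mxE => <- <-; rewrite !mul0r subr0.
Qed.

Lemma binlin_prime : rprime L.
Proof.
by rewrite binlin_lin; apply: lin_prime; rewrite -lin_eq0 -binlin_lin binlin_neq0.
Qed.

Lemma binlin_ndvd : ~ rdvd L M.
Proof.
rewrite !binlin_lin => /rdvd_lin [|e cE].
  by rewrite -lin_eq0 -binlin_lin binlin_neq0.
have [ca cb] := binlin_coefs a b; have [ca' cb'] := binlin_coefs a' b'.
move: ca' cb'; rewrite cE mxE ca mxE cb => a'E b'E.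
by case/eqP: ab; rewrite -a'E -b'E; ring.
Qed.

(** Modulo [L] both variables are scalar multiples of [M], so a form of degree [p] is a scalar times
    [M ^+ p]. The clause for [p = 0] compensates the truncated [p.-1]. *)
Lemma binary_div p f : binary p f ->
  exists e f', [/\ binary p.-1 f', p = 0%N -> f' = 0 &
    f = e%:MP * M ^+ p + L * f'].
Proof.
set dd := (a * b' - b * a')^-1.
(* The variables in terms of [L] and [M]; [dd] is the inverse of the determinant. *)
have XE : X = (dd * b')%:MP * L - (dd * b)%:MP * M.
  rewrite /binlin; transitivity ((dd * (a * b' - b * a'))%:MP * X).
    by rewrite mulVf // mpolyC1 mul1r.
  by rewrite !(mpolyCM, mpolyCB); ring.
have YE : Y = (dd * a)%:MP * M - (dd * a')%:MP * L.
  rewrite /binlin; transitivity ((dd * (a * b' - b * a'))%:MP * Y).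
    by rewrite mulVf // mpolyC1 mul1r.
  by rewrite !(mpolyCM, mpolyCB); ring.
elim: p f => [|p IHp] f /=.
  move=> [e ->]; exists e, 0; split=> //; first exact: (binary0 0).
  by rewrite mulr0 addr0 mulr1.
move=> [g [h [bg bh ->]]].
have [e1 [g' [bg' g'0 gE]]] := IHp g bg; have [e2 [h' [bh' h'0 hE]]] := IHp h bh.
exists (dd * a * e2 - dd * b * e1).
exists ((dd * b')%:MP * g + (- (dd * a'))%:MP * h
        + ((- (dd * b))%:MP * (M * g') + (dd * a)%:MP * (M * h'))); split=> //.
  apply: binaryD; first by apply: binaryD; apply: binaryZ.
  case: p {IHp bg bh gE hE} bg' bh' g'0 h'0 => [|p] bg' bh' g'0 h'0; last first.
    by apply: binaryD; apply/binaryZ/binary_mul_lin.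
  by rewrite g'0 // h'0 // !mulr0 addr0; apply: (binary0 0).
have Mg : M * g = e1%:MP * M ^+ p.+1 + L * (M * g') by rewrite exprS {1}gE; ring.
have Mh : M * h = e2%:MP * M ^+ p.+1 + L * (M * h') by rewrite exprS {1}hE; ring.
rewrite XE YE.
transitivity (L * ((dd * b')%:MP * g - (dd * a')%:MP * h) +
  ((dd * a)%:MP * (M * h) - (dd * b)%:MP * (M * g))); first by ring.
by rewrite Mg Mh !(mpolyCB, mpolyCM, mpolyCN); ring.
Qed.

(** The term [e%:MP * M ^+ p] must vanish, because the prime [L] divides neither a nonzero constant
    nor [M]. *)
Lemma binary_quotient p f h : binary p f -> f = L * h -> f != 0 ->
  (0 < p)%N /\ binary p.-1 h.
Proof.
have [_ L1 LM] := binlin_prime.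
move=> /binary_div [e [f' [bf' f'0 ->]]] fE f0.
have e0 : e = 0.
  apply/eqP/negP => /negP e0; have : rdvd L (e%:MP * M ^+ p).
    by exists (h - f'); rewrite mulrBr -fE addrK.
  case/LM => [Le|/(rprime_exp binlin_prime)/binlin_ndvd //].
  by apply/L1/(rdvd_trans Le)/rdvd_unit/mpolyC_unit.
move: fE f0; rewrite e0 mpolyC0 mul0r add0r => /(mulfI binlin_neq0) <- f0.
split=> //; rewrite lt0n; apply: contraNneq f0 => /f'0 ->; by rewrite mulr0.
Qed.

Lemma binary_quotientX n p f h : binary p f -> f = L ^+ n * h -> f != 0 ->
  (n <= p)%N /\ binary (p - n) h.
Proof.
elim: n p f => [|n IHn] p f bf.
  by rewrite mul1r subn0 => <-.
rewrite exprS -mulrA => fE f0; have [p0 bh] := binary_quotient bf fE f0.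
have [|np bh'] := IHn p.-1 (L ^+ n * h) bh erefl.
  by apply: contraNneq f0; rewrite fE => ->; rewrite mulr0.
by case: p {bf bh} p0 np bh' => //= p _ np; rewrite subSS.
Qed.

End Division.

(** * Freeness in rank two, raising one multiplicity at a time *)

Section Rank2.

Variables (T : eqType) (J : seq T) (a b : T -> K).

Hypothesis uniqJ : uniq J.
Hypothesis ab0 : forall t, t \in J -> (a t != 0) || (b t != 0).
Hypothesis abJ : forall s t, s \in J -> t \in J -> s != t ->
  a s * b t - b s * a t != 0.

Definition binvec t : 'cV[S]_2 := \col_i (if i == 0 then a t else b t)%:MP.

Local Notation L t := (binlin (a t) (b t)).
Local Notation D m := (log_mod J (fun t => L t) m binvec).

Lemma binlin_complement t : t \in J ->
  exists a' b', a t * b' - b t * a' != 0.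
Proof.
move=> /ab0 /orP [at0|bt0]; first by exists 0, 1; rewrite mulr0 mulr1 subr0.
by exists 1, 0; rewrite mulr0 mulr1 sub0r oppr_eq0.
Qed.

Lemma rank2_prime t : t \in J -> rprime (L t).
Proof. by move=> /binlin_complement [a' [b' /binlin_prime]]. Qed.

Lemma rank2_ndvd s t : s \in J -> t \in J -> s != t -> ~ rdvd (L s) (L t).
Proof. by move=> sJ tJ st; apply: binlin_ndvd; apply: abJ. Qed.

Lemma rank2_unit t : t \in J -> exists i, binvec t i 0 \is a GRing.unit.
Proof.
by move=> /ab0 /orP [h|h]; [exists 0 | exists 1]; rewrite mxE mpolyC_unit.
Qed.

Let primeL := rank2_prime.
Let ndvdL := rank2_ndvd.
Let unitL := rank2_unit.

Definition binrow p (x : 'rV[S]_2) := forall i, binary p (x 0 i).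

Lemma binrow_eval p x t : binrow p x -> binary p ((x *m binvec t) 0 0).
Proof.
move=> bx; rewrite mulmx2 !mxE /=.
by apply: binaryD; rewrite mulrC; apply: binaryZ.
Qed.

(** The scalar [e] is the obstruction to one more factor [L t]: modulo [L t], a binary form is a
    scalar times a power of the complement. *)
Lemma binrow_lead p x t n a' b' : a t * b' - b t * a' != 0 ->
  binrow p x -> rdvd (L t ^+ n) ((x *m binvec t) 0 0) ->
  exists e r, (e != 0 -> (n <= p)%N) /\
    (x *m binvec t) 0 0 =
      L t ^+ n * (e%:MP * binlin a' b' ^+ (p - n)) + L t ^+ n.+1 * r.
Proof.
move=> ab bx; move: (binrow_eval t bx); set f := (_ *m _) 0 0 => bf [h fE].
have [f0|f0] := eqVneq f 0.
  by exists 0, 0; rewrite f0 eqxx mpolyC0 mul0r !mulr0 addr0.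
have [np bh] := binary_quotientX ab bf fE f0.
have [e [h' [_ _ hE]]] := binary_div ab bh.
exists e, h'; split=> //.
by rewrite [LHS]fE {1}hE exprS; ring.
Qed.

(** A member with nonzero obstruction at [t] cancels the obstruction of the other one, whose value
    gains a factor [L t]; it is then itself multiplied by [L t]. *)
Lemma rank2_step m m' t p q x y :
  t \in J -> m t = (m' t).+1 -> (forall s, s != t -> m s = m' s) ->
  binrow p x -> binrow q y -> saito_pair J (fun t => L t) binvec m' x y ->
  exists p' q' x' y', [/\ binrow p' x', binrow q' y',
    saito_pair J (fun t => L t) binvec m x' (L t *: y') & D m' y'].
Proof.
move=> tJ mt ms; have [a' [b' ab]] := binlin_complement tJ.
(* Here [y1] has nonzero obstruction [e2], and [x1] is corrected by a multiple of it, homogeneous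
   because [q1 <= p1] or [e1 = 0]. *)
have core p1 q1 x1 y1 e1 r1 e2 r2 :
    binrow p1 x1 -> binrow q1 y1 -> saito_pair J (fun t => L t) binvec m' x1 y1 ->
    (x1 *m binvec t) 0 0 = L t ^+ m' t * (e1%:MP * binlin a' b' ^+ (p1 - m' t))
      + L t ^+ (m' t).+1 * r1 ->
    (y1 *m binvec t) 0 0 = L t ^+ m' t * (e2%:MP * binlin a' b' ^+ (q1 - m' t))
      + L t ^+ (m' t).+1 * r2 ->
    (m' t <= q1)%N -> e2 != 0 -> e1 = 0 \/ (q1 <= p1)%N ->
    exists p' q' x' y', [/\ binrow p' x', binrow q' y',
      saito_pair J (fun t => L t) binvec m x' (L t *: y') & D m' y'].
  move=> bx by1 xy1 xE yE mq e20 e1q.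
  pose g : S := (e1 / e2)%:MP * binlin a' b' ^+ (p1 - q1).
  exists p1, q1, (x1 - g *: y1), y1; split=> //; last by case: xy1.
    move=> i; rewrite !mxE; apply: binaryD => //; apply: binaryN.
    rewrite /g; case: e1q => [->|qp]; first by rewrite mul0r mpolyC0 !mul0r; apply: binary0.
    rewrite -mulrA; apply: binaryZ.
    by have := binary_mul_linX (p1 - q1) a' b' (by1 i); rewrite subnK.
  apply: (@saito_pair_succ _ _ _ _ _ uniqJ _ _ m') => //.
  rewrite mulmx_subZ xE yE mt.
  exists (r1 - g * r2); case: e1q => [e10|qp].
    by rewrite /g e10 [0 / e2]mul0r mpolyC0 !mul0r !mulr0 !subr0 add0r.
  have -> : (p1 - m' t = (p1 - q1) + (q1 - m' t))%N by rewrite addnBA // subnK.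
  have -> : e1 = e1 / e2 * e2 by rewrite divfK.
  rewrite /g !exprD !mpolyCM; ring.
move=> bx by1 xy; have [Dx Dy dxy] := xy.
have [ex [rx [pm xE]]] := binrow_lead ab bx (Dx t tJ).
have [ey [ry [qm yE]]] := binrow_lead ab by1 (Dy t tJ).
have yx := saito_pair_sym xy.
have [ey0|ey0] := eqVneq ey 0; have [ex0|ex0] := eqVneq ex 0; last 1 first.
- have [qp|pq] := leqP q p.
    by apply: (core _ _ _ _ _ _ _ _ bx by1 xy xE yE) => //; [apply: qm | right].
  by apply: (core _ _ _ _ _ _ _ _ by1 bx yx yE xE) => //; [apply: pm | right; apply: ltnW].
(* If both obstructions vanish, both members satisfy the conditions for [m]; then the product for
   [m] divides the product for [m'], and [L t] divides 1. *)
- exfalso; have [_ L1 _] := primeL tJ; apply: L1.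
  have Dm z : D m' z -> rdvd (L t ^+ m t) ((z *m binvec t) 0 0) -> D m z.
    by move=> Dz Lz s sJ; have [->//|st] := eqVneq s t; rewrite ms //; apply: Dz.
  have Q'0 := saito_prod_neq0 m' primeL.
  apply: (rdvd_cancel Q'0); rewrite mulr1 mulrC.
  rewrite -(prod_mult_succ (fun t => L t) uniqJ tJ mt ms).
  apply: rdvd_trans dxy; apply: (saito_pair_dvd uniqJ primeL ndvdL unitL); apply: Dm => //.
    by rewrite xE ex0 mpolyC0 mul0r mulr0 add0r mt; apply/rdvd_mulr/rdvd_refl.
  by rewrite yE ey0 mpolyC0 mul0r mulr0 add0r mt; apply/rdvd_mulr/rdvd_refl.
- by apply: (core _ _ _ _ _ _ _ _ by1 bx yx yE xE) => //; [apply: pm | left].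
by apply: (core _ _ _ _ _ _ _ _ bx by1 xy xE yE) => //; [apply: qm | left].
Qed.

(** Induction on the total multiplicity, starting from the two coordinate derivations. *)
Lemma rank2_free m : exists p q x y, [/\ binrow p x, binrow q y &
  saito_pair J (fun t => L t) binvec m x y].
Proof.
have [N mN] : exists N, (\sum_(t <- J) m t)%N = N by exists (\sum_(t <- J) m t)%N.
elim: N m mN => [|N IHN] m mN.
  have m0 t : t \in J -> m t = 0%N.
    by move=> tJ; apply/eqP; move/eqP: mN; rewrite sum_nat_seq_eq0 => /allP/(_ t tJ).
  exists 0%N, 0%N, (delta_mx 0 0), (delta_mx 0 1); split.
  - by move=> i; rewrite mxE /=; exists (i == 0)%:R; case: eqP; rewrite ?mpolyC1 ?mpolyC0.
  - by move=> i; rewrite mxE /=; exists (i == 1)%:R; case: eqP; rewrite ?mpolyC1 ?mpolyC0.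
  split=> [t tJ|t tJ|]; try by rewrite m0 // expr0; apply: rdvd1r.
  by rewrite /det2 !mxE /= mulr1 mulr0 subr0; apply: rdvd1r.
have [t tJ mt] : exists2 t, t \in J & (0 < m t)%N.
  have : (\sum_(t <- J) m t)%N != 0%N by rewrite mN.
  rewrite sum_nat_seq_neq0 => /hasP [t tJ]; rewrite /= -lt0n; by exists t.
pose m' s := if s == t then (m t).-1 else m s.
have mt' : m t = (m' t).+1 by rewrite /m' eqxx prednK.
have ms s : s != t -> m s = m' s by rewrite /m' => /negPf ->.
have [|p [q [x [y [bx by1 xy]]]]] := IHN m'.
  apply: succn_inj; rewrite -mN !(big_rem t tJ) /= -addSn -mt'; congr (_ + _)%N.
  rewrite [LHS]big_seq [RHS]big_seq; apply: eq_bigr => s.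
  by rewrite mem_rem_uniq // inE => /andP [st _]; rewrite ms.
have [p' [q' [x' [y' [bx' by' xy' _]]]]] := rank2_step tJ mt' ms bx by1 xy.
exists p', q'.+1, x', (L t *: y'); split=> // i.
by rewrite mxE; apply: binary_mul_lin.
Qed.

(* The homogeneous basis adapted to the hyperplane [t] that defines the Euler
   multiplicity. *)
Lemma rank2_adapted_basis m t : t \in J -> (0 < m t)%N ->
  exists p q x y, [/\ binrow p x, binrow q y,
    mxbasis (D m) (rows2 x y), ~ (exists z, x = L t *: z) &
    exists z, y = L t *: z].
Proof.
move=> tJ m0; pose m' s := if s == t then (m t).-1 else m s.
have mt' : m t = (m' t).+1 by rewrite /m' eqxx prednK.
have ms s : s != t -> m s = m' s by rewrite /m' => /negPf ->.
(* Starting from [m'] makes the last step take place at [t], so that one member is a multiple of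
   [L t]. *)
have [p [q [x [y [bx by1 xy]]]]] := rank2_free m'.
have [p' [q' [x' [y' [bx' by' xy' Dy']]]]] := rank2_step tJ mt' ms bx by1 xy.
exists p', q'.+1, x', (L t *: y'); split=> //.
- by move=> i; rewrite mxE; apply: binary_mul_lin.
- exact: saito_pair_basis xy'.
- exact: (saito_pair_succ_ndvd (L := fun t => L t) (c := binvec) uniqJ primeL
    ndvdL unitL tJ mt' ms xy' Dy').
by exists y'.
Qed.

End Rank2.

End BinaryForms.

(** * The local basis at a codimension two flat *)

Section SeqBases.

Variables (S : nzRingType) (M : lmodType S).
Implicit Types (b x y : M) (B : seq M).

Definition in_span B x := exists c : 'I_(size B) -> S, x = \sum_i c i *: B`_i.

Definition seq_indep B :=
  forall c : 'I_(size B) -> S, \sum_i c i *: B`_i = 0 -> forall i, c i = 0.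

Lemma sum_cons b B (c : 'I_(size (b :: B)) -> S) :
  \sum_i c i *: (b :: B)`_i =
  c ord0 *: b + \sum_(i < size B) c (lift ord0 i) *: B`_i.
Proof. by rewrite big_ord_recl. Qed.

Definition fcons B a (c : 'I_(size B) -> S) (i : 'I_(size B).+1) : S :=
  if unlift ord0 i is Some j then c j else a.

Lemma fcons0 B a (c : 'I_(size B) -> S) : fcons a c ord0 = a.
Proof. by rewrite /fcons unlift_none. Qed.

Lemma fconsS B a (c : 'I_(size B) -> S) i : fcons a c (lift ord0 i) = c i.
Proof. by rewrite /fcons liftK. Qed.

Lemma in_span_nil x : in_span [::] x <-> x = 0.
Proof.
split=> [[c ->]|->]; first by rewrite big_ord0.
by exists (fun=> 0); rewrite big_ord0.
Qed.

Lemma in_span_cons b B x :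
  in_span (b :: B) x <-> exists a y, x = a *: b + y /\ in_span B y.
Proof.
split=> [[c ->]|[a [_ [-> [c ->]]]]].
  rewrite sum_cons; exists (c ord0), (\sum_(i < size B) c (lift ord0 i) *: B`_i).
  by split=> //; exists (fun i => c (lift ord0 i)).
exists (fcons a c); rewrite sum_cons fcons0; congr (_ + _).
by apply: eq_bigr => i _; rewrite fconsS.
Qed.

Lemma seq_indep_cons b B : seq_indep (b :: B) <->
  seq_indep B /\ forall a y, in_span B y -> a *: b + y = 0 -> a = 0.
Proof.
split=> [ind|[ind bB] c].
  split=> [c c0 i|a _ [c ->] ac0]; last first.
    rewrite -(fcons0 a c); apply: ind; rewrite sum_cons fcons0 -[RHS]ac0.
    by congr (_ + _); apply: eq_bigr => i _; rewrite fconsS.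
  rewrite -(fconsS 0 c); apply: ind; rewrite sum_cons fcons0 scale0r add0r -[RHS]c0.
  by apply: eq_bigr => j _; rewrite fconsS.
rewrite sum_cons => c0; have c00 : c ord0 = 0.
  by apply: bB c0; exists (fun i => c (lift ord0 i)).
move: c0; rewrite c00 scale0r add0r => c0 i.
case: (unliftP ord0 i) => [j|] -> //.
exact: (ind (fun j => c (lift ord0 j))).
Qed.

End SeqBases.

Section Partials.

Variables (K : fieldType) (k : nat).

Lemma in_span_partial (s : seq 'I_k) (x : Der K k) :
  in_span [seq partial K i | i <- s] x <-> forall i, i \notin s -> x 0 i = 0.
Proof.
elim: s x => [|j s IHs] x.
  split=> [/in_span_nil -> i _|x0]; first by rewrite mxE.
  by apply/in_span_nil/rowP => i; rewrite x0 // mxE.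
split=> [/in_span_cons [a [y [-> /IHs yP]]] i|xP].
  rewrite inE negb_or => /andP [ij /yP y0].
  by rewrite !mxE y0 (negPf ij) andbF mulr0 addr0.
apply/in_span_cons; exists (x 0 j), (x - x 0 j *: partial K j).
split; first by rewrite addrCA subrr addr0.
apply/IHs => i is_; rewrite !mxE eqxx /=.
have [->|ij] := eqVneq i j; first by rewrite mulr1 subrr.
by rewrite mulr0 subr0 xP // inE negb_or ij.
Qed.

Lemma seq_indep_partial (s : seq 'I_k) :
  uniq s -> seq_indep [seq partial K i | i <- s].
Proof.
elim: s => [_ c _ []//|j s IHs /= /andP [js us]].
apply/seq_indep_cons; split; first exact: IHs.
move=> a y /in_span_partial/(_ j js) y0 /rowP/(_ j).
by rewrite !mxE y0 !eqxx mulr1 addr0.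
Qed.

End Partials.

Section Evaluation.

Variables (K : fieldType) (k : nat).
Local Notation S := {mpoly K[k]}.

(* The value of the derivation [x] on the linear form [lin c]. *)
Definition ev (x : 'rV[S]_k) (c : 'rV[K]_k) : S := \sum_i c 0 i *: x 0 i.

Lemma evE x c : ev x c = (x *m (\col_i (c 0 i)%:MP)) 0 0.
Proof. by rewrite mxE; apply: eq_bigr => i _; rewrite mxE mulrC mul_mpolyC. Qed.

Lemma evD x y c : ev (x + y) c = ev x c + ev y c.
Proof. by rewrite !evE mulmxDl mxE. Qed.

Lemma evZ a x c : ev (a *: x) c = a * ev x c.
Proof. by rewrite !evE -scalemxAl mxE. Qed.

Lemma ev_lin x a b c d : ev x (a *: c + b *: d) = a *: ev x c + b *: ev x d.
Proof.
rewrite /ev !scaler_sumr -big_split; apply: eq_bigr => i _.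
by rewrite !mxE scalerDl !scalerA.
Qed.

Definition arr_mod (T : eqType) (J : seq T) (C : T -> 'rV[K]_k) (m : T -> nat)
    (x : 'rV[S]_k) :=
  forall t, t \in J -> rdvd (lin (C t) ^+ m t) (ev x (C t)).

Lemma arr_mod_log_mod (T : eqType) J (C : T -> 'rV[K]_k) m x : arr_mod J C m x <->
  log_mod J (fun t => lin (C t)) m (fun t => \col_i (C t 0 i)%:MP) x.
Proof. by split=> Dx t tJ; have := Dx t tJ; rewrite evE. Qed.

End Evaluation.

(** * Reduction of a localization to two variables *)

Section Local.

Variables (K : fieldType) (k : nat) (i0 i1 : 'I_k).
Hypothesis i01 : i0 != i1.
Local Notation S := {mpoly K[k]}.

Variables (T : eqType) (J : seq T) (C : T -> 'rV[K]_k).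

Hypothesis uniqJ : uniq J.
Hypothesis suppC : forall t i, t \in J -> i != i0 -> i != i1 -> C t 0 i = 0.
Hypothesis C0 : forall t, t \in J -> C t != 0.
Hypothesis CJ : forall s t e, s \in J -> t \in J -> s != t -> C t != e *: C s.

Let a t := C t 0 i0.
Let b t := C t 0 i1.

Lemma local_coef t : t \in J -> C t = a t *: delta_mx 0 i0 + b t *: delta_mx 0 i1.
Proof.
move=> tJ; have [ha hb] := binlin_coefs i01 (a t) (b t).
apply/rowP => i; have [->|ni0] := eqVneq i i0; first by rewrite ha.
have [->|ni1] := eqVneq i i1; first by rewrite hb.
by rewrite suppC // !mxE (negPf ni0) (negPf ni1) !mulr0 addr0.
Qed.

Lemma local_lin t : t \in J -> lin (C t) = binlin i0 i1 (a t) (b t).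
Proof. by move=> tJ; rewrite binlin_lin -local_coef. Qed.

Lemma local_ab0 t : t \in J -> (a t != 0) || (b t != 0).
Proof.
move=> tJ; rewrite -negb_and; apply: contra (C0 tJ) => /andP [/eqP a0 /eqP b0].
by rewrite (local_coef tJ) a0 b0 !scale0r addr0.
Qed.

Lemma local_abJ s t : s \in J -> t \in J -> s != t -> a s * b t - b s * a t != 0.
Proof.
move=> sJ tJ st; apply/negP; rewrite subr_eq0 => /eqP abE.
have [as0|as0] := eqVneq (a s) 0; last first.
  have /eqP[] := CJ (a t / a s) sJ tJ st.
  rewrite (local_coef tJ) (local_coef sJ) scalerDr !scalerA divfK //.
  by congr (_ + _ *: _); rewrite mulrAC [a t * _]mulrC -abE mulrAC divff ?mul1r.
have bs0 : b s != 0 by have := local_ab0 sJ; rewrite as0 eqxx.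
have at0 : a t = 0.
  by move/esym/eqP: abE; rewrite as0 mul0r mulf_eq0 (negPf bs0) => /eqP.
have /eqP[] := CJ (b t / b s) sJ tJ st.
by rewrite (local_coef tJ) (local_coef sJ) as0 at0 !scale0r !add0r scalerA divfK.
Qed.

Definition restr2 (x : 'rV[S]_k) : 'rV[S]_2 := \row_i x 0 (if i == 0 then i0 else i1).

Definition ext2 (z : 'rV[S]_2) : 'rV[S]_k :=
  \row_i (if i == i0 then z 0 0 else if i == i1 then z 0 1 else 0).

Lemma ext2K : cancel ext2 restr2.
Proof.
move=> z; apply/rowP => i; rewrite !mxE; have [->|->] := ord2P i.
  by rewrite !eqxx.
by rewrite /= eq_sym (negPf i01) eqxx.
Qed.

Lemma restr2D x y : restr2 (x + y) = restr2 x + restr2 y.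
Proof. by apply/rowP => i; rewrite !mxE. Qed.

Lemma restr2Z e x : restr2 (e *: x) = e *: restr2 x.
Proof. by apply/rowP => i; rewrite !mxE. Qed.

Lemma ev_restr2 x t : t \in J -> ev x (C t) = (restr2 x *m binvec k a b t) 0 0.
Proof.
move=> tJ; rewrite mulmx2 !mxE /= /ev (bigD1 i0) //= (bigD1 i1) 1?eq_sym //=.
rewrite big1 ?addr0 => [|i /andP [ni0 ni1]]; last by rewrite suppC ?scale0r.
by rewrite -!mul_mpolyC !(mulrC _%:MP).
Qed.

Local Notation L := (fun t => binlin i0 i1 (a t) (b t)).

Lemma arr_mod_restr2 m x :
  arr_mod J C m x <-> log_mod J L m (binvec k a b) (restr2 x).
Proof.
by split=> Dx t tJ; have := Dx t tJ; rewrite -local_lin // ev_restr2.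
Qed.

Definition transverse := [seq i <- enum 'I_k | (i != i0) && (i != i1)].

Lemma transverse_span (x : Der K k) :
  in_span [seq partial K i | i <- transverse] x <-> restr2 x = 0.
Proof.
apply: (iff_trans (in_span_partial _ _)); split=> [x0|x0 i].
  apply/rowP => i; rewrite !mxE x0 // mem_filter mem_enum andbT.
  by case: ifP; rewrite ?eqxx ?andbF.
rewrite mem_filter mem_enum andbT negb_and !negbK => /orP [/eqP->|/eqP->].
  by have /rowP/(_ 0) := x0; rewrite !mxE.
by have /rowP/(_ 1) := x0; rewrite !mxE.
Qed.

(** The transverse partial derivatives kill every form involved, so the module is a rank two module
    plus their span. *)
Lemma transverse_basis m (x y : Der K k) :
  is_basis (arr_mod J C m) [:: x, y & [seq partial K i | i <- transverse]] <->
  mxbasis (log_mod J L m (binvec k a b)) (rows2 (restr2 x) (restr2 y)).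
Proof.
pose P : seq (Der K k) := [seq partial K i | i <- transverse].
have spanE z : in_span [:: x, y & P] z <->
    exists c : 'rV_2, restr2 z = c *m rows2 (restr2 x) (restr2 y).
  split=> [/in_span_cons [e1 [_ [-> /in_span_cons [e2 [w [-> /transverse_span w0]]]]]]|].
    exists (\row_i (if i == 0 then e1 else e2)); rewrite mul_rows2 !mxE /=.
    by rewrite !restr2D !restr2Z w0 addr0.
  move=> [c]; rewrite mul_rows2 => zE; apply/in_span_cons.
  exists (c 0 0), (z - c 0 0 *: x); split; first by rewrite addrCA subrr addr0.
  apply/in_span_cons; exists (c 0 1), (z - c 0 0 *: x - c 0 1 *: y).
  split; first by rewrite addrCA subrr addr0.
  apply/transverse_span; rewrite -!scaleNr !restr2D !restr2Z zE.
  by rewrite !scaleNr addrAC addrK subrr.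
split=> [[DE ind]|[DE ind]].
  split=> [z|c].
    have -> : log_mod J L m (binvec k a b) z <-> arr_mod J C m (ext2 z).
      by rewrite arr_mod_restr2 ext2K.
    by apply: (iff_trans (DE _)); apply: (iff_trans (spanE _)); rewrite ext2K.
  rewrite mul_rows2 => cxy.
  have {ind} /seq_indep_cons [/seq_indep_cons [_ ind1] ind0] := ind.
  pose w := - (c 0 0 *: x + c 0 1 *: y).
  have wP : in_span P w.
    apply/transverse_span; rewrite /w -scaleN1r restr2Z restr2D !restr2Z cxy.
    by rewrite scaler0.
  have c0 : c 0 0 = 0.
    apply: (ind0 _ (c 0 1 *: y + w)); last by rewrite addrA /w subrr.
    by apply/in_span_cons; exists (c 0 1), w.
  have c1 : c 0 1 = 0.
    by apply: (ind1 _ w) => //; rewrite /w c0 scale0r add0r subrr.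
  by apply/rowP => i; rewrite mxE; have [->|->] := ord2P i.
split=> [z|].
  apply: (iff_trans (arr_mod_restr2 _ _)); apply: (iff_trans (DE _)).
  exact: iff_sym (spanE _).
have indz e1 e2 (w : Der K k) : restr2 w = 0 -> e1 *: x + (e2 *: y + w) = 0 ->
    e1 = 0 /\ e2 = 0.
  move=> w0 /(congr1 restr2); rewrite !restr2D !restr2Z w0 addr0 => exy.
  have /rowP e0 : \row_i (if i == 0 then e1 else e2) = 0 :> 'rV[S]_2.
    apply: ind; rewrite mul_rows2 !mxE /= exy.
    by apply/rowP => i; rewrite !mxE.
  by split; [have := e0 0 | have := e0 1]; rewrite !mxE.
apply/seq_indep_cons; split; last first.
  by move=> e1 _ /in_span_cons [e2 [w [-> /transverse_span w0]]] /indz [].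
apply/seq_indep_cons; split.
  by apply: seq_indep_partial; rewrite filter_uniq ?enum_uniq.
move=> e2 w /transverse_span w0 yw.
by have [|//] := indz 0 e2 w w0; rewrite scale0r add0r.
Qed.

Lemma local_adapted_basis m t : t \in J -> (0 < m t)%N ->
  exists p q (x y : Der K k), [/\
    is_basis (arr_mod J C m) [:: x, y & [seq partial K i | i <- transverse]],
    (x != 0) /\ (forall i, x 0 i \is p.-homog),
    (y != 0) /\ (forall i, y 0 i \is q.-homog),
    ~ (exists z, x = lin (C t) *: z) & exists z, y = lin (C t) *: z].
Proof.
move=> tJ mt; have [p [q [x [y [bx by1 bas xL [z yL]]]]]] :=
  rank2_adapted_basis i01 uniqJ local_ab0 local_abJ tJ mt.
have ext_homog n (v : 'rV[S]_2) : binrow i0 i1 n v -> forall i, ext2 v 0 i \is n.-homog.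
  move=> bv i; rewrite mxE; case: eqP => _; first exact: binary_homog (bv 0).
  case: eqP => _; first exact: binary_homog (bv 1).
  exact: dhomog0.
have ext0 (v : 'rV[S]_2) : v != 0 -> ext2 v != 0.
  apply: contraNneq => v0; rewrite -(ext2K v) v0; apply/eqP/rowP => i.
  by rewrite !mxE.
have [_ ind] := bas.
have x0 : x != 0.
  apply/eqP => x0; have /rowP/(_ 0)/eqP : delta_mx 0 0 = 0 :> 'rV[S]_2.
    by apply: ind; rewrite mul_rows2 !mxE x0 /= scaler0 scale0r addr0.
  by rewrite !mxE oner_eq0.
have y0 : y != 0.
  apply/eqP => y0; have /rowP/(_ 1)/eqP : delta_mx 0 1 = 0 :> 'rV[S]_2.
    by apply: ind; rewrite mul_rows2 !mxE y0 /= scaler0 scale0r addr0.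
  by rewrite !mxE oner_eq0.
exists p, q, (ext2 x), (ext2 y); split.
- by apply/transverse_basis; rewrite !ext2K.
- by split; [exact: ext0 | exact: ext_homog].
- by split; [exact: ext0 | exact: ext_homog].
- move=> [w xE]; apply: xL; exists (restr2 w).
  by rewrite -local_lin // -restr2Z -xE ext2K.
exists (ext2 z); rewrite yL local_lin //; apply/rowP => i; rewrite !mxE.
by do 2?case: ifP => //; rewrite mulr0.
Qed.

(* The images of [theta(beta)] and [psi(alpha)/alpha^m] modulo [alpha] have
   product [gamma^N] up to a unit; by homogeneity the first factor is
   [gamma^d]. *)
Lemma euler_degree_bounds (n : nat) (f : {rmorphism S -> {mpoly K[n]}})
    (g : 'rV[K]_n) (e : T -> K) m t0 t1 d (x y : Der K k) :
  t0 \in J -> t1 \in J -> t0 != t1 -> g != 0 ->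
  (forall p q, p \is q.-homog -> f p \is q.-homog) ->
  (forall z, f z = 0 <-> rdvd (lin (C t0)) z) ->
  (forall t, t \in J -> t != t0 -> e t != 0 /\ f (lin (C t)) = e t *: lin g) ->
  is_basis (arr_mod J C m) [:: x, y & [seq partial K i | i <- transverse]] ->
  (forall i, x 0 i \is d.-homog) -> (exists z, y = lin (C t0) *: z) ->
  let N := (\sum_(t <- rem t0 J) m t)%N in
  [/\ (d <= N)%N,
      forall z, arr_mod J C m z -> rdvd (lin g ^+ d) (f (ev z (C t1))) &
      forall z h, arr_mod J C m (lin (C t0) *: z) ->
        lin (C t0) * ev z (C t0) = lin (C t0) ^+ m t0 * h ->
        rdvd (lin g ^+ (N - d)) (f h)].
Proof.
move=> t0J t1J t01 g0 f_homog f_ker f_lin bas hx [z0 yE] N.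
have gP := lin_prime g0; have a0 : lin (C t0) != 0 by rewrite lin_eq0 C0.
have fa0 : f (lin (C t0)) = 0 by apply/f_ker/rdvd_refl.
have [DE _] := bas.
have bas2 := (transverse_basis m x y).1 bas.
have Dspan z : arr_mod J C m z -> exists e1 e2, forall t, t \in J ->
    ev z (C t) = e1 * ev x (C t) + e2 * ev y (C t).
  move=> /arr_mod_restr2 Dz; have [c] := (bas2.1 _).1 Dz.
  rewrite mul_rows2 => zE; exists (c 0 0), (c 0 1) => t tJ.
  by rewrite !ev_restr2 // zE mulmxDl -!scalemxAl [LHS]mxE ![(_ *: (_ *m _)) _ _]mxE.
have Dx : arr_mod J C m x.
  by apply/arr_mod_restr2; have := mxbasis_row 0 bas2; rewrite row_rows2_0.
have Dy : arr_mod J C m y.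
  by apply/arr_mod_restr2; have := mxbasis_row 1 bas2; rewrite row_rows2_1.
have [u uE] := Dx t0 t0J; have [v vE] := Dy t0 t0J.
pose Q := \prod_(t <- J) lin (C t) ^+ m t.
pose R := \prod_(t <- rem t0 J) lin (C t) ^+ m t.
have QE : Q = lin (C t0) ^+ m t0 * R by rewrite /Q (big_rem t0).
(* The determinant of the values on [C t0] and [C t1] is that of the rank two basis, an associate of
   [Q], times a nonzero scalar. *)
have [w [wU detE]] : exists w, w \is a GRing.unit /\
    ev x (C t0) * ev y (C t1) - ev x (C t1) * ev y (C t0) = Q * w.
  have QL : Q = \prod_(t <- J) L t ^+ m t.
    by rewrite /Q !big_seq; apply: eq_bigr => t tJ; rewrite local_lin.
  have [] := saito_det_assoc uniqJ (rank2_prime i01 local_ab0)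
    (rank2_ndvd i01 local_abJ) (rank2_unit k local_ab0) bas2.
  rewrite det_rows2 -QL => -[w1 dE] [w2 dE'].
  have Q0 : Q != 0.
    by rewrite QL; apply/saito_prod_neq0/(rank2_prime i01 local_ab0).
  have w1U : w1 \is a GRing.unit.
    apply: rdvd1_unit; exists w2; apply: (mulfI Q0).
    by rewrite mulr1 mulrA -dE -dE'.
  exists (w1 * (a t0 * b t1 - b t0 * a t1)%:MP); split.
    by rewrite unitrM w1U mpolyC_unit ?local_abJ.
  rewrite mulrA -dE !ev_restr2 // !mulmx2 /det2 !mxE /= mpolyCB !mpolyCM; ring.
pose X1 := f (ev x (C t1)).
(* Divide by [lin (C t0) ^+ m t0] and apply [f]: the term with [ev y (C t1)] disappears, as [y] is a
   multiple of [lin (C t0)]. *)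
have [w' [w'U prodE]] : exists w', w' \is a GRing.unit /\
    X1 * f v = lin g ^+ N * w'.
  have fR : f R = lin g ^+ N * \prod_(t <- rem t0 J) (e t)%:MP ^+ m t.
    rewrite /R /N rmorph_prod -prodrXr -big_split /= big_seq [RHS]big_seq.
    apply: eq_bigr => t; rewrite mem_rem_uniq // inE => /andP [tt0 tJ].
    by rewrite rmorphXn /= (f_lin t tJ tt0).2 -mul_mpolyC exprMn mulrC.
  exists (- (\prod_(t <- rem t0 J) (e t)%:MP ^+ m t * f w)); split.
    rewrite unitrN unitrM; apply/andP; split; last exact: rmorph_unit.
    rewrite big_seq; apply: rpred_prod => t; rewrite mem_rem_uniq // inE.
    by move=> /andP [tt0 tJ]; apply/unitrX/mpolyC_unit; have [] := f_lin t tJ tt0.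
  rewrite mulrN mulrA -fR -[f R * f w]rmorphM /X1.
  have : u * ev y (C t1) - ev x (C t1) * v = R * w.
    apply: (mulfI (expf_neq0 (m t0) a0)); rewrite mulrA -QE -detE uE vE; ring.
  rewrite yE evZ => <-.
  rewrite rmorphB !rmorphM /= fa0; ring.
have X10 : X1 != 0.
  apply: contraTneq (expf_neq0 N (rprime_neq0 gP)) => X0.
  by move/esym/eqP: prodE; rewrite X0 mul0r mulf_eq0 => /orP [/eqP->|/eqP w0];
    rewrite ?eqxx //; move: w'U; rewrite w0 unitr0.
have [j [jN gX1 X1g gv]] := rprime_exp_split gP w'U prodE.
have hX1 : X1 \is d.-homog.
  by apply/f_homog/rpred_sum => i _; apply: rpredZ.
have hg : lin g ^+ j \is j.-homog by have := dhomogMn j (lin_homog g); rewrite mul1n.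
have dj : d = j := homog_assoc X1g gX1 X10 hX1 hg.
rewrite -dj in jN gX1 X1g gv *; split=> // [z /Dspan [e1 [e2 zE]]|z h Dz hE].
  rewrite zE // yE evZ rmorphD !rmorphM /= fa0 mul0r mulr0 addr0.
  exact: rdvd_mull.
have [e1 [e2 zE]] := Dspan _ Dz.
(* The value of [lin (C t0) *: z] on [C t1] dies under [f], whereas [X1] is nonzero, so the
   coefficient on [x] dies. *)
have fe1 : f e1 = 0.
  have := congr1 f (zE t1 t1J); rewrite yE !evZ rmorphD !rmorphM /= fa0.
  rewrite !mul0r mulr0 addr0 => /esym/eqP; rewrite mulf_eq0 => /orP [/eqP//|].
  by rewrite -/X1 (negPf X10).
have hE' : h = e1 * u + e2 * v.
  apply: (mulfI (expf_neq0 (m t0) a0)); rewrite -hE -evZ zE // uE vE; ring.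
by rewrite hE' rmorphD !rmorphM /= fe1 mul0r add0r; apply: rdvd_mull.
Qed.

End Local.

(** * The triple in coordinates *)

Section ArrangementSaito.

Variables (K : fieldType) (k : nat) (T : eqType) (J : seq T).
Variables (C : T -> 'rV[K]_k).

Hypothesis uniqJ : uniq J.
Hypothesis C0 : forall t, t \in J -> C t != 0.
Hypothesis CJ : forall s t e, s \in J -> t \in J -> s != t -> C t != e *: C s.

Local Notation L := (fun t => lin (C t)).
Local Notation Q m := (\prod_(t <- J) lin (C t) ^+ m t).

Lemma arr_prime t : t \in J -> rprime (L t).
Proof. by move=> /C0; apply: lin_prime. Qed.

Lemma arr_ndvd s t : s \in J -> t \in J -> s != t -> ~ rdvd (L s) (L t).
Proof.
move=> sJ tJ st /(rdvd_lin (C0 sJ)) [e tE].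
by have /eqP := CJ e sJ tJ st; apply.
Qed.

Lemma arr_unit t : t \in J ->
  exists i, (\col_i (C t 0 i)%:MP : 'cV[{mpoly K[k]}]_k) i 0 \is a GRing.unit.
Proof.
by move=> /C0 /row_neq0 [i ci]; exists i; rewrite mxE mpolyC_unit.
Qed.

Lemma mxbasis_ext (D D' : 'rV[{mpoly K[k]}]_k -> Prop) r (M : 'M_(r, k)) :
  (forall x, D x <-> D' x) -> mxbasis D M -> mxbasis D' M.
Proof. by move=> DD' [DM fM]; split=> // x; rewrite -DD'. Qed.

Lemma arr_prod_neq0 m : Q m != 0.
Proof. exact: saito_prod_neq0 arr_prime. Qed.

Lemma arr_basis m (M : 'M_k) :
  (forall i, arr_mod J C m (row i M)) -> rdvd (\det M) (Q m) ->
  mxbasis (arr_mod J C m) M.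
Proof.
move=> DM dM; apply: (mxbasis_ext (fun x => iff_sym (arr_mod_log_mod J C m x))).
apply: (saito_basis uniqJ arr_prime arr_ndvd arr_unit) => // i.
exact/arr_mod_log_mod.
Qed.

Lemma arr_det m (M : 'M_k) : mxbasis (arr_mod J C m) M ->
  rdvd (Q m) (\det M) /\ rdvd (\det M) (Q m).
Proof.
move=> /(mxbasis_ext (arr_mod_log_mod J C m)).
exact: saito_det_assoc uniqJ arr_prime arr_ndvd arr_unit _.
Qed.

Lemma arr_prod_homog m : Q m \is (\sum_(t <- J) m t).-homog.
Proof.
apply: homog_bigprod => t; have := dhomogMn (m t) (lin_homog (C t)).
by rewrite mul1n.
Qed.

(** Both sides are the degree of the determinant of the basis, an associate of the product of the
    forms. *)
Lemma arr_sum_degrees m (M : 'M_k) p :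
  mxbasis (arr_mod J C m) M -> rows_homog p M ->
  (\sum_i p i = \sum_(t <- J) m t)%N.
Proof.
move=> bM hM; have [QM MQ] := arr_det bM.
apply: (homog_assoc MQ QM); last exact: arr_prod_homog.
  by apply: contraNneq (arr_prod_neq0 m) => M0; case: MQ => g ->; rewrite M0 mul0r.
exact: det_homog.
Qed.

End ArrangementSaito.

(** * Multisets of degrees *)

Section Degrees.

Definition degs k (p : 'I_k -> nat) : seq int := [seq (p i)%:Z | i <- enum 'I_k].

Lemma degs_lift k (p : 'I_k.+1 -> nat) i :
  perm_eq (degs p) ((p i)%:Z :: degs (p \o lift i)).
Proof.
have -> : (p i)%:Z :: degs (p \o lift i) =
    [seq (p j)%:Z | j <- i :: [seq lift i j | j <- enum 'I_k]].
  by rewrite /= -map_comp.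
apply: perm_map; apply: uniq_perm; rewrite ?enum_uniq //=.
  rewrite map_inj_uniq ?enum_uniq ?andbT; last exact: lift_inj.
  by apply/mapP => -[j _ /eqP]; rewrite (negPf (neq_lift _ _)).
move=> j; rewrite mem_enum !inE; case: (unliftP i j) => [s|] ->; last by rewrite eqxx.
by rewrite map_f ?orbT ?mem_enum.
Qed.

Lemma degs_perm k (p q : 'I_k -> nat) :
  (exists s : 'S_k, forall i, p i = q (s i)) -> perm_eq (degs p) (degs q).
Proof.
move=> [s pq]; rewrite /degs (eq_map (g := (fun i => (q i)%:Z) \o s)); last first.
  by move=> i /=; rewrite pq.
rewrite map_comp; apply: perm_map; apply: uniq_perm; rewrite ?enum_uniq //.
  by rewrite map_inj_uniq ?enum_uniq //; apply: perm_inj.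
move=> i; rewrite mem_enum -[i](permKV s) map_f // mem_enum //.
Qed.

Lemma degs_count k (p : 'I_k -> nat) t :
  #|[set i | p i == t]| = count_mem (t%:Z) (degs p).
Proof.
rewrite cardsE cardE /enum_mem size_filter count_map -enumT.
by apply: eq_count => i.
Qed.

Lemma degs_sum k (p : 'I_k -> nat) : \sum_(z <- degs p) z = (\sum_i p i)%N%:Z.
Proof.
by rewrite big_map big_enum /= (big_morph Posz PoszD (erefl _)).
Qed.

(** Count the occurrences of [a]: if [a] differed from [b - 1], the second hypothesis would give [d]
    one more than [r], against the first. *)
Lemma perm_exp_shift (r d : seq int) (a b : int) :
  perm_eq ((a + 1) :: r) (rcons d b) -> perm_eq (a :: r) (rcons d (b - 1)) ->
  perm_eq r d.
Proof.
rewrite perm_sym perm_rcons perm_sym [perm_eq (a :: r) _]perm_sym perm_rcons.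
rewrite [perm_eq _ (a :: r)]perm_sym => rd rd'.
suff ab : a = b - 1 by move: rd'; rewrite ab perm_cons.
apply/eqP/negP => /negP ab.
have /seq.permP/(_ (pred1 a)) := rd; have /seq.permP/(_ (pred1 a)) := rd'.
by rewrite /= eqxx eq_sym in ab *; lia.
Qed.

End Degrees.

Definition mx_exp (K : fieldType) k (D : 'rV[{mpoly K[k]}]_k -> Prop) (es : seq int) :=
  exists (M : 'M_k) p, [/\ mxbasis D M, rows_homog p M & perm_eq (degs p) es].

(** * Restriction modulo [x] and the three implications *)

Section Triple.

Variables (K : fieldType) (n : nat).
Local Notation S := {mpoly K[n.+1]}.
Local Notation S0 := {mpoly K[n]}.

(* Setting the variable of index 0 to zero; the transpose gives a section. *)
Definition restr_mx : 'M[K]_(n.+1, n) := \matrix_(i, j) (i == lift ord0 j)%:R.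

Local Notation rho := (lsub restr_mx).
Local Notation iota := (lsub restr_mx^T).

Lemma mul_restr_mx (c : 'rV[K]_n.+1) : c *m restr_mx = col' ord0 c.
Proof.
apply/rowP => j; rewrite !mxE (bigD1 (lift ord0 j)) //= mxE eqxx mulr1.
by rewrite big1 ?addr0 // => i ij; rewrite mxE (negPf ij) mulr0.
Qed.

Lemma restr_mxK : restr_mx^T *m restr_mx = 1%:M.
Proof.
apply/row_matrixP => i; rewrite row_mul mul_restr_mx row1; apply/rowP => j.
by rewrite !mxE (inj_eq lift_inj) eq_sym.
Qed.

Lemma iotaK p : rho (iota p) = p.
Proof. by rewrite lsub_comp restr_mxK lsub1. Qed.

Variable (c0 : 'rV[K]_n.+1).
Hypothesis c00 : c0 0 ord0 != 0.
Hypothesis c0S : forall j, c0 0 (lift ord0 j) = 0.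

Local Notation x := (lin c0).

Lemma x_prime : rprime x.
Proof.
by apply: lin_prime; apply: contraNneq c00 => ->; rewrite mxE.
Qed.

Lemma c0_delta : c0 = c0 0 ord0 *: delta_mx 0 ord0.
Proof.
apply/rowP => i; rewrite !mxE eqxx; case: (unliftP ord0 i) => [j|] ->.
  by rewrite c0S eq_sym (negPf (neq_lift _ _)) mulr0.
by rewrite eqxx mulr1.
Qed.

(** Restriction followed by the section is the identity modulo [x]: it moves only the variable of
    index 0, a multiple of [x]. *)
Lemma rho_ker z : rho z = 0 <-> rdvd x z.
Proof.
split=> [z0|[g ->]]; last first.
  rewrite rmorphM /= lsub_lin mul_restr_mx.
  have -> : col' ord0 c0 = 0 by apply/rowP => j; rewrite !mxE c0S.
  by rewrite raddf0 mul0r.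
have [|g gE] := @lsub_congr _ _ (restr_mx *m restr_mx^T) x z.
  move=> i; case: (unliftP ord0 i) => [j|] ->.
    have -> : row (lift ord0 j) (restr_mx *m restr_mx^T) = delta_mx 0 (lift ord0 j).
      rewrite row_mul; have -> : row (lift ord0 j) restr_mx = row j 1%:M.
        by apply/rowP => k; rewrite !mxE (inj_eq lift_inj).
      by rewrite -row_mul mul1mx; apply/rowP => k; rewrite !mxE.
    by rewrite lin_delta subrr; apply: rdvdr0.
  rewrite row_mul; have -> : row ord0 restr_mx = 0.
    by apply/rowP => k; rewrite !mxE (negPf (neq_lift _ _)).
  rewrite mul0mx raddf0 sub0r; apply: rdvdN; exists (c0 0 ord0)^-1%:MP.
  by rewrite c0_delta linearZ /= lin_delta mulrC mul_mpolyC !mxE /= scalerA mulr1 mulVf ?scale1r.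
exists (- g); rewrite mulrN -gE -lsub_comp z0 raddf0 sub0r opprK //.
Qed.

Lemma ev_c0 (th : 'rV[S]_n.+1) : ev th c0 = c0 0 ord0 *: th 0 ord0.
Proof.
by rewrite /ev big_ord_recl big1 ?addr0 // => j _; rewrite c0S scale0r.
Qed.

Definition restr_der k (th : 'M[S]_(k, n.+1)) : 'M[S0]_(k, n) :=
  map_mx rho (col' ord0 th).

(** Tangency to [x = 0] makes the component of index 0 vanish modulo [x], so dropping it does not
    change values. *)
Lemma ev_restr_der th c : rdvd x (ev th c0) ->
  ev (restr_der th) (c *m restr_mx) = rho (ev th c).
Proof.
move=> /rho_ker; rewrite ev_c0 linearZ /= => /eqP.
rewrite -mul_mpolyC mulf_eq0 => /orP [/eqP c0E|/eqP th0].
  by have := mpolyC_unit n c00; rewrite c0E unitr0.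
rewrite [in RHS]/ev raddf_sum big_ord_recl /= linearZ /= th0 scaler0 add0r.
by apply: eq_bigr => j _; rewrite linearZ /= mul_restr_mx !mxE.
Qed.

Lemma restr_der_mul k r (g : 'M[S0]_(r, k)) (th : 'M[S]_(k, n.+1)) :
  restr_der (map_mx iota g *m th) = g *m restr_der th.
Proof.
apply/matrixP => i j; rewrite !mxE rmorph_sum /=; apply: eq_bigr => s _.
by rewrite rmorphM /= !mxE iotaK.
Qed.

Lemma restr_der_row k (th : 'M[S]_(k, n.+1)) i :
  restr_der (row i th) = row i (restr_der th).
Proof. by apply/rowP => j; rewrite !mxE. Qed.

Lemma restr_der0 (th : 'rV[S]_n.+1) :
  rdvd x (ev th c0) -> restr_der th = 0 -> exists psi, th = x *: psi.
Proof.
move=> xth th0; have /fin_all_exists [g gE] : forall i, exists g, th 0 i = x * g.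
  move=> i; case: (unliftP ord0 i) => [j|] ->.
    by apply/rho_ker; have /rowP/(_ j) := th0; rewrite !mxE.
  move: xth; rewrite ev_c0 -mul_mpolyC mulrC; apply: rdvd_mulUr.
  exact: mpolyC_unit.
by exists (\row_i g i); apply/rowP => i; rewrite gE !mxE.
Qed.

Lemma restr_der_homog k p (th : 'M[S]_(k, n.+1)) :
  rows_homog p th -> rows_homog p (restr_der th).
Proof. by move=> hth i j; rewrite !mxE; apply: lsub_homog. Qed.

Variables (T : eqType) (J : seq T) (C : T -> 'rV[K]_n.+1) (m m' : T -> nat).
Variable (H0 : T).
Hypothesis uniqJ : uniq J.
Hypothesis C0 : forall t, t \in J -> C t != 0.
Hypothesis CJ : forall s t e, s \in J -> t \in J -> s != t -> C t != e *: C s.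
Hypothesis H0J : H0 \in J.
Hypothesis CH0 : C H0 = c0.
Hypothesis mH0 : m H0 = (m' H0).+1.
Hypothesis mm' : forall t, t != H0 -> m t = m' t.

Variables (T2 : eqType) (J2 : seq T2) (C2 : T2 -> 'rV[K]_n) (m2 : T2 -> nat).
Hypothesis uniqJ2 : uniq J2.
Hypothesis C20 : forall t, t \in J2 -> C2 t != 0.
Hypothesis C2J : forall s t e, s \in J2 -> t \in J2 -> s != t -> C2 t != e *: C2 s.

Variables (tr : T -> T2) (e : T -> K).
Hypothesis tr_mem : forall t, t \in rem H0 J -> tr t \in J2.
Hypothesis tr_surj : forall X, X \in J2 -> exists2 t, t \in rem H0 J & tr t = X.
Hypothesis tr_lin : forall t, t \in rem H0 J ->
  e t != 0 /\ C t *m restr_mx = e t *: C2 (tr t).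

Local Notation D := (arr_mod J C m).
Local Notation D' := (arr_mod J C m').
Local Notation D2 := (arr_mod J2 C2 m2).
Let N X := (\sum_(t <- rem H0 J | tr t == X) m t)%N.

(* The only properties of the Euler multiplicities that are needed. *)
Hypothesis m2N : forall X, X \in J2 -> (m2 X <= N X)%N.
Hypothesis D_restr : forall th t, D th -> t \in rem H0 J ->
  rdvd (lin (C2 (tr t)) ^+ m2 (tr t)) (rho (ev th (C t))).
Hypothesis D'_restr : forall th h X, D' th -> X \in J2 ->
  ev th c0 = x ^+ m' H0 * h -> rdvd (lin (C2 X) ^+ (N X - m2 X)) (rho h).

Local Notation Q := (\prod_(t <- J) lin (C t) ^+ m t).
Local Notation Q' := (\prod_(t <- J) lin (C t) ^+ m' t).
Local Notation Q2 := (\prod_(X <- J2) lin (C2 X) ^+ m2 X).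
Let R := \prod_(t <- rem H0 J) lin (C t) ^+ m t.
Let B := \prod_(X <- J2) lin (C2 X) ^+ (N X - m2 X).

Lemma triple_rem t : t \in rem H0 J -> t != H0 /\ t \in J.
Proof. by rewrite mem_rem_uniq // inE => /andP. Qed.

Lemma triple_Q' : Q' = x ^+ m' H0 * R.
Proof.
rewrite (big_rem H0) //= CH0; congr (_ * _).
rewrite /R [LHS]big_seq [RHS]big_seq.
by apply: eq_bigr => t /triple_rem [tH _]; rewrite mm'.
Qed.

Lemma triple_Q : Q = x * Q'.
Proof. by rewrite triple_Q' (big_rem H0) //= CH0 mH0 exprS mulrA. Qed.

Lemma triple_partition (M : Type) (idx : M) (op : Monoid.com_law idx) (F : T -> M) :
  \big[op/idx]_(t <- rem H0 J) F t =
  \big[op/idx]_(X <- J2) \big[op/idx]_(t <- rem H0 J | tr t == X) F t.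
Proof.
rewrite (exchange_big_dep predT) //= big_seq [RHS]big_seq.
apply: eq_bigr => t tJ.
rewrite (eq_bigl (pred1 (tr t))) => [|X]; last by rewrite /= eq_sym.
by rewrite -big_filter filter_pred1_uniq ?tr_mem // big_seq1.
Qed.

(** Group the factors of [R] by trace: the multiplicities over [X] add up to [N X], which is shared
    between [B] and the product for [m2]. *)
Lemma triple_R : rdvd (rho R) (B * Q2).
Proof.
have -> : B * Q2 = \prod_(t <- rem H0 J) lin (C2 (tr t)) ^+ m t.
  rewrite triple_partition -big_split /= big_seq [RHS]big_seq.
  apply: eq_bigr => X XJ; rewrite -exprD subnK ?m2N // /N -prodrXr.
  by apply: eq_bigr => t /eqP ->.
rewrite /R rmorph_prod /= big_seq [X in rdvd _ X]big_seq.
elim/big_ind2: _ => [|a b a' b'|t tJ]; [exact: rdvd_refl | exact: rdvd_mul |].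
have [et0 Ct] := tr_lin tJ.
rewrite rmorphXn /= lsub_lin Ct linearZ /= -mul_mpolyC exprMn.
exists ((e t)^-1%:MP ^+ m t).
by rewrite mulrC mulrA -exprMn -mpolyCM mulVf // mpolyC1 expr1n mul1r.
Qed.

Lemma triple_degree : (\sum_(X <- J2) (N X - m2 X) + \sum_(X <- J2) m2 X =
  \sum_(t <- rem H0 J) m t)%N.
Proof.
rewrite triple_partition -big_split /= big_seq [RHS]big_seq.
by apply: eq_bigr => X XJ; rewrite subnK ?m2N.
Qed.

Lemma triple_B_neq0 : B != 0.
Proof. exact: (arr_prod_neq0 C20 (fun X => N X - m2 X)%N). Qed.

Lemma triple_x_ndvd t : t \in J -> t != H0 -> ~ rdvd (lin (C t)) x.
Proof. by move=> tJ tH; rewrite -CH0; apply: (arr_ndvd C0 CJ). Qed.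

Lemma D_D' th : D th <-> D' th /\ rdvd (x ^+ (m' H0).+1) (ev th c0).
Proof.
split=> [Dth|[D'th xth] t tJ].
  split=> [t tJ|]; last by rewrite -mH0 -CH0; apply: Dth.
  have [->|tH] := eqVneq t H0; last by rewrite -mm' //; apply: Dth.
  by apply: rdvd_trans (Dth _ H0J); apply: rdvd_exp2l; rewrite mH0.
have [->|tH] := eqVneq t H0; first by rewrite CH0 mH0.
by rewrite mm' //; apply: D'th.
Qed.

Lemma D_x th : D th -> rdvd x (ev th c0).
Proof.
move=> /D_D' [_]; apply: rdvd_trans.
by rewrite exprS; apply/rdvd_mulr/rdvd_refl.
Qed.

(** The other forms are prime to [x], so a factor [x] matters only at [H0], where the multiplicities
    differ by one. With [restr_der0] this gives exactness of the restriction sequence in the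
    middle. *)
Lemma D_mulx th : D' th <-> D (x *: th).
Proof.
split=> [D'th t tJ|Dxth t tJ].
  rewrite evZ; have [->|tH] := eqVneq t H0; last first.
    by rewrite mm' //; apply/rdvd_mull/D'th.
  by rewrite mH0 exprS CH0; apply: rdvd_mul;
    [exact: rdvd_refl | rewrite -CH0; apply: D'th].
have := Dxth t tJ; rewrite evZ; have [->|tH] := eqVneq t H0.
  rewrite mH0 exprS CH0; apply: rdvd_cancel; exact: rprime_neq0 x_prime.
rewrite mm' //; apply: rprime_exp_coprime; first exact: (arr_prime C0).
exact: triple_x_ndvd.
Qed.

Lemma arr_mod_comb (T' : eqType) (J' : seq T') k (C' : T' -> 'rV[K]_k) m'' r
    (a : 'rV_r) (M : 'M_(r, k)) :
  (forall i, a 0 i = 0 \/ arr_mod J' C' m'' (row i M)) ->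
  arr_mod J' C' m'' (a *m M).
Proof.
move=> DM t tJ; rewrite evE -mulmxA mxE; apply: rdvd_sum => i _.
have [->|/(_ t tJ)] := DM i; first by rewrite mul0r; apply: rdvdr0.
by rewrite evE -row_mul mxE => h; apply: rdvd_mull.
Qed.

Lemma D2_restr th : D th -> D2 (restr_der th).
Proof.
move=> Dth X /tr_surj [t tJ <-]; have [et0 Ct] := tr_lin tJ.
have := D_restr Dth tJ; rewrite -ev_restr_der ?Ct; last exact: D_x.
have -> : ev (restr_der th) (e t *: C2 (tr t)) = ev (restr_der th) (C2 (tr t)) * (e t)%:MP.
  have := ev_lin (restr_der th) (e t) 0 (C2 (tr t)) 0.
  by rewrite !scale0r !addr0 => ->; rewrite mulrC mul_mpolyC.
by apply: rdvd_mulUr; apply: mpolyC_unit.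
Qed.

(** The bounds at the individual [X] combine because the forms of distinct [X] are non-associated
    primes. *)
Lemma triple_quotient th : D' th -> exists h,
  ev th c0 = x ^+ m' H0 * h /\ rdvd B (rho h).
Proof.
move=> D'th; have [h hE] := D'th _ H0J; rewrite CH0 in hE; exists h; split=> //.
apply: (rdvd_prime_prod (m := fun X => N X - m2 X)%N) => // [X XJ|X Y XJ YJ XY|X XJ].
- exact: (arr_prime C20).
- exact: (arr_ndvd C20 C2J).
exact: D'_restr hE.
Qed.

(* Modulo [x], expanding the determinant of [setrow i psi Th] along its column of
   index 0 leaves the product of [psi(x) / x ^ m' H0], a multiple of [B], with the
   determinant of the restricted basis, which therefore divides [Q2]. *)
Lemma triple_core (Th : 'M[S]_n.+1) (g : 'rV_n.+1) i psi :
  mxbasis D Th -> g *m Th = x *: psi -> g 0 i \is a GRing.unit ->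
  mxbasis D' (setrow i psi Th) /\ mxbasis D2 (row' i (restr_der Th)).
Proof.
move=> bD gTh gU; have [xn0 _ _] := x_prime.
have DTh j : D (row j Th) by apply: mxbasis_row bD.
have D'psi : D' psi.
  by apply/D_mulx; rewrite -gTh; apply: arr_mod_comb => j; right.
have [_ detQ] := arr_det uniqJ C0 CJ bD.
have D'M : forall j, D' (row j (setrow i psi Th)).
  by move=> j; rewrite row_setrow; case: eqP => // _; have /D_D' [] := DTh j.
(* Cramer's rule: [x] times this determinant is [\det Th] times the unit [g 0 i]. *)
have detQ' : rdvd (\det (setrow i psi Th)) Q'.
  apply: (rdvd_cancel xn0); rewrite -triple_Q -det_setrowZ -gTh det_setrow_mul.
  by rewrite -[Q]mul1r; apply: rdvd_mul => //; apply: rdvd_unit.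
have bD' : mxbasis D' (setrow i psi Th) by apply: (arr_basis uniqJ C0 CJ).
split=> //; apply: (arr_basis uniqJ2 C20 C2J) => [j|].
  have -> : row j (row' i (restr_der Th)) = restr_der (row (lift i j) Th).
    by apply/rowP => s; rewrite !mxE.
  exact: D2_restr.
have [h [psi_h [b hB]]] := triple_quotient D'psi.
pose M := setrow i psi Th.
(* The rows other than [i] lie in [D], so their entries of index 0 carry one factor [x] beyond
   [x ^+ m' H0]. *)
have /fin_all_exists [u uE] : forall j, exists u, j != i ->
    ev (row j Th) c0 = x ^+ (m' H0).+1 * u.
  by move=> j; have /D_D' [_ [u uE]] := DTh j; exists u.
have [w wE] := detQ'.
have [cof cofE] : exists c, c = cofactor M i ord0 by exists (cofactor M i ord0).
have detM : c0 0 ord0 *: \det M =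
    x ^+ m' H0 * (h * cof + x * \sum_(j | j != i) u j * cofactor M j ord0).
  rewrite (expand_det_col _ ord0) (bigD1 i) //= -cofE scalerDr mulrDr; congr (_ + _).
    rewrite scalerAl mulrA -psi_h ev_c0; congr (_ *: _ * _).
    by rewrite !mxE eqxx.
  rewrite scaler_sumr !mulr_sumr; apply: eq_bigr => j ji.
  move: (cofactor M j ord0) => cf.
  rewrite scalerAl !mulrA -exprSr -uE // ev_c0; congr (_ *: _ * _).
  by rewrite !mxE (negPf ji) mxE.
have Rw : (h * cof + x * \sum_(j | j != i) u j * cofactor M j ord0) * w =
    (c0 0 ord0)%:MP * R.
  apply: (mulfI (expf_neq0 (m' H0) xn0)).
  by rewrite mulrA -detM -mul_mpolyC -mulrA -wE triple_Q' mulrCA.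
have := congr1 rho Rw; rewrite rmorphM rmorphD !rmorphM /= hB.
have -> : rho x = 0 by apply/rho_ker/rdvd_refl.
rewrite mul0r addr0 lsubC => rhoRw.
have [R' RE] := triple_R.
(* [rho h] is a multiple of [B]; cancelling [B] leaves the cofactor modulo [x], the restricted
   determinant up to sign, as a divisor of the product for [m2]. *)
apply: (rdvd_cancel triple_B_neq0); rewrite RE -[R' in rdvd _ (_ * R')]mul1r.
have cU : (c0 0 ord0)%:MP \is a @GRing.unit S0 by apply: mpolyC_unit.
apply: (rdvd_mulUr cU); rewrite mul1r [_ * R' * _]mulrC mulrA -rhoRw.
apply: rdvd_mulr; apply: rdvd_mulr; rewrite -mulrA; apply: rdvd_mul.
  exact: rdvd_refl.
apply: rdvd_mull; rewrite cofE cofactor_setrow /cofactor rmorphM /=.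
apply: rdvd_mull; rewrite -det_map_mx.
suff -> : map_mx rho (row' i (col' ord0 Th)) = row' i (restr_der Th).
  exact: rdvd_refl.
by apply/matrixP => a a'; rewrite !mxE.
Qed.

(* If [p] is not a permutation of [p'], the transition matrix provides the unit
   coefficient required by [triple_core]. *)
Lemma triple_restriction_exp (d : seq int) (dl : int) :
  mx_exp D (rcons d dl) -> mx_exp D' (rcons d (dl - 1)) -> mx_exp D2 d.
Proof.
move=> [Th [p [bTh hTh pd]]] [Th' [p' [bTh' hTh' p'd]]].
have cn0 : c0 != 0 by apply: contraNneq c00 => ->; rewrite mxE.
have [||/degs_perm pp'|[g [i [j [gTh gU pij]]]]] :=
  homog_basis_unit_coef hTh hTh' bTh bTh' _ _ cn0.
- by move=> th /D_D' [].
- by move=> th /D_mulx.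
(* Equal degrees would force [dl = dl - 1]. *)
- have : perm_eq (dl :: d) ((dl - 1) :: d).
    rewrite -perm_rcons perm_sym -perm_rcons perm_sym.
    by rewrite -(permPl pd) (permPl pp').
  by move=> /seq.permP/(_ (pred1 dl)); rewrite /= eqxx; lia.
have [bM b2] := triple_core bTh (esym gTh) gU.
(* Exchanging row [i] for row [j] of [Th'] lowers one degree by one; comparison with the degrees of
   [Th'] shows that the other ones form [d]. *)
pose p1 k := if k == i then p' j else p k.
have hM : rows_homog p1 (setrow i (row j Th') Th).
  by move=> k s; rewrite mxE /p1; case: eqP => _; rewrite mxE.
have /degs_perm p1p' := homog_basis_degrees hM hTh' bM bTh'.
exists (row' i (restr_der Th)), (p \o lift i); split=> //.
  by move=> k s; rewrite mxE; apply: restr_der_homog.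
apply: (@perm_exp_shift _ _ (p' j) dl).
  by rewrite -(permPr pd) perm_sym (permPl (degs_lift p i)) pij intS addrC.
rewrite -(permPr p'd) -(permPr p1p') perm_sym (permPl (degs_lift p1 i)).
rewrite /p1 eqxx perm_cons; apply/seq.permP => P; rewrite !count_map.
by apply: eq_count => k /=; rewrite eq_sym (negPf (neq_lift _ _)).
Qed.

(** The lift lies in [D] and restricts to zero, so it is a multiple of [x]. Rows with coefficient
    zero are exempt because the addition argument knows only rows of small degree to be in [D]. *)
Lemma lift_relation k (M : 'M[S]_(k, n.+1)) (g : 'rV[S0]_k) :
  (forall i, g 0 i = 0 \/ D (row i M)) -> g *m restr_der M = 0 ->
  exists psi, map_mx iota g *m M = x *: psi /\ D' psi.
Proof.
move=> DM gM; have Dy : D (map_mx iota g *m M).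
  apply: arr_mod_comb => i; have [gi|] := DM i; [left | by right].
  by rewrite mxE gi raddf0.
have [|psi yE] := restr_der0 (D_x Dy); first by rewrite restr_der_mul.
by exists psi; split=> //; apply/D_mulx; rewrite -yE.
Qed.

(** [D] has one generator more than [D2] in degree [dl] and equally many in every other degree,
    which forces a relation with a unit coefficient between the restrictions; its lift divided by
    [x] is the new member. *)
Lemma triple_deletion_exp (d : seq int) (dl : int) :
  mx_exp D (rcons d dl) -> mx_exp D2 d -> mx_exp D' (rcons d (dl - 1)).
Proof.
move=> [Th [p [bTh hTh pd]]] [F [q [bF hF qd]]].
have [i0 dlE] : exists i, dl = (p i)%:Z.
  have : dl \in degs p by rewrite (perm_mem pd) mem_rcons mem_head.
  by move=> /mapP [i _ ->]; exists i.
have DTh i : D (row i Th) by apply: mxbasis_row bTh.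
have counts t : #|[set i | p i == t]| = (#|[set j | q j == t]| + (p i0 == t))%N.
  rewrite !degs_count (seq.permP pd) (seq.permP qd) -cats1 count_cat /= addn0 dlE.
  by congr (_ + _)%N.
have [|t _||t [g [tp gX hg [i pit gU]]]] :=
  homog_relation (t0 := p i0) (restr_der_homog hTh) hF.
- by move=> i _; apply: (bF.1 _).1; rewrite -restr_der_row; apply/D2_restr/DTh.
- by rewrite counts leq_addr.
- by rewrite counts eqxx addn1.
have [|psi [yE D'psi]] := lift_relation _ gX; first by move=> k; right.
have iU : map_mx iota g 0 i \is a GRing.unit by rewrite mxE; apply: rmorph_unit.
have [bM b2] := triple_core bTh yE iU.
(* [F] and the remaining restricted rows are both bases of [D2], so their degree sums agree and the
   dropped degree is [dl]. *)
have pidl : (p i)%:Z = dl.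
  have := arr_sum_degrees uniqJ2 C20 C2J bF hF.
  have hb2 : rows_homog (p \o lift i) (row' i (restr_der Th)).
    by move=> k s; rewrite mxE; apply: restr_der_homog.
  have := arr_sum_degrees uniqJ2 C20 C2J b2 hb2.
  move=> <- /(congr1 Posz); rewrite -!degs_sum (perm_big _ qd) /= => sumE.
  have := perm_big _ pd (op := +%R) (x := 0) (P := xpredT) (F := id).
  rewrite /= (perm_big _ (degs_lift p i)) /= big_cons -sumE -cats1 big_cat /=.
  by rewrite big_seq1 addrC => /addrI.
have x_homog j : (psi 0 j == 0) || (0 < t)%N && (psi 0 j \is (t - 1).-homog).
  have [//|psij] := eqVneq (psi 0 j) 0; have [xn0 _ _] := x_prime.
  have [||t0 ht] := @homog_divl _ _ t 1 (psi 0 j) x (lin_homog c0); last by rewrite t0.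
    rewrite mulrC; have -> : x * psi 0 j = (map_mx iota g *m Th) 0 j by rewrite yE mxE.
    rewrite mxE; apply: rpred_sum => k _; rewrite mxE.
    have := hg k; rewrite /coef_homog; case: leqP => [pt hgk|_ /eqP ->].
      by rewrite -(subnK pt); apply: dhomogM (hTh k j); apply: lsub_homog.
    by rewrite raddf0 mul0r rpred0.
  by rewrite mulf_neq0.
(* Were [t] zero, [psi] would vanish, although it is a row of a basis. *)
have t_gt0 : (0 < t)%N.
  case: t tp hg pit x_homog {gX gU} => // _ _ _ psi0; case: bM => _ /(_ (delta_mx 0 i)).
  rewrite -rowE row_setrow eqxx => psi_free; have /rowP/(_ i)/eqP : delta_mx 0 i = 0 :> 'rV[S]_n.+1.
    by apply: psi_free; apply/rowP => j; have := psi0 j; rewrite orbF mxE => /eqP.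
  by rewrite !mxE !eqxx oner_eq0.
pose p1 k := if k == i then t.-1 else p k.
exists (setrow i psi Th), p1; split=> //.
  move=> k j; rewrite mxE /p1; case: eqP => _; last by rewrite mxE.
  by have /orP [/eqP ->|/andP [_]] := x_homog j; rewrite ?dhomog0 // subn1.
rewrite (permPl (degs_lift p1 i)) perm_sym perm_rcons.
have -> : (p1 i)%:Z = dl - 1 by rewrite /p1 eqxx -pidl pit -subn1 -subzn.
rewrite perm_cons; have : perm_eq (dl :: d) ((p i)%:Z :: degs (p \o lift i)).
  by rewrite -perm_rcons perm_sym -(permPr pd) perm_sym degs_lift.
rewrite pidl perm_cons => /permPl ->; apply/seq.permP => P; rewrite !count_map.
by apply: eq_count => k /=; rewrite /p1 eq_sym (negPf (neq_lift _ _)).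
Qed.

Lemma triple_addition_exp (d : seq int) (dl : int) :
  mx_exp D' (rcons d (dl - 1)) -> mx_exp D2 d -> mx_exp D (rcons d dl).
Proof.
move=> [Th [p [bTh hTh pd]]] [F [q [bF hF qd]]]; have [xn0 x1 _] := x_prime.
have [i0 dlE] : exists i, dl - 1 = (p i)%:Z.
  have : dl - 1 \in degs p by rewrite (perm_mem pd) mem_rcons mem_head.
  by move=> /mapP [i _ ->]; exists i.
have counts t : #|[set i | p i == t]| = (#|[set j | q j == t]| + (p i0 == t))%N.
  rewrite !degs_count (seq.permP pd) (seq.permP qd) -cats1 count_cat /= addn0 dlE.
  by congr (_ + _)%N.
have DTh i : D' (row i Th) by apply: mxbasis_row bTh.
have /fin_all_exists2 [h hE hB] : forall i, exists2 h,
    ev (row i Th) c0 = x ^+ m' H0 * h & rdvd B (rho h).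
  by move=> i; have [h [hE hB]] := triple_quotient (DTh i); exists h.
have DTh0 i : rho (h i) = 0 -> D (row i Th).
  move=> /rho_ker [u hu]; apply/D_D'; split=> //.
  by rewrite hE hu mulrA -exprSr; apply/rdvd_mulr/rdvd_refl.
have h_homog i : rho (h i) != 0 -> (m' H0 <= p i)%N /\ rho (h i) \is (p i - m' H0).-homog.
  move=> h0; have hx : x ^+ m' H0 \is (m' H0).-homog.
    by have := dhomogMn (m' H0) (lin_homog c0); rewrite mul1n.
  have [||mp hh] := homog_divl (p := h i) (d := p i) hx.
  - by rewrite mulrC -hE ev_c0; apply: rpredZ; rewrite mxE; apply: hTh.
  - apply: mulf_neq0; last exact: expf_neq0.
    by apply: contraNneq h0 => ->; rewrite raddf0.
  by split=> //; apply: lsub_homog.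
pose dB := (\sum_(X <- J2) (N X - m2 X))%N.
have hBd : B \is dB.-homog.
  apply: homog_bigprod => X; have := dhomogMn (N X - m2 X) (lin_homog (C2 X)).
  by rewrite mul1n.
(* Comparing degree sums of [D'] and [D2], the extra exponent [dl - 1] is the degree of
   [x ^+ m' H0 * B]. *)
have dBE : (p i0 = m' H0 + dB)%N.
  have := arr_sum_degrees uniqJ C0 CJ bTh hTh; rewrite (big_rem H0) //=.
  have -> : (\sum_(t <- rem H0 J) m' t = \sum_(t <- rem H0 J) m t)%N.
    rewrite big_seq [RHS]big_seq; apply: eq_bigr => t /triple_rem [tH _].
    by rewrite mm'.
  rewrite -triple_degree -(arr_sum_degrees uniqJ2 C20 C2J bF hF) -/dB => sumE.
  have := perm_big _ pd (op := +%R) (x := 0) (P := xpredT) (F := id).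
  rewrite degs_sum sumE -cats1 big_cat big_seq1 /= -(perm_big _ qd) /= degs_sum dlE.
  by rewrite -PoszD addnA [(m' H0 + dB + _)%N]addnC => -[] /addnI.
(* Otherwise all rows of degree at most [p i0] lie in [D], and the count gives a relation between
   restrictions. Its lift is [x] times a combination of the basis, so [x] divides a unit
   coefficient. *)
have [k /andP [kp hk]] : exists k, (p k <= p i0)%N && (rho (h k) != 0).
  apply/existsP; apply: contraT; rewrite negb_exists => /forallP noh; exfalso.
  have Dlow i : (p i <= p i0)%N -> D (row i Th).
    by move=> pi; apply: DTh0; have := noh i; rewrite pi negbK => /eqP.
  have [|t _||t [g [tp gX hg [i pit gU]]]] :=
    homog_relation (t0 := p i0) (restr_der_homog hTh) hF.
  - by move=> i pi; apply: (bF.1 _).1; rewrite -restr_der_row; apply/D2_restr/Dlow.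
  - by rewrite counts leq_addr.
  - by rewrite counts eqxx addn1.
  have [|psi [yE D'psi]] := lift_relation _ gX.
    move=> s; have [pt|tps] := leqP (p s) t; first by right; apply/Dlow/(leq_trans pt).
    by left; apply: coef_homog_gt (hg s).
  have [a psiE] := (bTh.1 psi).1 D'psi.
  have gxa : map_mx iota g = x *: a.
    apply/eqP; rewrite -subr_eq0; apply/eqP; apply: bTh.2.
    by rewrite mulmxBl yE psiE scalemxAl subrr.
  apply: x1; apply: (@rdvd_trans _ (iota (g 0 i))).
    by have /rowP/(_ i) := gxa; rewrite !mxE => ->; apply/rdvd_mulr/rdvd_refl.
  by apply: rdvd_unit; apply: rmorph_unit.
have [mk hhk] := h_homog k hk.
(* [rho (h k)] is a nonzero multiple of [B], which bounds [p k] below by [p i0]; the degrees being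
   equal, the quotient [bk] is a nonzero scalar. *)
have pkE : p k = p i0.
  apply/eqP; rewrite eqn_leq kp dBE -leq_subRL //.
  exact: homog_rdvd (hB k) hk hBd hhk.
have [bk bkE] := hB k.
have bk0 : bk != 0 by apply: contraNneq hk => b0; rewrite bkE b0 mulr0.
have [_ hbk] : (dB <= p k - m' H0)%N /\ bk \is (p k - m' H0 - dB).-homog.
  by apply: (homog_divl hBd); rewrite mulrC -bkE.
have bkU : bk \is a GRing.unit.
  apply: homog0_unit => //; move: hbk; suff -> : (p k - m' H0 - dB = 0)%N by [].
  by rewrite pkE dBE addKn subnn.
(* [s i] lifts the quotient of [rho (h i)] by [rho (h k)]: both are multiples of [B], the second one
   by a unit. *)
have /fin_all_exists2 [s sE hs] : forall i, exists2 s : S,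
    rho (h i - s * h k) = 0 & (s == 0) || (p k <= p i)%N && (s \is (p i - p k).-homog).
  move=> i; have [hi|hi] := eqVneq (rho (h i)) 0.
    by exists 0; rewrite ?mul0r ?subr0 ?eqxx.
  have [b bE] := hB i; have [mi hhi] := h_homog i hi.
  exists (iota (b * bk^-1)).
    by rewrite rmorphB rmorphM /= iotaK bE bkE mulrCA -[b / bk * _]mulrA mulVr // mulr1 subrr.
  have [dBi hb] : (dB <= p i - m' H0)%N /\ b \is (p i - m' H0 - dB).-homog.
    by apply: (homog_divl hBd); rewrite mulrC -bE.
  apply/orP; right; apply/andP; split; first by rewrite pkE dBE -leq_subRL.
  have bkC : bk^-1 \is 0.-homog.
    have bkc : bk = (bk@_0%MM)%:MP.
      apply: homog0_const; move: hbk; suff -> : (p k - m' H0 - dB = 0)%N by [].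
      by rewrite pkE dBE addKn subnn.
    have : bk^-1 = (bk@_0%MM)^-1%:MP.
      apply: (mulrI bkU); rewrite divrr // {1}bkc -mpolyCM divff ?mpolyC1 //.
      by apply: contraNneq bk0 => b0; rewrite bkc b0 mpolyC0.
    by move=> ->; apply: homogC.
  apply: lsub_homog; have := dhomogM hb bkC; rewrite addn0.
  by rewrite pkE dBE subnDA.
(* Row [k] is multiplied by [x], and [s i] times row [k] is subtracted from each other row [i]. *)
pose E : 'M[S]_n.+1 := \matrix_(i, j)
  (if j == k then if i == k then x else - s i else (i == j)%:R).
have row_ETh i : row i (E *m Th) = if i == k then x *: row k Th
    else row i Th - s i *: row k Th.
  rewrite row_mul mulmx_sum_row (bigD1 k) //= !mxE eqxx; have [->|ik] := eqVneq i k.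
    rewrite big1 ?addr0 // => j jk.
    by rewrite !mxE (negPf jk) eq_sym (negPf jk) scale0r.
  rewrite addrC (bigD1 i) //= !mxE (negPf ik) eqxx scale1r scaleNr big1 ?addr0 //.
  by move=> j /andP [jk ji]; rewrite !mxE (negPf jk) eq_sym (negPf ji) scale0r.
have detE : \det E = x.
  rewrite (@det_col_identity _ _ k) => [|i j jk]; first by rewrite mxE !eqxx.
  by rewrite mxE (negPf jk).
pose p1 i := if i == k then (p k).+1 else p i.
exists (E *m Th), p1; split.
- apply: (arr_basis uniqJ C0 CJ) => [i|]; last first.
    rewrite det_mulmx detE triple_Q; apply: rdvd_mul; first exact: rdvd_refl.
    by have [] := arr_det uniqJ C0 CJ bTh.
  rewrite row_ETh; have [_|ik] := eqVneq i k; first by apply/D_mulx.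
  apply/D_D'; split.
    have -> : row i Th - s i *: row k Th = (delta_mx 0 i - s i *: delta_mx 0 k) *m Th.
      by rewrite mulmxBl -scalemxAl -!rowE.
    by apply: arr_mod_comb => j; right.
  rewrite -scaleNr evD evZ !hE mulNr mulrCA -mulrBr.
  have /rho_ker [u ->] := sE i.
  by rewrite mulrA -exprSr; apply/rdvd_mulr/rdvd_refl.
- move=> i j; have -> : (E *m Th) i j = row i (E *m Th) 0 j by rewrite [RHS]mxE.
  rewrite row_ETh /p1; case: eqP => _.
    by rewrite !mxE -[(p k).+1]add1n; apply: dhomogM (lin_homog c0) _; apply: hTh.
  rewrite !mxE; apply: rpredB => //.
  have /orP [/eqP ->|/andP [ki hsi]] := hs i; first by rewrite mul0r rpred0.
  by rewrite -(subnK ki); apply: dhomogM.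
rewrite (permPl (degs_lift p1 k)) perm_sym perm_rcons.
have -> : (p1 k)%:Z = dl by rewrite /p1 eqxx pkE intS -dlE addrC subrK.
rewrite perm_cons; have : perm_eq ((dl - 1) :: d) ((p k)%:Z :: degs (p \o lift k)).
  by rewrite -perm_rcons perm_sym -(permPr pd) perm_sym degs_lift.
rewrite pkE -dlE perm_cons => /permPl ->; apply/seq.permP => P; rewrite !count_map.
by apply: eq_count => j /=; rewrite /p1 eq_sym (negPf (neq_lift _ _)).
Qed.

End Triple.

(** * Linear forms and changes of coordinates *)

Section Forms.

Variables (K : fieldType) (V : vectType K).
Implicit Types (a b : 'Hom(V, K^o)) (u v : V) (H : {vspace V}).

(** The form is the coordinate along a vector [v] that completes a basis of [H]. *)
Lemma lker_form_exists H : (\dim H).+1 = \dim {:V} ->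
  exists a : 'Hom(V, K^o), lker a = H.
Proof.
move=> dH; have [v _ vH] : exists2 v, v \in {:V}%VS & v \notin H.
  by apply/subvPn/negP => /dimvS; rewrite -dH ltnn.
pose X := [tuple of v :: vbasis H].
have fX : free X.
  by rewrite free_cons (span_basis (vbasisP H)) vH (basis_free (vbasisP H)).
pose a : 'Hom(V, K^o) := linfun (coord X ord0 : V -> K^o).
exists a; have aH u : u \in H -> a u = 0.
  move=> /(coord_basis (vbasisP H)) ->; rewrite linear_sum big1 //= => i _.
  rewrite linearZ /= lfunE /= -[(vbasis H)`_i]/(X`_(lift ord0 i)) coord_free //.
  by rewrite eq_sym (negPf (neq_lift _ _)) scaler0.
have av : a v = 1 by rewrite lfunE /= -[v]/(X`_(@ord0 (\dim H))) coord_free.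
apply/eqP; rewrite eq_sym eqEdim; apply/andP; split.
  by apply/subvP => u /aH au; rewrite memv_ker au.
have := limg_ker_dim a {:V}; rewrite capfv -dH => dimE.
suff : (0 < \dim (a @: {:V}))%N by lia.
rewrite lt0n dimv_eq0; apply/eqP => a0.
have := memv_img a (memvf v); rewrite a0 memv0 av oner_eq0 //.
Qed.

Lemma alpha_ker_form a H : lker a = H -> lker (alpha H) = H.
Proof.
by move=> aH; apply: (epsilon_spec (inhabits _) (fun a => lker a = H)); exists a.
Qed.

Lemma form_prop a b : (lker a <= lker b)%VS -> a != 0 -> exists e : K, b = e *: a.
Proof.
move=> /subvP ab /lfunPn [u]; rewrite lfunE /= => au0.
exists (b u / a u : K); apply/lfunP => v; rewrite lfunE /=.
have /ab : v - ((a v : K) / a u) *: u \in lker a.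
  rewrite memv_ker linearB linearZ /= subr_eq0 /GRing.scale /=.
  by rewrite divfK.
rewrite memv_ker linearB linearZ /= subr_eq0 => /eqP ->.
by rewrite /GRing.scale /= mulrAC [RHS]mulrAC [X in X / _]mulrC.
Qed.

Lemma form_prop_ker a b (e : K) : b = e *: a -> b != 0 -> lker b = lker a.
Proof.
move=> bE b0; have e0 : e != 0 by apply: contraNneq b0 => e0; rewrite bE e0 scale0r.
apply/vspaceP => v; rewrite !memv_ker bE lfunE /= /GRing.scale /= mulf_eq0.
by rewrite (negPf e0).
Qed.

Definition coef l (e : l.-tuple V) a : 'rV[K]_l := \row_i a (tnth e i).

Lemma form_mpoly_lin l (e : l.-tuple V) a : form_mpoly e a = lin (coef e a).
Proof. by apply: eq_bigr => i _; rewrite mxE. Qed.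

Lemma form_coefZ l (e : l.-tuple V) (k : K) a : coef e (k *: a) = k *: coef e a.
Proof. by apply/rowP => i; rewrite !mxE lfunE. Qed.

(** Transition matrix in the convention of [coef_cmx]: coefficient rows of forms are multiplied on
    the right. *)
Definition cmx l k (e : l.-tuple V) (w : k.-tuple V) : 'M[K]_(l, k) :=
  \matrix_(i, j) coord e i (tnth w j).

Section Basis.

Variables (l : nat) (e : l.-tuple V).
Hypothesis he : basis_of {:V} e.

Lemma coef_cmx k (w : k.-tuple V) a : coef w a = coef e a *m cmx e w.
Proof.
apply/rowP => j; rewrite !mxE {1}(coord_basis he (memvf (tnth w j))) linear_sum /=.
apply: eq_bigr => i _; rewrite linearZ /= !mxE !(tnth_nth 0) /GRing.scale /=.
by rewrite mulrC.
Qed.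

Lemma cmx_comp k r (w : k.-tuple V) (z : r.-tuple V) :
  basis_of {:V} w -> cmx e w *m cmx w z = cmx e z.
Proof.
move=> hw; apply/matrixP => i j; rewrite !mxE.
rewrite [X in coord e i X](coord_basis hw (memvf (tnth z j))) linear_sum /=.
by apply: eq_bigr => s _; rewrite linearZ /= !mxE !(tnth_nth 0) mulrC.
Qed.

Lemma cmx_id : cmx e e = 1%:M.
Proof.
by apply/matrixP => i j; rewrite !mxE !(tnth_nth 0) coord_free ?(basis_free he) // eq_sym.
Qed.

Lemma coef_inj : injective (coef e).
Proof.
move=> a b /rowP ab; apply/lfunP => v.
rewrite (coord_basis he (memvf v)) !linear_sum; apply: eq_bigr => i _.
by rewrite !linearZ /=; have := ab i; rewrite !mxE !(tnth_nth 0) => ->.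
Qed.

Lemma coef_neq0 a : a != 0 -> coef e a != 0.
Proof.
apply: contraNneq => a0; apply/eqP/coef_inj; rewrite a0.
by apply/rowP => i; rewrite !mxE lfunE.
Qed.

Lemma coef_nprop a b (k : K) :
  a != 0 -> b != 0 -> lker a != lker b -> coef e b != k *: coef e a.
Proof.
move=> a0 b0; apply: contraNneq; rewrite -form_coefZ => /coef_inj bE.
by rewrite (form_prop_ker bE).
Qed.

End Basis.

Lemma basis_change l k (e : l.-tuple V) (e' : k.-tuple V) :
  basis_of {:V} e -> basis_of {:V} e' ->
  cmx e e' *m cmx e' e = 1%:M /\ cmx e' e *m cmx e e' = 1%:M.
Proof. by move=> he he'; rewrite !cmx_comp // !cmx_id. Qed.

Lemma der_app_lin l (th : Der K l) c : der_app th (lin c) = ev th c.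
Proof.
apply: eq_bigr => i _; rewrite /lin (raddf_sum (mderiv i)) /=.
have -> : \sum_j (c 0 j *: 'X_j)^`M(i) = (c 0 i)%:MP.
  rewrite (bigD1 i) //= mderivZ mderivX mnm1E eqxx big1 ?addr0 => [|j ji].
    by rewrite scale1r -{1}[U_(i)%MM]addm0 addmC addmK mpolyX0 alg_mpolyC.
  by rewrite mderivZ mderivX mnm1E (negPf ji) scale0r scaler0.
by rewrite mulrC mul_mpolyC.
Qed.

Lemma log_der_arr_mod l (e : l.-tuple V) (A : {fset {vspace V}}) m th :
  log_der e A m th <-> arr_mod (enum_fset A) (fun H => coef e (alpha H)) m th.
Proof.
split=> Dth H HA; have := Dth H HA; rewrite form_mpoly_lin der_app_lin;
  by move=> [g gE]; exists g.
Qed.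

End Forms.

(** * Change of coordinates for derivations *)

Section Transport.

Variables (K : fieldType) (l k : nat) (P : 'M[K]_(l, k)) (P' : 'M[K]_(k, l)).
Hypothesis PP' : P *m P' = 1%:M.

(** The entries are substituted by [P]; the components, which vary contragrediently to forms, are
    multiplied by the transpose of the inverse [P']. *)
Definition transport r (M : 'M[{mpoly K[l]}]_(r, l)) : 'M[{mpoly K[k]}]_(r, k) :=
  map_mx (lsub P) M *m map_mx (@mpolyC k K) P'^T.

Lemma ev_transport x c : ev (transport x) (c *m P) = lsub P (ev x c).
Proof.
rewrite !evE /transport.
have -> : \col_i ((c *m P) 0 i)%:MP = map_mx (@mpolyC k K) (c *m P)^T.
  by apply/colP => i; rewrite !mxE.
rewrite -mulmxA -map_mxM -trmx_mul -mulmxA PP' mulmx1 !mxE rmorph_sum /=.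
by apply: eq_bigr => i _; rewrite rmorphM /= !mxE lsubC.
Qed.

Lemma arr_mod_transport (T : eqType) (J : seq T) C m x :
  arr_mod J C m x -> arr_mod J (fun t => C t *m P) m (transport x).
Proof.
move=> Dx t /Dx [g gE]; rewrite ev_transport gE rmorphM rmorphXn /= lsub_lin.
by apply/rdvd_mulr/rdvd_refl.
Qed.

Lemma transport_mul r s (G : 'M[{mpoly K[l]}]_(s, r)) (M : 'M_(r, l)) :
  transport (G *m M) = map_mx (lsub P) G *m transport M.
Proof. by rewrite /transport map_mxM mulmxA. Qed.

Lemma transport_homog r (M : 'M[{mpoly K[l]}]_(r, l)) p :
  rows_homog p M -> rows_homog p (transport M).
Proof.
move=> hM i j; rewrite mxE; apply: rpred_sum => s _.
by rewrite !mxE mulrC mul_mpolyC; apply/rpredZ/lsub_homog.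
Qed.

End Transport.

Lemma transportK (K : fieldType) l k (P : 'M[K]_(l, k)) P' r
    (M : 'M[{mpoly K[l]}]_(r, l)) :
  P *m P' = 1%:M -> transport P' P (transport P P' M) = M.
Proof.
move=> PP'; rewrite /transport map_mxM -mulmxA.
have -> : map_mx (lsub P') (map_mx (@mpolyC k K) P'^T) = map_mx (@mpolyC l K) P'^T.
  by apply/matrixP => i j; rewrite !mxE lsubC.
rewrite -map_mxM -trmx_mul PP' trmx1 map_mx1 mulmx1.
by apply/matrixP => i j; rewrite !mxE /= lsub_comp PP' lsub1.
Qed.

Lemma mxbasis_transport (K : fieldType) l k (P : 'M[K]_(l, k)) P'
    (T : eqType) (J : seq T) C m r (M : 'M_(r, l)) :
  P *m P' = 1%:M -> P' *m P = 1%:M ->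
  mxbasis (arr_mod J C m) M ->
  mxbasis (arr_mod J (fun t => C t *m P) m) (transport P P' M).
Proof.
move=> PP' P'P bM; have [DM fM] := bM.
split=> [x|c cM].
  split=> [/(arr_mod_transport P'P) Dx|[c ->]].
    have /DM [c cE] : arr_mod J C m (transport P' P x).
      move=> t /(Dx t); rewrite -[C t *m P *m P']mulmxA PP' mulmx1 //.
    exists (map_mx (lsub P) c); rewrite -transport_mul -cE transportK //.
  have -> : c = map_mx (lsub P) (map_mx (lsub P') c).
    by apply/rowP => i; rewrite !mxE lsub_comp P'P lsub1.
  rewrite -transport_mul; apply: arr_mod_transport => //.
  by apply/DM; exists (map_mx (lsub P') c).
have c'0 : map_mx (lsub P') c = 0.
  apply: fM; have := transport_mul P' P c (transport P P' M).
  by rewrite cM transportK // => <-; rewrite /transport map_mx0 mul0mx.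
apply/rowP => i; have /rowP/(_ i) := c'0; rewrite !mxE => /(congr1 (lsub P)).
by rewrite lsub_comp P'P lsub1 raddf0.
Qed.

(** * Exponents in matrix form and in arbitrary coordinates *)

Section MatrixExponents.

Variables (K : fieldType).

Lemma is_basis_mx (S : idomainType) N r (D : 'rV[S]_N -> Prop) (B : seq 'rV[S]_N) :
  size B = r -> is_basis D B <-> mxbasis D (\matrix_(i < r) B`_i).
Proof.
move=> <-; split=> -[DB fB]; split.
- move=> x; rewrite DB; split=> -[c ->].
    exists (\row_i c i); rewrite mulmx_sum_row.
    by apply: eq_bigr => i _; rewrite rowK mxE.
  exists (c 0); rewrite mulmx_sum_row.
  by apply: eq_bigr => i _; rewrite rowK.
- move=> c cB; apply/rowP => i; rewrite mxE; apply: (fB (c 0)).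
  by rewrite -[RHS]cB mulmx_sum_row; apply: eq_bigr => j _; rewrite rowK.
- move=> x; rewrite DB; split=> -[c ->].
    exists (c 0); rewrite mulmx_sum_row.
    by apply: eq_bigr => i _; rewrite rowK.
  exists (\row_i c i); rewrite mulmx_sum_row.
  by apply: eq_bigr => i _; rewrite rowK mxE.
move=> c cB i; have /rowP/(_ i) : \row_i c i = 0; last by rewrite !mxE.
apply: fB; rewrite -[RHS]cB mulmx_sum_row.
by apply: eq_bigr => j _; rewrite rowK mxE.
Qed.

(** The length of [es] makes a basis fill a square matrix. Conversely the rows of a basis are
    nonzero, as [der_homog] demands. *)
Lemma free_with_expP (V : vectType K) l (e : l.-tuple V) A m (es : seq int) :
  size es = l -> free_with_exp e A m es <-> mx_exp (log_der e A m) es.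
Proof.
move=> ses; split.
  move=> [_ [B [ps [bB + ps_es]]]]; rewrite all2E => /andP [/eqP sB hB].
  have sps : size ps = l by rewrite -ses -(perm_size ps_es) size_map.
  have sBl : size B = l by rewrite -sB.
  exists (\matrix_(i < l) B`_i), (fun i => nth 0%N ps i); split.
  - exact/(is_basis_mx _ sBl).
  - move=> i j; rewrite mxE.
    have /(all_nthP (0%N, 0))/(_ (val i)) := hB.
    rewrite size_zip -sB minnn sps ltn_ord => /(_ isT).
    by rewrite nth_zip //= => /andP [_ /forallP/(_ j)].
  rewrite -(permPr ps_es) /degs.
  have -> : [seq (nth 0%N ps (val i))%:Z | i <- enum 'I_l] =
      [seq (nth 0%N ps i)%:Z | i <- [seq val i | i <- enum 'I_l]].
    by rewrite -map_comp.
  rewrite val_enum_ord -sps [X in perm_eq X _](map_comp Posz (nth 0%N ps)).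
  by rewrite map_nth_iota0 ?take_size.
move=> [M [p [bM hM pes]]].
pose B := [seq row i M | i <- enum 'I_l].
have sB : size B = l by rewrite size_map size_enum_ord.
have BM : \matrix_(i < l) B`_i = M.
  apply/row_matrixP => i; rewrite rowK (nth_map i) ?size_enum_ord //.
  by rewrite nth_ord_enum.
have bB : is_basis (log_der e A m) B by apply/(is_basis_mx _ sB); rewrite BM.
split; first by exists B.
exists B, [seq p i | i <- enum 'I_l]; split=> //; last by rewrite -map_comp.
rewrite /B; elim: (enum 'I_l) => //= i s ->; rewrite andbT.
apply/andP; split; last by apply/forallP => j; rewrite mxE; apply: hM.
apply/eqP => Mi; have /rowP/(_ i)/eqP : delta_mx 0 i = 0 :> 'rV[{mpoly K[l]}]_l.
  by apply: bM.2; rewrite -rowE.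
by rewrite !mxE !eqxx oner_eq0.
Qed.

Lemma mx_exp_ext k (D D' : 'rV[{mpoly K[k]}]_k -> Prop) es :
  (forall x, D x <-> D' x) -> mx_exp D es -> mx_exp D' es.
Proof.
by move=> DD' [M [p [bM hM pes]]]; exists M, p; split=> //; apply: mxbasis_ext bM.
Qed.

Lemma mx_exp_transport k (P P' : 'M[K]_k) (T : eqType) (J : seq T) C m es :
  P *m P' = 1%:M -> P' *m P = 1%:M ->
  mx_exp (arr_mod J C m) es -> mx_exp (arr_mod J (fun t => C t *m P) m) es.
Proof.
move=> PP' P'P [M [p [bM hM pes]]]; exists (transport P P' M), p; split=> //.
  exact: mxbasis_transport.
exact: transport_homog.
Qed.

Lemma arr_mod_ext k (T : eqType) (J : seq T) (C C' : T -> 'rV[K]_k) m m' x :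
  (forall t, t \in J -> C t = C' t) -> (forall t, t \in J -> m t = m' t) ->
  arr_mod J C m x <-> arr_mod J C' m' x.
Proof.
move=> CC mm; split=> Dx t tJ; first by rewrite -CC // -mm //; apply: Dx.
by rewrite CC // mm //; apply: Dx.
Qed.

(** The two bases of [V] are related by an invertible linear substitution, which preserves
    degrees. *)
Lemma free_with_exp_coords (V : vectType K) l (e e' : l.-tuple V) A m es :
  basis_of {:V} e -> basis_of {:V} e' -> size es = l ->
  free_with_exp e A m es <->
  mx_exp (arr_mod (enum_fset A) (fun H => coef e' (alpha H)) m) es.
Proof.
move=> he he' ses; have [ee' e'e] := basis_change he he'.
rewrite free_with_expP //; split=> [/(mx_exp_ext (log_der_arr_mod e A m))|].
  move=> /(mx_exp_transport ee' e'e); apply: mx_exp_ext => x.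
  by apply: arr_mod_ext => // H _; rewrite -coef_cmx.
move=> /(mx_exp_transport e'e ee'); apply: mx_exp_ext => x.
rewrite log_der_arr_mod.
by apply: arr_mod_ext => // H _; rewrite -coef_cmx.
Qed.

End MatrixExponents.

(** * Existence of the Euler multiplicity *)

Section EulerMultiplicity.

Variables (K : fieldType) (V : vectType K).
Variables (A : {fset {vspace V}}) (m : {vspace V} -> nat) (H0 H1 : {vspace V}).
Hypothesis hA : is_multiarrangement A m.
Hypotheses (H0A : H0 \in A) (H1A : H1 \in A) (H01 : H0 != H1).

Let X := (H0 :&: H1)%VS.

Lemma arr_alpha H : H \in A -> lker (alpha H) = H.
Proof.
by move=> /hA [/lker_form_exists [a aH] _]; apply: (alpha_ker_form aH).
Qed.

Lemma arr_alpha_neq0 H : H \in A -> alpha H != 0.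
Proof.
move=> HA; apply/eqP => a0; have := arr_alpha HA; have [+ _] := hA HA.
move=> dH HE; have HV : H = {:V}%VS.
  by apply/vspaceP => v; rewrite -HE a0 memv_ker lfunE eqxx memvf.
by move: dH; rewrite HV => /esym/n_Sn.
Qed.

Lemma arr_nsub H H' : H \in A -> H' \in A -> H != H' ->
  exists2 v, v \in H & v \notin H'.
Proof.
move=> HA H'A HH'; apply/subvPn; apply: contra HH' => HsH'.
by rewrite eqEdim HsH' -ltnS (hA HA).1 -(hA H'A).1 ltnSn.
Qed.

Lemma dim_pencil : (\dim X).+2 = \dim {:V}.
Proof.
have [v vH0 vH1] := arr_nsub H0A H1A H01.
have [d0 _] := hA H0A; have [d1 _] := hA H1A.
have := dimv_sum_cap H0 H1; rewrite -/X.
have : (\dim (H0 + H1) <= \dim {:V})%N by apply/dimvS/subvf.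
have : (\dim H1 < \dim (H0 + H1))%N.
  rewrite ltn_neqAle dimvS ?addvSr // andbT dimv_leqif_eq ?addvSr //.
  by apply: contraNneq vH1 => ->; rewrite (subvP (addvSl _ _)).
lia.
Qed.

Section Pencil.

Variables (i0 i1 : 'I_(\dim {:V})) (e : (\dim {:V}).-tuple V).
Hypotheses (i0E : val i0 = 0%N) (i1E : val i1 = 1%N).
Hypotheses (he : basis_of {:V} e) (eX : X = <<drop 2 e>>%VS).

Let J := enum_fset (localization A X).
Let C H := coef e (alpha H).

Lemma mem_localization H : (H \in J) = (H \in A) && (X <= H)%VS.
Proof. by rewrite [LHS](_ : _ = (H \in localization A X)) // !inE. Qed.

Lemma pencil_i01 : i0 != i1.
Proof. by apply/eqP => /(congr1 val); rewrite i0E i1E. Qed.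

Lemma pencil_supp H i : H \in J -> i != i0 -> i != i1 -> C H 0 i = 0.
Proof.
rewrite mem_localization => /andP [HA XH]; rewrite -!val_eqE /= i0E i1E => ni0 ni1.
have i2 : (2 <= i)%N by move: ni0 ni1; case: (nat_of_ord i) => [|[|j]].
suff : tnth e i \in lker (alpha H) by rewrite memv_ker mxE => /eqP.
rewrite arr_alpha //; apply: (subvP XH).
rewrite eX; apply: memv_span; rewrite (tnth_nth 0) -(subnKC i2) -nth_drop.
by apply: mem_nth; rewrite size_drop size_tuple ltn_sub2r // (leq_ltn_trans i2).
Qed.

Lemma pencil_C0 H : H \in J -> C H != 0.
Proof.
rewrite mem_localization => /andP [HA _].
exact: (coef_neq0 he (arr_alpha_neq0 HA)).
Qed.

Lemma pencil_CJ H H' k : H \in J -> H' \in J -> H != H' -> C H' != k *: C H.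
Proof.
rewrite !mem_localization => /andP [HA _] /andP [H'A _] HH'.
by apply: (coef_nprop he); rewrite ?arr_alpha_neq0 // !arr_alpha.
Qed.

Lemma pencil_transverse : [seq partial K i | i <- transverse i0 i1] =
  [seq partial K i | i : 'I_(\dim {:V}) <- enum 'I_(\dim {:V}) & (2 <= i)%N].
Proof.
congr (map _ _); apply: eq_filter => i; rewrite -!val_eqE /= i0E i1E.
by case: (val i) => [|[|j]].
Qed.

Lemma pencil_basis B : is_basis (log_der e (localization A X) m) B <->
  is_basis (arr_mod J C m) B.
Proof.
split=> -[DB fB]; split=> // x; rewrite -DB; [symmetry|]; exact: log_der_arr_mod.
Qed.

End Pencil.

Lemma euler_degree_exists : exists d, is_euler_degree A m H0 X d.
Proof.
have dX := dim_pencil; have [v1 v1H0 v1H1] := arr_nsub H0A H1A H01.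
have [v0 _ v0H0] : exists2 v, v \in {:V}%VS & v \notin H0.
  by apply/subvPn/negP => /dimvS; have [<- _] := hA H0A; rewrite ltnn.
(* [v0] lies outside [H0], and [v1] in [H0] outside [H1]; they complete a basis of [X], which starts
   at the third position as [is_euler_degree] asks. *)
have se : size [:: v0, v1 & vbasis X] == \dim {:V} by rewrite /= size_tuple dX.
pose e := Tuple se.
have sX : <<vbasis X>>%VS = X := span_basis (vbasisP X).
have he : basis_of {:V} e.
  rewrite basisEfree subvf /= size_tuple dX leqnn andbT.
  rewrite !free_cons (basis_free (vbasisP X)) andbT sX; apply/andP; split.
    apply: contra v0H0; apply/subvP; rewrite span_cons sX subv_add capvSl andbT.
    by rewrite -memvE.
  by rewrite memv_cap negb_and v1H1 orbT.
have lt0 : (0 < \dim {:V})%N by rewrite -dX.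
have lt1 : (1 < \dim {:V})%N by rewrite -dX.
pose i0 := Ordinal lt0; pose i1 := Ordinal lt1.
have eX : X = <<drop 2 e>>%VS by rewrite /= drop0 sX.
have i0E : val i0 = 0%N by []. have i1E : val i1 = 1%N by [].
have H0J : H0 \in enum_fset (localization A X).
  by rewrite mem_localization H0A capvSl.
have [p [q [x [y [bas [x0 hx] [y0 hy] xL [z yL]]]]]] :=
  local_adapted_basis (pencil_i01 i0E i1E) (fset_uniq _)
    (pencil_supp i0E i1E eX) (pencil_C0 he) (pencil_CJ he) H0J (hA H0A).2.
exists p, e, x, y, q; split=> //.
- by rewrite -(pencil_transverse i0E i1E); apply/pencil_basis.
- by split; apply/andP; split=> //; apply/forallP.
- by move=> [w xE]; apply: xL; exists w; rewrite -form_mpoly_lin.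
by exists z; rewrite form_mpoly_lin.
Qed.

Lemma euler_multP : is_euler_degree A m H0 X (euler_mult A m H0 X).
Proof. exact: (epsilon_spec _ _ euler_degree_exists). Qed.

End EulerMultiplicity.

(** * The triple in coordinates adapted to [H0] *)

Section Restriction.

Variables (K : fieldType) (V : vectType K) (n : nat).
Variables (A : {fset {vspace V}}) (m : {vspace V} -> nat) (H0 : {vspace V}).
Variable (e0 : n.-tuple (subvs_of H0)).
Hypothesis hV : \dim {:V} = n.+1.
Hypothesis hA : is_multiarrangement A m.
Hypothesis H0A : H0 \in A.
Hypothesis he0 : basis_of {:subvs_of H0} e0.
Variable v0 : V.
Hypothesis v0H0 : v0 \notin H0.

Local Notation J := (enum_fset A).
Local Notation W := (subvs_of H0).
Let inj : 'Hom(W, V) := linfun (vsval : W -> V).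

(* In these coordinates the form of [H0] is a multiple of the first variable. *)
Definition adapted_tuple : n.+1.-tuple V := [tuple of v0 :: map_tuple vsval e0].
Local Notation eh := adapted_tuple.

Lemma adapted_basis : basis_of {:V} eh.
Proof.
rewrite basisEfree subvf size_tuple hV leqnn !andbT free_cons; apply/andP; split.
  apply: contra v0H0; apply/subvP/span_subvP => _ /mapP [w _ ->]; exact: subvsP.
apply/(@freeP _ _ _ (map_tuple vsval e0)) => k k0.
have /freeP := basis_free he0; apply; apply: subvs_inj; rewrite -[RHS]k0.
rewrite raddf_sum /=; apply: eq_bigr => i _.
by rewrite (nth_map 0) ?size_tuple.
Qed.

Lemma coef_restr (a : 'Hom(V, K^o)) :
  coef eh a *m restr_mx K n = coef e0 (a \o inj)%VF.
Proof.
rewrite mul_restr_mx; apply/rowP => j; rewrite !mxE comp_lfunE lfunE /=.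
by rewrite !(tnth_nth 0) /= (nth_map 0) !add0n ?size_tuple.
Qed.

Lemma lker_restr (a : 'Hom(V, K^o)) : lker (a \o inj)%VF = trace_on H0 (lker a).
Proof.
by apply/vspaceP => w; rewrite /trace_on -memv_preim !memv_ker comp_lfunE.
Qed.

Let C H := coef eh (alpha H).
Let tr := trace_on H0.

Lemma mem_rem_arr H : (H \in rem H0 J) = (H != H0) && (H \in A).
Proof. by rewrite mem_rem_uniq ?fset_uniq. Qed.

Lemma adapted_c00 : C H0 0 ord0 != 0.
Proof.
have : v0 \notin lker (alpha H0) by rewrite (arr_alpha hA).
by rewrite memv_ker mxE (tnth_nth 0).
Qed.

Lemma adapted_c0S j : C H0 0 (lift ord0 j) = 0.
Proof.
have : vsval (e0`_j) \in lker (alpha H0) by rewrite (arr_alpha hA) ?subvsP.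
rewrite memv_ker => /eqP; rewrite mxE (tnth_nth 0) /= (nth_map 0) !add0n ?size_tuple //.
Qed.

Lemma arr_C0 H : H \in J -> C H != 0.
Proof. by move=> HA; apply: (coef_neq0 adapted_basis); apply: (arr_alpha_neq0 hA). Qed.

Lemma arr_CJ H H' k : H \in J -> H' \in J -> H != H' -> C H' != k *: C H.
Proof.
move=> HA H'A HH'; apply: (coef_nprop adapted_basis); rewrite ?(arr_alpha_neq0 hA) //.
by rewrite !(arr_alpha hA).
Qed.

Lemma restr_form_neq0 H : H \in A -> H != H0 -> (alpha H \o inj)%VF != 0.
Proof.
move=> HA HH0; have [|u uH0 uH] := arr_nsub hA H0A HA; first by rewrite eq_sym.
apply: contra uH => /eqP a0; rewrite -(arr_alpha hA HA) memv_ker.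
have := congr1 (fun f : 'Hom(W, K^o) => f (vsproj H0 u)) a0.
by rewrite comp_lfunE !lfunE /= vsprojK // => ->.
Qed.

Lemma alpha_trace H : H \in A -> H != H0 -> lker (alpha (tr H)) = tr H.
Proof.
move=> HA HH0; apply: (@alpha_ker_form _ _ (alpha H \o inj)%VF).
by rewrite lker_restr (arr_alpha hA).
Qed.

Lemma alpha_trace_neq0 H : H \in A -> H != H0 -> alpha (tr H) != 0.
Proof.
move=> HA HH0; apply: contra (restr_form_neq0 HA HH0) => /eqP a0.
apply/eqP/lfunP => w; apply/eqP; rewrite [X in _ == X]lfunE /= -memv_ker.
rewrite lker_restr (arr_alpha hA) // -/(tr H) -(alpha_trace HA HH0) a0.
by rewrite memv_ker lfunE.
Qed.

(** The form chosen for the trace of [H] and the restriction to [H0] of the form of [H] have the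
    same kernel, hence differ by this scalar. *)
Definition trace_scale H : K :=
  epsilon (inhabits 0) (fun k => (alpha H \o inj)%VF = k *: alpha (tr H)).

Lemma trace_scaleP H : H \in A -> H != H0 ->
  trace_scale H != 0 /\
  C H *m restr_mx K n = trace_scale H *: coef e0 (alpha (tr H)).
Proof.
move=> HA HH0.
have kE : (alpha H \o inj)%VF = trace_scale H *: alpha (tr H).
  apply: (epsilon_spec (inhabits 0) (fun k => _ = k *: alpha (tr H))).
  apply: form_prop; last exact: alpha_trace_neq0.
  by rewrite alpha_trace // lker_restr (arr_alpha hA).
split; last by rewrite coef_restr kE form_coefZ.
by apply: contraNneq (restr_form_neq0 HA HH0) => k0; rewrite kE k0 scale0r.
Qed.

Lemma img_trace H : (inj @: tr H)%VS = (H0 :&: H)%VS.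
Proof.
apply/vspaceP => v; rewrite memv_cap; apply/memv_imgP/andP => [[w wH ->]|[vH0 vH]].
  by rewrite {1}lfunE /= subvsP memv_preim.
exists (vsproj H0 v); first by rewrite -memv_preim lfunE /= vsprojK.
by rewrite lfunE /= vsprojK.
Qed.

(** An inclusion between kernels of nonzero forms is an equality. Apart from [H0], the localizations
    are thus the fibres of [tr]. *)
Lemma trace_sub H1 H : H1 \in A -> H1 != H0 -> H \in A -> H != H0 ->
  (H0 :&: H1 <= H)%VS = (tr H == tr H1).
Proof.
move=> H1A H10 HA HH0; apply/idP/eqP => [XH|HH1]; last first.
  by rewrite -img_trace -HH1 img_trace capvSr.
have : (lker (alpha (tr H1)) <= lker (alpha (tr H)))%VS.
  rewrite !alpha_trace //; apply/subvP => w; rewrite -!memv_preim => wH1.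
  by apply: (subvP XH); rewrite memv_cap wH1 lfunE /= subvsP.
move=> /form_prop [|k kE]; first exact: alpha_trace_neq0.
rewrite -(alpha_trace HA HH0) -(alpha_trace H1A H10).
by apply: (form_prop_ker kE); apply: alpha_trace_neq0.
Qed.

Local Notation J2 := (enum_fset (restriction A H0)).
Local Notation C2 := (fun X : {vspace W} => coef e0 (alpha X)).
Local Notation m2 := (restriction_mult A m H0).
Let N X := (\sum_(H <- rem H0 J | tr H == X) m H)%N.

Lemma trace_mem H : H \in rem H0 J -> tr H \in J2.
Proof.
rewrite mem_rem_arr => /andP [HH0 HA].
rewrite -[_ \in _]/(tr H \in restriction A H0).
by apply/imfsetP; exists H => //=; rewrite !inE HH0.
Qed.

Lemma trace_surj X : X \in J2 -> exists2 H, H \in rem H0 J & tr H = X.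
Proof.
rewrite -[_ \in _]/(X \in restriction A H0) => /imfsetP [H /= HA ->].
by exists H => //; move: HA; rewrite mem_rem_arr !inE.
Qed.

Lemma restr_C20 X : X \in J2 -> C2 X != 0.
Proof.
move=> /trace_surj [H]; rewrite mem_rem_arr => /andP [HH0 HA] <-.
exact: (coef_neq0 he0 (alpha_trace_neq0 HA HH0)).
Qed.

Lemma restr_C2J X Y k : X \in J2 -> Y \in J2 -> X != Y -> C2 Y != k *: C2 X.
Proof.
move=> /trace_surj [H]; rewrite mem_rem_arr => /andP [HH0 HA] <-.
move=> /trace_surj [H']; rewrite mem_rem_arr => /andP [H'H0 H'A] <- XY.
by apply: (coef_nprop he0); rewrite ?alpha_trace_neq0 // !alpha_trace.
Qed.

(** The coordinates that witness the Euler multiplicity are unrelated to the adapted ones, so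
    derivations are transported to them before [euler_degree_bounds] applies. *)
Lemma restriction_bounds H1 : H1 \in A -> H1 != H0 ->
  [/\ (m2 (tr H1) <= N (tr H1))%N,
    forall th, arr_mod J C m th ->
      rdvd (lin (C2 (tr H1)) ^+ m2 (tr H1)) (lsub (restr_mx K n) (ev th (C H1))) &
    forall th h, arr_mod J C m (lin (C H0) *: th) ->
      lin (C H0) * ev th (C H0) = lin (C H0) ^+ m H0 * h ->
      rdvd (lin (C2 (tr H1)) ^+ (N (tr H1) - m2 (tr H1))) (lsub (restr_mx K n) h)].
Proof.
move=> H1A H10; have H01 : H0 != H1 by rewrite eq_sym.
have := euler_multP hA H0A H1A H01; rewrite -img_trace -/(m2 (tr H1)).
move: (m2 (tr H1)) => d; rewrite img_trace.
move=> [e' [x [y [p [[he' eX] bas [/andP [_ /forallP hx] _] _ [z yE]]]]]].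
have lt0 : (0 < \dim {:V})%N by rewrite -(dim_pencil hA H0A H1A H01).
have lt1 : (1 < \dim {:V})%N by rewrite -(dim_pencil hA H0A H1A H01).
pose i0 := Ordinal lt0; pose i1 := Ordinal lt1.
have i0E : val i0 = 0%N by []. have i1E : val i1 = 1%N by [].
pose JX := enum_fset (localization A (H0 :&: H1)%VS).
have JXE H : (H \in JX) = (H \in A) && (H0 :&: H1 <= H)%VS by apply: mem_localization.
have H0J : H0 \in JX by rewrite JXE H0A capvSl.
have H1J : H1 \in JX by rewrite JXE H1A capvSr.
pose P := cmx e' eh; pose P' := cmx eh e'.
have [PP' P'P] : P *m P' = 1%:M /\ P' *m P = 1%:M.
  exact: basis_change he' adapted_basis.
pose C' H := coef e' (alpha H).
have C'P H : C' H *m P = C H by rewrite -coef_cmx.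
have CP' H : C H *m P' = C' H by rewrite -(coef_cmx adapted_basis).
(* Passage to the adapted coordinates followed by restriction to [H0]. *)
pose f := lsub (P *m restr_mx K n).
have fP' q : f (lsub P' q) = lsub (restr_mx K n) q.
  by rewrite /f lsub_comp mulmxA P'P mul1mx.
have f_ker q : f q = 0 <-> rdvd (lin (C' H0)) q.
  rewrite /f -lsub_comp; apply: (iff_trans (rho_ker adapted_c00 adapted_c0S _)).
  split=> -[g gE].
    exists (lsub P' g); have := congr1 (lsub P') gE.
    by rewrite rmorphM /= lsub_lin CP' lsub_comp PP' lsub1.
  by exists (lsub P g); rewrite gE rmorphM /= lsub_lin C'P.
have f_lin H : H \in JX -> H != H0 ->
    trace_scale H != 0 /\ f (lin (C' H)) = trace_scale H *: lin (C2 (tr H1)).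
  rewrite JXE => /andP [HA XH] HH0; have [k0 kE] := trace_scaleP HA HH0.
  split=> //; rewrite /f lsub_lin mulmxA C'P kE linearZ /=.
  by move: XH; rewrite trace_sub // => /eqP ->.
have f_homog q r : q \is r.-homog -> f q \is r.-homog by apply: lsub_homog.
have H1J2 : tr H1 \in J2 by apply: trace_mem; rewrite mem_rem_arr H10.
move: bas; rewrite -(pencil_transverse i0E i1E) => /pencil_basis bas.
have yE' : exists z, y = lin (C' H0) *: z by exists z; rewrite yE form_mpoly_lin.
have [dN F1 F2] := euler_degree_bounds (pencil_i01 i0E i1E) (fset_uniq _)
  (pencil_supp hA i0E i1E eX) (pencil_C0 hA he') (pencil_CJ hA he')
  H0J H1J H01 (restr_C20 H1J2) f_homog f_ker f_lin bas hx yE'.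
(* The hyperplanes over the trace of [H1] are those of the localization other than [H0]. *)
have NE : N (tr H1) = (\sum_(H <- rem H0 JX) m H)%N.
  rewrite /N -big_filter; apply: perm_big; apply: uniq_perm.
  - by rewrite filter_uniq ?rem_uniq ?fset_uniq.
  - by rewrite rem_uniq ?fset_uniq.
  move=> H; rewrite mem_filter mem_rem_arr mem_rem_uniq ?fset_uniq // inE /= JXE.
  have [->|HH0] /= := eqVneq H H0; first by rewrite andbF.
  by have [HA|HA] /= := boolP (H \in A); rewrite ?andbF // andbT trace_sub.
have D_JX th : arr_mod J C m th -> arr_mod JX C' m (transport P' P th).
  move=> /(arr_mod_transport P'P) Dth H; rewrite JXE => /andP [HA _].
  by have := Dth H HA; rewrite CP'.
have evE' th H : ev (transport P' P th) (C' H) = lsub P' (ev th (C H)).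
  by rewrite -CP' (ev_transport P'P).
rewrite -NE in dN F2; split=> // [th /D_JX/F1|th h /D_JX Dth hE].
  by rewrite evE' -[X in rdvd _ X]/(f (lsub P' (ev th (C H1)))) fP'.
rewrite -fP'; apply: (F2 (transport P' P th)).
  suff <- : transport P' P (lin (C H0) *: th) = lin (C' H0) *: transport P' P th by [].
  rewrite /transport scalemxAl -CP' -lsub_lin; congr (_ *m _).
  by apply/rowP => i; rewrite !mxE rmorphM.
have := congr1 (lsub P') hE; rewrite evE' !rmorphM rmorphXn /= lsub_lin.
by rewrite CP'.
Qed.

Let m' := deletion_mult m H0.

(** When [H0] is deleted, [deletion_mult] is 0 there, so keeping [H0] in the list imposes an empty
    condition and one index set serves both modules. *)
Lemma deletion_arr_mod (th : 'rV_n.+1) :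
  arr_mod (enum_fset (deletion A m H0)) C (deletion_mult m H0) th <->
  arr_mod J C (deletion_mult m H0) th.
Proof.
rewrite /deletion; case: eqP => // m1; split=> Dth H HA.
  have [->|HH0] := eqVneq H H0.
    by rewrite /deletion_mult eqxx m1 expr0; apply: rdvd1r.
  by apply: Dth; rewrite -[_ \in _]/(H \in A `\ H0) !inE HH0.
by apply: Dth; move: HA; rewrite -[_ \in _]/(H \in A `\ H0) !inE => /andP [].
Qed.

Let D := arr_mod J C m.
Let D' := arr_mod J C m'.
Let D2 := arr_mod J2 C2 m2.

Lemma restriction_addition_deletion (d : seq int) (dl : int) :
  [/\ mx_exp D (rcons d dl) -> mx_exp D' (rcons d (dl - 1)) -> mx_exp D2 d,
      mx_exp D (rcons d dl) -> mx_exp D2 d -> mx_exp D' (rcons d (dl - 1)) &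
      mx_exp D' (rcons d (dl - 1)) -> mx_exp D2 d -> mx_exp D (rcons d dl)].
Proof.
have mH0 : m H0 = (m' H0).+1.
  by rewrite /m' /deletion_mult eqxx prednK //; have [] := hA H0A.
have mm' H : H != H0 -> m H = m' H by rewrite /m' /deletion_mult => /negPf ->.
have tr_lin H : H \in rem H0 J ->
    trace_scale H != 0 /\ C H *m restr_mx K n = trace_scale H *: C2 (tr H).
  by rewrite mem_rem_arr => /andP [HH0 HA]; apply: trace_scaleP.
have m2N X : X \in J2 -> (m2 X <= N X)%N.
  move=> /trace_surj [H]; rewrite mem_rem_arr => /andP [HH0 HA] <-.
  by have [] := restriction_bounds HA HH0.
have D_restr th H : D th -> H \in rem H0 J ->
    rdvd (lin (C2 (tr H)) ^+ m2 (tr H)) (lsub (restr_mx K n) (ev th (C H))).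
  rewrite mem_rem_arr => Dth /andP [HH0 HA].
  by have [_ + _] := restriction_bounds HA HH0; apply.
have D'_restr th h X : D' th -> X \in J2 ->
    ev th (C H0) = lin (C H0) ^+ m' H0 * h ->
    rdvd (lin (C2 X) ^+ (N X - m2 X)) (lsub (restr_mx K n) h).
  move=> D'th /trace_surj [H]; rewrite mem_rem_arr => /andP [HH0 HA] <- hE.
  have [_ _ F2] := restriction_bounds HA HH0; apply: (F2 th); last by rewrite hE mH0 exprS mulrA.
  by apply/(D_mulx adapted_c00 arr_C0 arr_CJ H0A erefl mH0 mm').
split.
- exact: (triple_restriction_exp adapted_c00 adapted_c0S (fset_uniq _) arr_C0 arr_CJ
    H0A erefl mH0 mm' (fset_uniq _) restr_C20 restr_C2J trace_mem trace_surj
    tr_lin m2N D_restr D'_restr).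
- exact: (triple_deletion_exp adapted_c00 adapted_c0S (fset_uniq _) arr_C0 arr_CJ
    H0A erefl mH0 mm' (fset_uniq _) restr_C20 restr_C2J trace_mem trace_surj
    tr_lin m2N D_restr D'_restr).
exact: (triple_addition_exp adapted_c00 adapted_c0S (fset_uniq _) arr_C0 arr_CJ
    H0A erefl mH0 mm' (fset_uniq _) restr_C20 restr_C2J trace_mem trace_surj
    tr_lin m2N D_restr D'_restr).
Qed.

End Restriction.

Theorem theorem0p8 (K : fieldType) (l : nat) (V : vectType K)
    (A : {fset {vspace V}}) (m : {vspace V} -> nat) (H0 : {vspace V})
    (e : l.-tuple V) (e0 : l.-1.-tuple (subvs_of H0))
    (d : l.-1.-tuple int) (dl : int)
    (hl : (2 <= l)%N) (hV : \dim {:V} = l)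
    (hA : is_multiarrangement A m) (hH0 : H0 \in A)
    (he : basis_of {:V} e) (he0 : basis_of {:subvs_of H0} e0) :
  let i := free_with_exp e A m (rcons d dl) in
  let ii := free_with_exp e (deletion A m H0) (deletion_mult m H0)
              (rcons d (dl - 1)) in
  let iii := free_with_exp e0 (restriction A H0)
               (restriction_mult A m H0) d in
  [/\ i -> ii -> iii, i -> iii -> ii & ii -> iii -> i].
Proof.
case: l e e0 d hl hV he he0 => [//|n] e e0 d _ hV he he0 i ii iii.
have [v0 _ v0H0] : exists2 v, v \in {:V}%VS & v \notin H0.
  by apply/subvPn/negP => /dimvS; have [<- _] := hA H0 hH0; rewrite ltnn.
(* Statements (i) and (ii) are moved to the basis of [V] that extends [e0] by [v0]; (iii) stays in
   [e0]. *)
have heh := adapted_basis hV he0 v0H0.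
have sr (a : int) : size (rcons d a) = n.+1 by rewrite size_rcons size_tuple.
have iE : i <-> mx_exp (arr_mod (enum_fset A)
    (fun H => coef (adapted_tuple e0 v0) (alpha H)) m) (rcons d dl).
  exact: free_with_exp_coords.
have iiE : ii <-> mx_exp (arr_mod (enum_fset A)
    (fun H => coef (adapted_tuple e0 v0) (alpha H)) (deletion_mult m H0))
    (rcons d (dl - 1)).
  rewrite /ii (free_with_exp_coords _ _ he heh) //.
  split; apply: mx_exp_ext => x; [|symmetry]; exact: deletion_arr_mod.
have iiiE : iii <-> mx_exp (arr_mod (enum_fset (restriction A H0))
    (fun X => coef e0 (alpha X)) (restriction_mult A m H0)) d.
  by apply: free_with_exp_coords; rewrite ?size_tuple.
have [res del add] := restriction_addition_deletion hV hA hH0 he0 v0H0 d dl.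
split=> [/iE iP /iiE iiP|/iE iP /iiiE iiiP|/iiE iiP /iiiE iiiP].
- by apply/iiiE/res.
- by apply/iiE/del.
by apply/iE/add.
Qed.
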